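(* No quadratic $x_3$-graph can be the support of a $3$-uniform measure. That is, for every symmetric real $2\times2$ matrix $S$, the set $\{(z,x_3)\in\mathbb{R}^2\times\mathbb{R}: x_3=\langle z,Sz\rangle\}\subset\mathbb{H}$ is not the support of any $3$-uniform measure on $(\mathbb{H},d_H)$.
   Context: The first Heisenberg group $\mathbb{H}$ is $\mathbb{R}^3$ with the group law $(x_1,x_2,x_3)*(y_1,y_2,y_3)=(x_1+y_1,\,x_2+y_2,\,x_3+y_3-2x_1y_2+2x_2y_1)$. It is equipped with the Korányi metric $d_H(x,y)=\|x^{-1}*y\|_H$, where $\|(x_1,x_2,x_3)\|_H^4=(x_1^2+x_2^2)^2+x_3^2$. $B_H(x,r)$ is the closed $d_H$-ball with center $x$ and radius $r$. A nonzero Borel measure $\mu$ on $\mathbb{H}$ is $3$-uniform if there is a constant $c>0$ such that $\mu(B_H(x,r))=cr^3$ for all $x\in\operatorname{spt}\mu$ and all $r>0$. A quadratic $x_3$-graph is the graph over the $x_1x_2$-plane of a quadratic form in the variables $z=(x_1,x_2)$; $\langle\cdot,\cdot\rangle$ is the Euclidean inner product on $\mathbb{R}^2$. *)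

(* Defs.v *)
From HB Require Import structures.
From mathcomp Require Export all_boot all_order all_algebra.
From mathcomp Require Export all_classical all_reals all_analysis.
From mathcomp Require Import ring lra.

Set Implicit Arguments.
Unset Strict Implicit.
Unset Printing Implicit Defensive.

Import Order.TTheory GRing.Theory Num.Theory.

Local Open Scope classical_set_scope.
Local Open Scope ring_scope.

Notation heis R := (R * R * R)%type.

Section Heisenberg.
Variable R : realType.
Implicit Types x y z : heis R.

Definition heis0 : heis R := (0, 0, 0).

Definition heis_mul x y : heis R :=
  (x.1.1 + y.1.1, x.1.2 + y.1.2,
   x.2 + y.2 - 2 * x.1.1 * y.1.2 + 2 * x.1.2 * y.1.1).

Definition heis_inv x : heis R := (- x.1.1, - x.1.2, - x.2).

Lemma heis_mulA : associative heis_mul.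
Proof.
by move=> [[a b] c] [[d e] f] [[g h] i]; congr (_, _, _) => /=; ring.
Qed.

Lemma heis_mul0x : left_id heis0 heis_mul.
Proof. by move=> [[a b] c]; congr (_, _, _) => /=; ring. Qed.

Lemma heis_mulVx : left_inverse heis0 heis_inv heis_mul.
Proof. by move=> [[a b] c]; congr (_, _, _) => /=; ring. Qed.

Definition koranyi_norm x : R :=
  Num.sqrt (Num.sqrt ((x.1.1 ^+ 2 + x.1.2 ^+ 2) ^+ 2 + x.2 ^+ 2)).

Lemma koranyi_norm_ge0 x : 0 <= koranyi_norm x.
Proof. exact: sqrtr_ge0. Qed.

Lemma koranyi_norm4 x :
  koranyi_norm x ^+ 4 = (x.1.1 ^+ 2 + x.1.2 ^+ 2) ^+ 2 + x.2 ^+ 2.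
Proof.
rewrite (exprM _ 2 2) !sqr_sqrtr ?sqrtr_ge0 //.
by rewrite addr_ge0 ?sqr_ge0.
Qed.

Definition koranyi_dist x y : R := koranyi_norm (heis_mul (heis_inv x) y).

Definition koranyi_ball x (r : R) : set (heis R) :=
  [set y | koranyi_dist x y <= r].

Definition koranyi_open : set (set (heis R)) :=
  [set U | forall x, U x ->
     exists2 r : R, 0 < r & [set y | koranyi_dist x y < r] `<=` U].

(* The carrier of the Heisenberg group with the Borel sigma-algebra of its
   metric; not to be confused with the product sigma-algebra that the library
   attaches to R * R * R. *)
Definition heis_borel := g_sigma_algebraType koranyi_open.

Definition spt (mu : {measure set heis_borel -> \bar R}) : set (heis R) :=
  [set x | forall r : R, 0 < r -> (0 < mu (koranyi_ball x r))%E].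

Definition uniform_measure (m : nat)
    (mu : {measure set heis_borel -> \bar R}) : Prop :=
  mu setT <> 0%E /\
  exists2 c : R, 0 < c &
    forall x, spt mu x -> forall r : R, 0 < r ->
      mu (koranyi_ball x r) = (c * r ^+ m)%:E.

Definition inner (u v : 'cV[R]_2) : R := \sum_(i < 2) u i 0 * v i 0.

Definition horizontal x : 'cV[R]_2 :=
  \col_(i < 2) (if i == 0 then x.1.1 else x.1.2).

Definition quadratic_graph (S : 'M[R]_2) : set (heis R) :=
  [set x | x.2 = inner (horizontal x) (S *m horizontal x)].

End Heisenberg.

Arguments heis_borel R : clear implicits.

(* Main.v *)
(** Write J for the rotation by a right angle, A = S + J and, for points z and w of the
    plane, P z w for the fourth power of the distance between the points of the graph
    above z and w.  A 3-uniform measure carried by the graph projects to a measure nu of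
    the plane such that the P-ball of radius r^4 about any z has mass c r^3, hence
    int e^(- P z w / r^4) dnu(w) = K r^3 for every z and r.  Near a point where A z <> 0
    the form P is, after an anisotropic dilation, close to s^4 + u^2; integrating the
    kernel e^(- P z w / r^4) against |A z| e^(- P x z) dz dnu(w) in both orders and letting
    r tend to 0 shows that the potential
      V x = int |A z| e^(- P x z) dz
    does not depend on x and is half the integral of e^(- s^4 - u^2); the zeros of A are
    harmless because they form a nu-null set.

    Expanding V at infinity in the direction z to second order gives q^2 = 2 + 8 m, where
    q = <S t, t> and m = <S t, J t> for the unit vector t with A z parallel to J t.  If A
    is singular the only such t has q = 0 and m = 1, which is absurd.  If A is invertible
    every t is allowed, and four of them force S = a I with a^2 = 2; this last case is
    excluded by expanding V at the origin to second order. *)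

From HB Require Import structures.
Require Import Defs.
From mathcomp Require Import ring lra measurable_realfun.

Set Implicit Arguments.
Unset Strict Implicit.
Unset Printing Implicit Defensive.

Import Order.TTheory GRing.Theory Num.Theory.

Local Open Scope classical_set_scope.
Local Open Scope ring_scope.

(** * Measures and integrals on the plane *)

Section affine_change_of_variables.
Context {R : realType}.
Local Notation leb := (@lebesgue_measure R).
Local Notation leb2 := (leb \x leb)%E.
Implicit Types (F : R -> \bar R) (G : R * R -> \bar R).

(** The measure nu is never identified: no differentiation theorem is used, only the values of its
    integrals of e^(- P z w / r^4). The weight |A z| is chosen because the dilation at z, by r along
    t and by r^2 / (2 |A z|) across it, has Jacobian r^3 / (2 |A z|). The factors |A z| cancel, so
    the rescaled kernel has the same limiting mass at every z with A z <> 0. Both orders of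
    integration carry the unknown constant K, which cancels too, and a statement about Lebesgue
    integrals that involves S alone remains.

    At infinity the second-order coefficient is made of moments of e^(- s^4 - u^2); dilation
    identities reduce them all to one, and the third coefficient of S in the frame drops out. These
    tests cannot be the end: for S = a I one has q = a and m = 0 in every direction, so a^2 = 2
    passes all of them. At the origin this S makes P and |A .| radial. The sum of the second
    variations in two orthogonal directions is then a combination of two radial integrals, which
    homogeneity shows to be six times a positive number instead of zero. *)

Lemma measurable_affine (a b : R) :
  measurable_fun [set: R] (fun x : R => a * x + b : R).
Proof. by apply: measurable_funD => //; exact: measurable_funM. Qed.

(** For positive [a] the pushforward of Lebesgue measure, scaled by [a], agrees with it on half-open
    intervals, hence everywhere. Negative [a] is reduced to this case by reflection. *)
Lemma ge0_integral_affine F (a b : R) : a != 0 ->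
  measurable_fun setT F -> (forall x, 0 <= F x)%E ->
  (\int[leb]_x F (a * x + b)%R = `|a|^-1%:E * \int[leb]_x F x)%E.
Proof.
move=> a0 mF F0.
wlog apos : a F a0 mF F0 / 0 < a.
  move=> H; case: (ltrP 0 a) => [|a_le0]; first exact: H.
  have alt0 : a < 0 by rewrite lt_neqAle a0.
  transitivity (\int[leb]_x F ((- a) * x + b)%R)%E; last first.
    by rewrite H ?oppr_eq0 ?oppr_gt0 ?normrN.
  transitivity (\int[pushforward leb (-%R : R -> measurableTypeR R)]_x F ((- a) * x + b)%R)%E.
    rewrite ge0_integral_pushforward//=.
    - by apply: eq_integral => x _; rewrite mulrNN.
    - by apply: measurableT_comp => //; exact: measurable_affine.
  by apply: eq_measure_integral => //= A mA _; exact: lebesgue_measureN.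
have phi_m : measurable_fun [set: measurableTypeR R]
  (fun x => a * x + b : measurableTypeR R) by exact: measurable_affine.
pose m' := mscale (NngNum (ltW apos)) (pushforward leb (fun x => a * x + b : measurableTypeR R)).
pose m := m' phi_m.
have -> : (\int[leb]_x F x = \int[m]_x F x)%E.
  apply: eq_measure_integral => A mA _.
  apply/lebesgue_measure_unique => //= _ [[u v]] _ <-.
  have pre : (fun x : R => a * x + b) @^-1` `]u, v] =
      `](u - b) / a, (v - b) / a]%classic.
    by apply/seteqP; split=> x/=;
      rewrite !in_itv/= ltr_pdivrMr// ler_pdivlMr// ltrBlDr lerBrDr (mulrC x).
  change (leb `]u, v] = a%:E * leb ((fun x : R => (a * x + b)%R) @^-1` `]u, v]))%E.
  rewrite pre lebesgue_measure_itv/= lte_fin.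
  rewrite lebesgue_measure_itv/= lte_fin ltr_pM2r ?invr_gt0// ltrD2r.
  case: ifP => uv; last by rewrite mule0.
  by rewrite -!EFinB -EFinM; congr EFin; field; exact: a0.
rewrite /m /m' ge0_integral_mscale// ge0_integral_pushforward//= muleA -EFinM.
by rewrite gtr0_norm// mulVf// mul1e.
Qed.

Lemma measurable_shear (a : R) (g : R -> R) : measurable_fun setT g ->
  measurable_fun [set: R * R] (fun z : R * R => (z.1, a * z.2 + g z.1) : R * R).
Proof.
move=> mg; apply: measurable_fun_pair => //.
apply: measurable_funD; first exact: measurable_funM.
exact: measurableT_comp.
Qed.

Lemma ge0_integral_shear G (a : R) (g : R -> R) : a != 0 ->
  measurable_fun setT g -> measurable_fun setT G -> (forall z, 0 <= G z)%E ->
  (\int[leb2]_z G (z.1, a * z.2 + g z.1)%R = `|a|^-1%:E * \int[leb2]_z G z)%E.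
Proof.
move=> a0 mg mG G0.
rewrite (fubini_tonelli1 (m1 := leb) (m2 := leb) (fun z : R * R => G (z.1, a * z.2 + g z.1)))//; last first.
  by apply: measurableT_comp => //; exact: measurable_shear.
rewrite (fubini_tonelli1 (m1 := leb) (m2 := leb) G)// -ge0_integralZl//; last 2 first.
- exact: measurable_fun_fubini_tonelli_F.
- by move=> x _; exact: integral_ge0.
apply: eq_integral => x _; rewrite /fubini_F/=.
rewrite (@ge0_integral_affine (fun y => G (x, y)))//.
exact: measurableT_comp.
Qed.

Lemma ge0_integral_swap G : measurable_fun setT G -> (forall z, 0 <= G z)%E ->
  (\int[leb2]_z G (z.2, z.1)%R = \int[leb2]_z G z)%E.
Proof.
move=> mG G0.
rewrite (fubini_tonelli1 (m1 := leb) (m2 := leb) (fun z : R * R => G (z.2, z.1)))//; last first.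
  by apply: measurableT_comp => //; exact: measurable_swap.
by rewrite (fubini_tonelli2 (m1 := leb) (m2 := leb) G).
Qed.

Lemma measurable_linear2 (a b c d : R) :
  measurable_fun [set: R * R]
    (fun z : R * R => (a * z.1 + b * z.2, c * z.1 + d * z.2) : R * R).
Proof.
by apply: measurable_fun_pair; apply: measurable_funD; exact: measurable_funM.
Qed.

(** Gaussian elimination: with pivot [d] the map is a product of two shears, each a one-dimensional
    substitution under Tonelli. If [d = 0], exchanging the two rows makes [b] the pivot. *)
Lemma ge0_integral_linear2 G (a b c d : R) : a * d - b * c != 0 ->
  measurable_fun setT G -> (forall z, 0 <= G z)%E ->
  (\int[leb2]_z G (a * z.1 + b * z.2, c * z.1 + d * z.2)%R
   = `|a * d - b * c|^-1%:E * \int[leb2]_z G z)%E.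
Proof.
wlog d0 : a b c d G / d != 0.
  move=> H; have [->|d0] := eqVneq d 0; last exact: H.
  move=> D mG G0.
  have b0 : b != 0 by apply: contraNneq D => ->; rewrite mul0r mulr0 subr0.
  pose G' (z : R * R) := G (z.2, z.1).
  have mG' : measurable_fun setT G'.
    by apply: measurableT_comp => //; exact: measurable_swap.
  have -> : (\int[leb2]_z G z = \int[leb2]_z G' z)%E.
    by rewrite ge0_integral_swap.
  rewrite -(distrC (b * c)) [X in (b * c) - X]mulr0 subr0.
  have := H c 0 a b G' b0.
  rewrite mul0r subr0 (mulrC c b).
  have bc0 : b * c != 0 by apply: contraNneq D => bc; rewrite bc mulr0 subr0.
  by move=> /(_ bc0 mG' (fun z => G0 _)) <-.
move=> D mG G0.
(* The Schur complement of [d]: the first row is [e * z.1 + (b / d) * (d * z.2 + c * z.1)]. *)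
pose e := (a * d - b * c) / d.
have e0 : e != 0 by rewrite mulf_neq0// invr_eq0.
pose G1 (z : R * R) := G (e * z.1 + (b / d) * z.2, z.2).
have mG1 : measurable_fun setT G1.
  apply: measurableT_comp => //; apply: measurable_fun_pair => //.
  by apply: measurable_funD; exact: measurable_funM.
transitivity (\int[leb2]_z G1 (z.1, d * z.2 + c * z.1)%R)%E.
  apply: eq_integral => z _; rewrite /G1/= /e; congr (G (_, _)); last by rewrite addrC.
  by field.
rewrite (ge0_integral_shear (g := fun x => c * x))//.
rewrite [in LHS]/G1 -(@ge0_integral_swap G1)//.
pose G2 (z : R * R) := G (z.2, z.1).
have mG2 : measurable_fun setT G2.
  by apply: measurableT_comp => //; exact: measurable_swap.
transitivity (`|d|^-1%:E * \int[leb2]_z G2 (z.1, e * z.2 + b / d * z.1)%R)%E => //.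
rewrite (ge0_integral_shear (g := fun x => b / d * x))//.
rewrite muleA -EFinM -invfM -normrM (ge0_integral_swap mG G0).
by rewrite /e mulrC divfK.
all: first [exact: measurable_funM | by move=> z; exact: G0].
Qed.

End affine_change_of_variables.

Section measurability.
Context d (T : measurableType d) (R : realType).
Implicit Types f g : T -> R.

Lemma measurable_fun_expR f : measurable_fun setT f ->
  measurable_fun setT (fun x => expR (f x)).
Proof. exact: measurableT_comp. Qed.

Lemma measurable_fun_oppr f : measurable_fun setT f ->
  measurable_fun setT (fun x => - f x).
Proof. exact: measurableT_comp. Qed.

Lemma measurable_fun_sqrt f : measurable_fun setT f ->
  measurable_fun setT (fun x => Num.sqrt (f x)).
Proof.
apply: measurableT_comp; apply: continuous_measurable_fun.
exact: sqrt_continuous.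
Qed.

Lemma measurable_fun_fst d1 d2 (T1 : measurableType d1) (T2 : measurableType d2)
  (f : T -> T1 * T2) : measurable_fun setT f -> measurable_fun setT (fun x => (f x).1).
Proof. by apply: measurableT_comp; exact: measurable_fst. Qed.

Lemma measurable_fun_snd d1 d2 (T1 : measurableType d1) (T2 : measurableType d2)
  (f : T -> T1 * T2) : measurable_fun setT f -> measurable_fun setT (fun x => (f x).2).
Proof. by apply: measurableT_comp; exact: measurable_snd. Qed.

End measurability.

Ltac measurability := repeat match goal with
  | |- _ => assumption
  | |- measurable_fun _ (fun x => GRing.add (@?f x) (@?g x)) => apply: measurable_funD
  | |- measurable_fun _ (fun x => GRing.mul (@?f x) (@?g x)) => apply: measurable_funM
  | |- measurable_fun _ (fun x => GRing.opp (@?f x)) => apply: measurable_fun_oppr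
  | |- measurable_fun _ (fun x => GRing.exp (@?f x) ?n) => apply: measurable_funX
  | |- measurable_fun _ (fun x => expR (@?f x)) => apply: measurable_fun_expR
  | |- measurable_fun _ (fun x => Num.sqrt (@?f x)) => apply: measurable_fun_sqrt
  | |- measurable_fun _ (fun x => (@?f x, @?g x)) => apply: measurable_fun_pair
  | |- measurable_fun _ (fun x => fst (@?f x)) => apply: measurable_fun_fst
  | |- measurable_fun _ (fun x => snd (@?f x)) => apply: measurable_fun_snd
  | |- _ => first [exact: measurable_cst | exact: measurable_id
      | apply: (measurable_fun_oppr (f := idfun)); exact: measurable_id
      | apply: (measurable_fun_sqrt (f := idfun)); exact: measurable_id]
  end.

Section plane_integral.
Context {R : realType}.
Local Notation leb := (@lebesgue_measure R).
Local Notation leb2 := (leb \x leb)%E.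
Implicit Types (f g : R * R -> R) (z : R * R).

Definition integrable2 f := leb2.-integrable setT (EFin \o f).
Definition integral2 f : R := (\int[leb2]_z f z)%R.

Lemma eq_integral2 f g : f =1 g -> integral2 f = integral2 g.
Proof. by move=> fg; apply: eq_Rintegral => z _; exact: fg. Qed.

Lemma eq_integrable2 f g : f =1 g -> integrable2 f -> integrable2 g.
Proof. by move=> fg; rewrite (_ : f = g)//; apply/funext. Qed.

Lemma integrable2D f g : integrable2 f -> integrable2 g ->
  integrable2 (fun z => f z + g z).
Proof. by move=> If Ig; exact: (integrableD measurableT If Ig). Qed.

Lemma integrable2Z (k : R) f : integrable2 f -> integrable2 (fun z => k * f z).
Proof. by move=> If; exact: (integrableZl measurableT k If). Qed.

Lemma integrable2B f g : integrable2 f -> integrable2 g ->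
  integrable2 (fun z => f z - g z).
Proof. by move=> If Ig; exact: (integrableB measurableT If Ig). Qed.

Lemma integral2D f g : integrable2 f -> integrable2 g ->
  integral2 (fun z => f z + g z) = integral2 f + integral2 g.
Proof. exact: RintegralD. Qed.

Lemma integral2B f g : integrable2 f -> integrable2 g ->
  integral2 (fun z => f z - g z) = integral2 f - integral2 g.
Proof. exact: RintegralB. Qed.

Lemma integral2Z (k : R) f : integrable2 f ->
  integral2 (fun z => k * f z) = k * integral2 f.
Proof. exact: RintegralZl. Qed.

Lemma le_integral2 f g : integrable2 f -> integrable2 g ->
  (forall z, f z <= g z) -> integral2 f <= integral2 g.
Proof. by move=> ? ? fg; apply: le_Rintegral. Qed.

Lemma integral2_ge0 f : (forall z, 0 <= f z) -> 0 <= integral2 f.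
Proof. by move=> f0; exact: Rintegral_ge0. Qed.

Lemma le_norm_integral2 f g : integrable2 f -> integrable2 g ->
  (forall z, `|f z| <= g z) -> `|integral2 f| <= integral2 g.
Proof.
move=> If Ig fg; have fg' z := ler_normlP _ _ (fg z).
rewrite ler_norml; apply/andP; split; last first.
  by apply: le_integral2 => // z; case: (fg' z).
rewrite lerNl -mulN1r -integral2Z//.
apply: le_integral2 => //; first exact: integrable2Z.
by move=> z; rewrite mulN1r; case: (fg' z).
Qed.

Lemma le_integrable2 f g : measurable_fun setT f -> integrable2 g ->
  (forall z, `|f z| <= g z) -> integrable2 f.
Proof.
move=> mf Ig fg; apply: le_integrable Ig => //; first exact/measurable_EFinP.
move=> z _; rewrite /= lee_fin (le_trans (fg z))// real_ler_norm//.
exact: num_real.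
Qed.

Lemma integral2E f : integrable2 f -> (\int[leb2]_z (f z)%:E)%E = (integral2 f)%:E.
Proof.
by move=> If; rewrite /integral2 /Rintegral fineK//; exact: integrable_fin_num.
Qed.

Lemma integral2_substitution (phi : R * R -> R * R) (k : R) :
  measurable_fun setT phi -> 0 <= k ->
  (forall G : R * R -> \bar R, measurable_fun setT G -> (forall z, 0 <= G z)%E ->
     \int[leb2]_z G (phi z) = k%:E * \int[leb2]_z G z)%E ->
  forall f, integrable2 f ->
    integrable2 (f \o phi) /\ integral2 (f \o phi) = k * integral2 f.
Proof.
move=> mphi k0 H f If.
have mf : measurable_fun setT (EFin \o f) by exact: (measurable_int leb2).
have If' : integrable2 (f \o phi).
  apply/integrableP; split; first exact: (measurableT_comp mf mphi).
  move/integrableP : If => [_ fin].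
  rewrite (H (fun z => `|(f z)%:E|)%E)//; last exact: measurableT_comp.
  by rewrite lte_mul_pinfty ?lee_fin.
split=> //; rewrite /integral2 /Rintegral integralE.
rewrite (_ : (fun z => ((f \o phi) z)%:E) = (EFin \o f) \o phi)//.
rewrite (funepos_comp (EFin \o f) phi) (funeneg_comp (EFin \o f) phi) (H (EFin \o f)^\+%E)//; last first.
  exact: measurable_funepos.
rewrite (H (EFin \o f)^\-%E)//; last exact: measurable_funeneg.
have pf := integrable_pos_fin_num measurableT If.
have nf := integrable_neg_fin_num measurableT If.
rewrite [in RHS]integralE -muleBr//; last by rewrite fin_num_adde_defr.
by rewrite fineM// fin_numB pf nf.
Qed.

Lemma integral2_linear (a b c d : R) : a * d - b * c != 0 ->
  forall f, integrable2 f ->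
  integrable2 (fun z => f (a * z.1 + b * z.2, c * z.1 + d * z.2)) /\
  integral2 (fun z => f (a * z.1 + b * z.2, c * z.1 + d * z.2)) =
    `|a * d - b * c|^-1 * integral2 f.
Proof.
move=> D f If.
apply: (integral2_substitution (measurable_linear2 a b c d) _ _ If).
  by rewrite invr_ge0.
by move=> G mG G0; exact: ge0_integral_linear2.
Qed.

Lemma integral2_shear (g : R -> R) : measurable_fun setT g ->
  forall f, integrable2 f ->
  integrable2 (fun z => f (z.1, z.2 + g z.1)) /\
  integral2 (fun z => f (z.1, z.2 + g z.1)) = integral2 f.
Proof.
move=> mg f If.
have := integral2_substitution (measurable_shear 1 mg) (k := 1) ler01 _ If.
rewrite mul1r (_ : _ \o _ = (fun z => f (z.1, z.2 + g z.1))).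
  apply=> G mG G0; have := ge0_integral_shear (oner_neq0 R) mg mG G0.
  by rewrite normr1 invr1.
by apply/funext => z/=; rewrite mul1r.
Qed.

(** The square has area 1 and keeps away from the axes, where the weights in question may vanish.
    This yields strict positivity of integrals without any null-set argument. *)
Lemma integral2_ge_square (f : R * R -> R) (c : R) :
  integrable2 f -> (forall z, 0 <= f z) -> 0 <= c ->
  (forall z, 1 <= z.1 <= 2 -> 1 <= z.2 <= 2 -> c <= f z) -> c <= integral2 f.
Proof.
move=> If f0 c0 fc.
have mD : measurable (`[1%R, 2%R]%classic `*` `[1%R, 2%R]%classic : set (R * R)).
  exact: measurableX.
rewrite -lee_fin -integral2E//.
apply: (@le_trans _ _ (\int[leb2]_(z in `[1%R, 2%R]%classic `*` `[1%R, 2%R]%classic) (f z)%:E)%E).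
  apply: (@le_trans _ _ (\int[leb2]_(z in `[1%R, 2%R]%classic `*` `[1%R, 2%R]%classic) c%:E)%E).
    rewrite integral_cst// [X in (_ * X)%E](_ : _ = 1%E); first by rewrite mule1.
    transitivity (leb `[1%R, 2%R]%classic * leb `[1%R, 2%R]%classic)%E.
      exact: product_measure1E.
    rewrite !lebesgue_measure_itv/= lte_fin ltr1n -EFinB -EFinM.
    by congr EFin; ring.
  apply: ge0_le_integral => //.
  - by apply: measurable_funTS; exact: (measurable_int leb2).
  - by move=> z [/=]; rewrite !in_itv/= => h1 h2; rewrite lee_fin fc.
apply: ge0_subset_integral => //.
- exact: (measurable_int leb2).
- by move=> z _; rewrite lee_fin.
Qed.

End plane_integral.

(** * Polynomial growth and exponential weights *)

Section polynomial_growth.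
Context {R : realType}.
Implicit Types (f g : R -> R * R -> R) (z : R * R).

(** Uniformity in the parameter [e] lets Taylor remainders that depend on [e] obey the same
    calculus. Closure under ring operations makes the property decidable from the syntax. *)
Definition poly_growth f := exists C n, 0 <= C /\
  forall e z, 0 < e <= 1 -> `|f e z| <= C * (1 + z.1 ^+ 2 + z.2 ^+ 2) ^+ n.

Let M_ge1 z : 1 <= 1 + z.1 ^+ 2 + z.2 ^+ 2.
Proof. by rewrite -addrA lerDl addr_ge0 ?sqr_ge0. Qed.

Lemma poly_growth_cst (c : R) : poly_growth (fun _ _ => c).
Proof. by exists `|c|, 0%N; split=> // e z _; rewrite expr0 mulr1. Qed.

Lemma poly_growth_param : poly_growth (fun e _ => e).
Proof.
exists 1, 0%N; split=> // e z /andP[e0 e1]; rewrite expr0 mulr1.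
by rewrite gtr0_norm.
Qed.

Lemma poly_growth_fst : poly_growth (fun _ z => z.1).
Proof.
exists 1, 1%N; split=> // e z _; rewrite expr1 mul1r ler_norml.
by apply/andP; split; nra.
Qed.

Lemma poly_growth_snd : poly_growth (fun _ z => z.2).
Proof.
exists 1, 1%N; split=> // e z _; rewrite expr1 mul1r ler_norml.
by apply/andP; split; nra.
Qed.

Lemma poly_growthD f g : poly_growth f -> poly_growth g ->
  poly_growth (fun e z => f e z + g e z).
Proof.
move=> [C [n [C0 fC]]] [D [m [D0 gD]]]; exists (C + D), (n + m)%N; split.
  exact: addr_ge0.
move=> e z he; rewrite (le_trans (ler_normD _ _))// mulrDl lerD//.
  rewrite (le_trans (fC _ _ he))// ler_wpM2l// ler_weXn2l ?M_ge1//.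
  exact: leq_addr.
rewrite (le_trans (gD _ _ he))// ler_wpM2l// ler_weXn2l ?M_ge1//.
exact: leq_addl.
Qed.

Lemma poly_growthM f g : poly_growth f -> poly_growth g ->
  poly_growth (fun e z => f e z * g e z).
Proof.
move=> [C [n [C0 fC]]] [D [m [D0 gD]]]; exists (C * D), (n + m)%N; split.
  exact: mulr_ge0.
move=> e z he; rewrite normrM exprD mulrACA; apply: ler_pM => //.
  exact: fC.
exact: gD.
Qed.

Lemma poly_growthN f : poly_growth f -> poly_growth (fun e z => - f e z).
Proof.
by move=> [C [n [C0 fC]]]; exists C, n; split=> // e z he; rewrite normrN fC.
Qed.

Lemma poly_growthX f n : poly_growth f -> poly_growth (fun e z => f e z ^+ n).
Proof.
move=> pf; elim: n => [|n IH]; first exact: poly_growth_cst.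
have [C [m [C0 H]]] := poly_growthM pf IH.
by exists C, m; split=> // e z he; rewrite exprS H.
Qed.

Lemma poly_growth_le f g : poly_growth g ->
  (forall e z, 0 < e <= 1 -> `|f e z| <= g e z) -> poly_growth f.
Proof.
move=> [C [n [C0 gC]]] fg; exists C, n; split=> // e z he.
by rewrite (le_trans (fg _ _ he))// (le_trans (ler_norm _))// gC.
Qed.

Lemma poly_growth_norm f : poly_growth f -> poly_growth (fun e z => `|f e z|).
Proof.
by move=> [C [n [C0 fC]]]; exists C, n; split=> // e z he; rewrite normr_id fC.
Qed.

End polynomial_growth.

Ltac poly_growth_tac := repeat first
  [ assumption | exact: poly_growth_cst | exact: poly_growth_param
  | exact: poly_growth_fst | exact: poly_growth_snd
  | apply: poly_growthD | apply: poly_growthN | apply: poly_growthX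
  | apply: poly_growthM | apply: poly_growth_norm ].

Section exponential_weights.
Context {R : realType}.
Local Notation leb := (@lebesgue_measure R).
Implicit Types (z : R * R).

Lemma integrable2_gauss (k : R) : 0 < k ->
  integrable2 (fun z => expR (- (k * (1 + z.1 ^+ 2 + z.2 ^+ 2)))).
Proof.
move=> k0.
pose g (z : R * R) := gauss_fun z.1 * gauss_fun z.2.
have mg : measurable_fun setT g.
  by rewrite /g /gauss_fun; measurability.
have Ig : integrable2 g.
  apply/integrable12ltyP; first exact/measurable_EFinP.
  have mG : measurable_fun setT (EFin \o @gauss_fun R).
    by apply/measurable_EFinP; exact: measurable_gauss_fun.
  have G0 (x : R) : (0 <= (gauss_fun x)%:E)%E by rewrite lee_fin gauss_fun_ge0.
  suff -> : (\int[leb]_x \int[leb]_y `|(EFin \o g) (x, y)|)%E =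
      ((Num.sqrt pi)%:E * (Num.sqrt pi)%:E)%E by rewrite -EFinM ltry.
  transitivity (\int[leb]_x ((Num.sqrt pi)%:E * (gauss_fun x)%:E))%E.
    apply: eq_integral => x _.
    transitivity (\int[leb]_y ((gauss_fun x)%:E * (gauss_fun y)%:E))%E.
      by apply: eq_integral => y _; rewrite /= ger0_norm// mulr_ge0// gauss_fun_ge0.
    by rewrite ge0_integralZl// integralT_gauss muleC.
  by rewrite ge0_integralZl ?integralT_gauss ?lee_fin.
have s0 : 0 < Num.sqrt k by rewrite sqrtr_gt0.
have [] := @integral2_linear R (Num.sqrt k) 0 0 (Num.sqrt k) _ _ Ig.
  by rewrite mul0r subr0 mulf_neq0// gt_eqF.
move=> + _; move/(@integrable2Z R (expR (- k))); apply: eq_integrable2 => z.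
rewrite /g /gauss_fun /= -!expRD !mul0r add0r addr0 !exprMn sqr_sqrtr ?ltW//.
by congr expR; ring.
Qed.

Lemma exprn_le_expR (x : R) n : 0 <= x -> x ^+ n <= n`!%:R * expR x.
Proof.
move=> x0; rewrite mulrC -ler_pdivrMr ?ltr0n ?fact_gt0//.
case: n => [|n]; first by rewrite expr0 divr1 -[X in X <= _]expR0 ler_expR.
by have := expR_ge1Dxn n x0; apply: le_trans; rewrite lerDr.
Qed.

(** Quadratic growth is all that s^4 + u^2 offers in the variable u, and it already beats every
    polynomial weight. *)
Definition coercive (E : R * R -> R) := exists k K : R, 0 < k /\
  forall z, k * (1 + z.1 ^+ 2 + z.2 ^+ 2) - K <= E z.

Lemma integrable2_growth_exp (f E : R * R -> R) :
  measurable_fun setT f -> measurable_fun setT E ->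
  poly_growth (fun _ => f) -> coercive E ->
  integrable2 (fun z => f z * expR (- E z)).
Proof.
move=> mf mE [C [n [C0 fC]]] [k [K [k0 hE]]].
(* Half of the decay absorbs the polynomial, through x^n <= n! e^x; the other half keeps the bound
   integrable. *)
have k20 : 0 < k / 2 by rewrite divr_gt0.
pose c := C * (n`!%:R / (k / 2) ^+ n) * expR K.
apply: (@le_integrable2 _ _ (fun z => c * expR (- (k / 2 * (1 + z.1 ^+ 2 + z.2 ^+ 2))))).
- by measurability.
- by apply: integrable2Z; exact: integrable2_gauss.
move=> z; rewrite normrM (gtr0_norm (expR_gt0 _)).
set M := 1 + z.1 ^+ 2 + z.2 ^+ 2.
have M0 : 0 <= M by rewrite /M !addr_ge0 ?sqr_ge0.
have h1 : expR (- E z) <= expR K * (expR (- (k / 2 * M)) * expR (- (k / 2 * M))).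
  by rewrite -!expRD ler_expR; have := hE z; rewrite -/M; lra.
have h2 : M ^+ n * expR (- (k / 2 * M)) <= n`!%:R / (k / 2) ^+ n.
  have h := @exprn_le_expR (k / 2 * M) n (mulr_ge0 (ltW k20) M0).
  rewrite expRN ler_pdivrMr ?expR_gt0// mulrAC ler_pdivlMr ?exprn_gt0//.
  by rewrite mulrC -exprMn.
have h3 := fC 1 z; rewrite ltr01 lexx in h3; have {}h3 := h3 isT.
apply: (@le_trans _ _ ((C * M ^+ n) *
    (expR K * (expR (- (k / 2 * M)) * expR (- (k / 2 * M)))))).
  by apply: ler_pM => //; exact: expR_ge0.
have -> : C * M ^+ n * (expR K * (expR (- (k / 2 * M)) * expR (- (k / 2 * M)))) =
    (C * (M ^+ n * expR (- (k / 2 * M))) * expR K) * expR (- (k / 2 * M)) by ring.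
rewrite ler_wpM2r ?expR_ge0// /c ler_wpM2r ?expR_ge0//.
by rewrite ler_wpM2l.
Qed.

End exponential_weights.

(** * Second-order expansion of integrals of Gibbs type *)

Section taylor.
Import numFieldNormedType.Exports.
Context {R : realType}.
Implicit Types x t : R.

Lemma ge0_derive_le (f f' : R -> R) : (forall x, is_derive x 1 f (f' x)) ->
  (forall x, 0 <= x -> 0 <= f' x) -> forall x, 0 <= x -> f 0 <= f x.
Proof.
move=> df f'0 x x0.
apply: (@ger0_derive1_ndecry R f 0) => //.
- by move=> y; rewrite in_itv/= andbT => y0; rewrite derive1E derive_val f'0 ?ltW.
- apply: continuous_subspaceT => y.
  by apply: differentiable_continuous; apply/derivable1_diffP.
Qed.

Lemma expR_sub_le (s : R) : 0 <= s -> expR s - 1 <= s * expR s.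
Proof.
move=> s0; have h := expR_ge1Dx (- s).
have := ler_wpM2r (expR_ge0 s) h.
rewrite mulrDl mul1r -expRD addNr expR0; lra.
Qed.

(** The bound has to hold on the whole line, since it is applied to differences of exponents that
    are unbounded polynomials. The factor [1 + expR x] turns into the sum of the two weights in
    [expRN_taylor2]. On each half-line the proof compares derivatives from 0 on. *)
Lemma expR_taylor2_norm x :
  `|expR x - (1 + x + x ^+ 2 / 2)| <= `|x| ^+ 3 * (1 + expR x).
Proof.
have [x0|x_lt0] := leP 0 x.
  rewrite (ger0_norm x0).
  have lo : 0 <= expR x - (1 + x + x ^+ 2 / 2).
    have := @ge0_derive_le (expR - (cst 1 + id + 2^-1 *: (id ^+ 2)))
      (fun y => expR y - (1 + y)) _ _ x x0.
    rewrite !fctE /GRing.scale/= expR0 expr0n/= mulr0 !addr0 subrr (mulrC 2^-1); apply.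
    - by move=> y; apply: is_derive_eq; rewrite /GRing.scale/=; field.
    - by move=> y _; rewrite subr_ge0 expR_ge1Dx.
  rewrite ger0_norm//.
  have := @ge0_derive_le (id ^+ 3 * expR - (expR - (cst 1 + id + 2^-1 *: (id ^+ 2))))
      (fun y => (3 * y ^+ 2 + y ^+ 3) * expR y - (expR y - (1 + y))) _ _ x x0.
  rewrite !fctE /GRing.scale/= expR0 !expr0n/= mulr0 mul0r !addr0 subrr subrr => /(_ _ _) H.
  have {}H : 0 <= x ^+ 3 * expR x - (expR x - (1 + x + 2^-1 * x ^+ 2)).
    apply: H.
      by move=> y; apply: is_derive_eq; rewrite /GRing.scale/= ?exprfctE/=; field.
    move=> y y0; rewrite subr_ge0.
    have h1 := expR_sub_le y0; have e0 := expR_ge0 y.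
    have h2 := expR_ge1Dx y; have h3 : 0 <= y ^+ 3 * expR y by rewrite mulr_ge0// exprn_ge0.
    have h4 : expR y - (1 + y) <= y * (expR y - 1).
      have := ler_wpM2r (expR_ge0 y) (expR_ge1Dx (- y)).
      by rewrite mulrDl mul1r -expRD addNr expR0; lra.
    have h5 := ler_wpM2l y0 h1.
    have h6 : 0 <= y ^+ 2 * expR y by rewrite mulr_ge0// sqr_ge0.
    lra.
  have p0 : 0 <= x ^+ 3 by rewrite exprn_ge0.
  lra.
have [t t0 ->] : exists2 t, 0 <= t & x = - t by exists (- x); rewrite ?opprK// oppr_ge0 ltW.
rewrite normrN (ger0_norm t0) sqrrN.
have hi : expR (- t) - (1 - t + t ^+ 2 / 2) <= 0.
  have := @ge0_derive_le (cst 1 - id + 2^-1 *: (id ^+ 2) - (expR \o -%R))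
      (fun y => -1 + y + expR (- y)) _ _ t t0.
  rewrite !fctE /GRing.scale/= oppr0 expR0 expr0n/= mulr0 !addr0 subrr (mulrC 2^-1) => H.
  rewrite -oppr_ge0 opprB; apply: H.
  - by move=> y; apply: is_derive_eq; rewrite /GRing.scale/=; field.
  - by move=> y _; have := expR_ge1Dx (- y); lra.
rewrite ler0_norm//.
have := @ge0_derive_le (id ^+ 3 + (expR \o -%R) - (cst 1 - id + 2^-1 *: (id ^+ 2)))
    (fun y => 3 * y ^+ 2 - expR (- y) + 1 - y) _ _ t t0.
rewrite !fctE /GRing.scale/= oppr0 expR0 !expr0n/= mulr0 !addr0 add0r subrr => H.
have {}H : 0 <= t ^+ 3 + expR (- t) - (1 - t + 2^-1 * t ^+ 2).
  apply: H.
    by move=> y; apply: is_derive_eq; rewrite /GRing.scale/= ?exprfctE/=; field.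
  move=> y y0; have h := expR_ge1Dx y; have e0 := expR_gt0 (- y).
  have h1 : expR (- y) * (1 + y) <= 1.
    by apply: (le_trans (ler_wpM2l (ltW e0) h)); rewrite -expRD addNr expR0.
  have h2 : expR (- y) <= 1 - y + y ^+ 2.
    have h3 : expR (- y) * (1 + y) <= (1 - y + y ^+ 2) * (1 + y).
      apply: (le_trans h1); have -> : (1 - y + y ^+ 2) * (1 + y) = 1 + y ^+ 3 by ring.
      by rewrite lerDl exprn_ge0.
    by rewrite ler_pM2r in h3 => //; lra.
  have := sqr_ge0 y; lra.
have : 0 <= t ^+ 3 * expR (- t) by rewrite mulr_ge0 ?expR_ge0 ?exprn_ge0.
lra.
Qed.

Lemma expRN_taylor2 (X Y : R) :
  `|expR (- X) - expR (- Y) * (1 - (X - Y) + (X - Y) ^+ 2 / 2)| <=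
  `|X - Y| ^+ 3 * (expR (- X) + expR (- Y)).
Proof.
have eX : expR (- X) = expR (- Y) * expR (- (X - Y)).
  by rewrite -expRD; congr expR; ring.
have -> : `|X - Y| ^+ 3 * (expR (- X) + expR (- Y)) =
    expR (- Y) * (`|- (X - Y)| ^+ 3 * (1 + expR (- (X - Y)))).
  by rewrite normrN eX; ring.
rewrite eX -mulrBr normrM gtr0_norm ?expR_gt0// ler_wpM2l ?expR_ge0//.
by have := expR_taylor2_norm (- (X - Y)); rewrite sqrrN.
Qed.

End taylor.

Section second_variation.
Context {R : realType}.
Implicit Types z : R * R.

Lemma quadratic_eq0 (a b C : R) :
  (forall e, 0 < e <= 1 -> `|e * a + e ^+ 2 * b| <= C * e ^+ 3) -> a = 0 /\ b = 0.
Proof.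
move=> H.
have small (x D : R) : 0 <= D -> (forall e, 0 < e <= 1 -> `|x| <= D * e) -> x = 0.
  move=> D0 hx; apply/eqP; rewrite -normr_le0 leNgt; apply/negP => x0.
  pose e := Num.min 1 (`|x| / (2 * (D + 1))).
  have D1 : 0 < 2 * (D + 1) by lra.
  have e0 : 0 < e by rewrite lt_min ltr01 divr_gt0.
  have e1 : e <= 1 by rewrite ge_min lexx.
  have := hx e; rewrite e0 e1 => /(_ isT).
  have : e <= `|x| / (2 * (D + 1)) by rewrite ge_min lexx orbT.
  rewrite ler_pdivlMr// => h1 h2; nra.
have C0 : 0 <= C by have := H 1; rewrite ltr01 lexx => /(_ isT) h;
  have := le_trans (normr_ge0 _) h; rewrite expr1n mulr1.
have a0 : a = 0.
  apply: (small a (`|b| + C)); first exact: addr_ge0.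
  move=> e he; have /andP[e0 e1] := he.
  have := H e he.
  have -> : e * a + e ^+ 2 * b = e * (a + e * b) by ring.
  rewrite normrM gtr0_norm// (_ : C * e ^+ 3 = e * (C * e ^+ 2)); last by ring.
  rewrite ler_pM2l// => h.
  have h2 : `|a| <= `|a + e * b| + `|e * b|.
    by rewrite -{1}(addrK (e * b) a); exact: ler_normB.
  rewrite normrM gtr0_norm// in h2.
  have : C * e ^+ 2 <= C * e by rewrite ler_wpM2l// expr2 ler_piMr// ltW.
  lra.
split=> //; apply: (small b C) => // e he; have /andP[e0 e1] := he.
have := H e he; rewrite a0 mulr0 add0r normrM (gtr0_norm (exprn_gt0 _ e0)).
rewrite (_ : C * e ^+ 3 = e ^+ 2 * (C * e)); last by ring.
by rewrite ler_pM2l// exprn_gt0.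
Qed.

Variables (E rho E3 r3 : R -> R * R -> R) (E0 E1 E2 r0 r1 r2 : R * R -> R).
Variables (k K : R).
Hypothesis k0 : 0 < k.
Hypothesis mE : forall e, measurable_fun setT (E e).
Hypothesis mrho : forall e, measurable_fun setT (rho e).
Hypotheses (mE0 : measurable_fun setT E0) (mE1 : measurable_fun setT E1)
  (mE2 : measurable_fun setT E2) (mr0 : measurable_fun setT r0)
  (mr1 : measurable_fun setT r1) (mr2 : measurable_fun setT r2).
Hypotheses (pE1 : poly_growth (fun _ => E1)) (pE2 : poly_growth (fun _ => E2))
  (pE3 : poly_growth E3) (pr0 : poly_growth (fun _ => r0))
  (pr1 : poly_growth (fun _ => r1)) (pr2 : poly_growth (fun _ => r2))
  (pr3 : poly_growth r3).
Hypothesis E_expansion : forall e z, 0 < e <= 1 ->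
  E e z = E0 z + e * E1 z + e ^+ 2 * E2 z + e ^+ 3 * E3 e z.
Hypothesis rho_expansion : forall e z, 0 < e <= 1 ->
  rho e z = r0 z + e * r1 z + e ^+ 2 * r2 z + e ^+ 3 * r3 e z.
Hypothesis E0_coercive : forall z, k * (1 + z.1 ^+ 2 + z.2 ^+ 2) - K <= E0 z.
Hypothesis E_coercive : forall e z, 0 < e <= 1 ->
  k * (1 + z.1 ^+ 2 + z.2 ^+ 2) - K <= E e z.

Let g1 z := r1 z - r0 z * E1 z.
Let g2 z := r2 z - E1 z * r1 z + r0 z * (E1 z ^+ 2 / 2 - E2 z).
(** [D] is the difference quotient of [E] in [e]. Replacing 1 - e D + (e D)^2 / 2 by 1 - e E1 + e^2
    F2 leaves exactly e^3 Y; multiplying by [rho] and removing the terms of order at most 2 leaves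
    exactly e^3 X. *)
Let D e z := E1 z + e * E2 z + e ^+ 2 * E3 e z.
Let F2 z := E1 z ^+ 2 / 2 - E2 z.
Let Y e z := - E3 e z + (E2 z + e * E3 e z) * (D e z + E1 z) / 2.
Let X e z := Y e z * rho e z + (1 - e * E1 z + e ^+ 2 * F2 z) * r3 e z +
  (F2 z * r1 z - E1 z * r2 z) + e * F2 z * r2 z.

Let prho : poly_growth rho.
Proof.
apply: (@poly_growth_le _ _ (fun e z =>
  `|r0 z| + e * `|r1 z| + e ^+ 2 * `|r2 z| + e ^+ 3 * `|r3 e z|)).
  by poly_growth_tac.
move=> e z he; have /andP[e0 e1] := he; rewrite rho_expansion//.
apply: (le_trans (ler_normD _ _)); rewrite lerD//; last first.
  by rewrite normrM ger0_norm// exprn_ge0// ltW.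
apply: (le_trans (ler_normD _ _)); rewrite lerD//; last first.
  by rewrite normrM ger0_norm// exprn_ge0// ltW.
apply: (le_trans (ler_normD _ _)); rewrite lerD//.
by rewrite normrM gtr0_norm.
Qed.

Lemma pointwise_expansion : exists C n, 0 <= C /\ forall e z, 0 < e <= 1 ->
  `|rho e z * expR (- E e z) -
    expR (- E0 z) * (r0 z + e * g1 z + e ^+ 2 * g2 z)| <=
  e ^+ 3 * (C * (1 + z.1 ^+ 2 + z.2 ^+ 2) ^+ n *
    expR (- (k * (1 + z.1 ^+ 2 + z.2 ^+ 2) - K))).
Proof.
have pD : poly_growth D by rewrite /D; poly_growth_tac.
have pX : poly_growth X by rewrite /X /Y /F2; poly_growth_tac.
have [C [n [C0 H]]] : poly_growth (fun e z => 2 * (`|D e z| ^+ 3 * `|rho e z|) + `|X e z|).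
  by poly_growth_tac.
exists C, n; split=> // e z he; have /andP[e0 e1] := he.
set W := expR (- (k * _ - K)).
have W0 : expR (- E0 z) <= W by rewrite ler_expR lerN2.
have W1 : expR (- E e z) <= W by rewrite ler_expR lerN2 E_coercive.
have dE : E e z - E0 z = e * D e z by rewrite E_expansion// /D; ring.
have := expRN_taylor2 (E e z) (E0 z); rewrite dE.
set T := expR (- E0 z) * _ => rem.
have -> : rho e z * expR (- E e z) - expR (- E0 z) * (r0 z + e * g1 z + e ^+ 2 * g2 z) =
    (expR (- E e z) - T) * rho e z + e ^+ 3 * (expR (- E0 z) * X e z).
  by rewrite /T /X /Y /D /g1 /g2 /F2 rho_expansion//; field.
apply: (le_trans (ler_normD _ _)).
have e30 : 0 < e ^+ 3 by rewrite exprn_gt0.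
(* Both weights in the remainder of [expRN_taylor2] are at most [W], whence the factor 2. *)
apply: (@le_trans _ _ (e ^+ 3 * ((2 * (`|D e z| ^+ 3 * `|rho e z|) + `|X e z|) * W))).
  rewrite [leRHS](_ : _ = e ^+ 3 * (2 * (`|D e z| ^+ 3 * `|rho e z|) * W) +
    e ^+ 3 * (`|X e z| * W)); last by ring.
  rewrite lerD//.
    rewrite normrM.
    apply: (le_trans (ler_wpM2r (normr_ge0 _) rem)).
    rewrite normrM (gtr0_norm e0) exprMn.
    have -> : e ^+ 3 * (2 * (`|D e z| ^+ 3 * `|rho e z|) * W) =
       (e ^+ 3 * `|D e z| ^+ 3) * (W + W) * `|rho e z| by ring.
    rewrite ler_wpM2r// ler_wpM2l ?lerD//.
    by rewrite mulr_ge0 ?exprn_ge0// ltW.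
  rewrite normrM (gtr0_norm e30) normrM (gtr0_norm (expR_gt0 _)) ler_pM2l//.
  by rewrite mulrC ler_wpM2l.
rewrite ler_pM2l// ler_wpM2r ?expR_ge0//.
by have := H e z he; apply: le_trans; exact: ler_norm.
Qed.

Let coercive0 : coercive E0.
Proof. by exists k, K. Qed.

Let coercive_e e : 0 < e <= 1 -> coercive (E e).
Proof. by move=> he; exists k, K; split=> // z; exact: E_coercive. Qed.

Let integrable_g (g : R * R -> R) : measurable_fun setT g ->
  poly_growth (fun _ => g) -> integrable2 (fun z => g z * expR (- E0 z)).
Proof. by move=> mg pg; exact: integrable2_growth_exp. Qed.

Let mg1 : measurable_fun setT g1. Proof. by rewrite /g1; measurability. Qed.
Let mg2 : measurable_fun setT g2. Proof. by rewrite /g2; measurability. Qed.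
Let pg1 : poly_growth (fun _ => g1). Proof. by rewrite /g1; poly_growth_tac. Qed.
Let pg2 : poly_growth (fun _ => g2). Proof. by rewrite /g2; poly_growth_tac. Qed.

Lemma integrable2_deformation e : 0 < e <= 1 ->
  integrable2 (fun z => rho e z * expR (- E e z)).
Proof.
move=> he; apply: integrable2_growth_exp => //; last exact: coercive_e.
have [C [n [C0 H]]] := prho.
by exists C, n; split=> // _ z _; exact: H.
Qed.

Lemma integral2_expansion : exists C, forall e, 0 < e <= 1 ->
  `|integral2 (fun z => rho e z * expR (- E e z)) -
    (integral2 (fun z => r0 z * expR (- E0 z)) +
     e * integral2 (fun z => g1 z * expR (- E0 z)) +
     e ^+ 2 * integral2 (fun z => g2 z * expR (- E0 z)))| <= C * e ^+ 3.
Proof.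
have [C [n [C0 H]]] := pointwise_expansion.
pose h z := C * (1 + z.1 ^+ 2 + z.2 ^+ 2) ^+ n *
    expR (- (k * (1 + z.1 ^+ 2 + z.2 ^+ 2) - K)).
have Ih : integrable2 h.
  apply: integrable2_growth_exp.
  - by measurability.
  - by measurability.
  - by poly_growth_tac.
  - by exists k, K.
exists (integral2 h) => e he; have /andP[e0 e1] := he.
have I1 := integrable2Z e (integrable_g mg1 pg1).
have I2 := integrable2Z (e ^+ 2) (integrable_g mg2 pg2).
have I0 := integrable_g mr0 pr0.
have Ie := integrable2_deformation he.
rewrite -!integral2Z; [|exact: integrable_g..].
rewrite -integral2D// -integral2D//; last exact: integrable2D.
rewrite -integral2B//; last by apply: integrable2D => //; exact: integrable2D.
rewrite mulrC -integral2Z//; apply: le_norm_integral2.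
- by apply: integrable2B => //; apply: integrable2D => //; exact: integrable2D.
- exact: integrable2Z.
move=> z; apply: le_trans (H e z he); rewrite le_eqVlt; apply/orP; left; apply/eqP.
congr (`|_|); ring.
Qed.

Lemma second_variation_eq0 :
  (forall e, 0 < e <= 1 -> integral2 (fun z => rho e z * expR (- E e z)) =
     integral2 (fun z => r0 z * expR (- E0 z))) ->
  integral2 (fun z => (r2 z - E1 z * r1 z + r0 z * (E1 z ^+ 2 / 2 - E2 z)) *
    expR (- E0 z)) = 0.
Proof.
move=> H; have [C HC] := integral2_expansion.
suff [] : integral2 (fun z => g1 z * expR (- E0 z)) = 0 /\
  integral2 (fun z => g2 z * expR (- E0 z)) = 0 by [].
apply: (@quadratic_eq0 _ _ C) => e he.
have := HC e he; rewrite H// distrC.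
set I0 := integral2 _; set I1 := integral2 _; set I2 := integral2 _.
by rewrite (_ : _ - I0 = e * I1 + e ^+ 2 * I2)//; ring.
Qed.

End second_variation.

(** * The virial identity for homogeneous weights *)

Section virial.
Import numFieldNormedType.Exports.
Context {R : realType}.
Implicit Types (f E : R * R -> R) (z : R * R).

(** The left-hand side equals X at t = 1, so it has a maximum there; its derivative at 1 is p X - n
    Y. *)
Lemma virial_of_scaling (X Y : R) (p n : nat) :
  (forall t : R, 0 < t -> t ^+ p * (X - (t ^+ n - 1) * Y) <= X) ->
  n%:R * Y = p%:R * X.
Proof.
move=> H.
pose f : R -> R := (X + Y) *: id ^+ p - Y *: id ^+ (p + n).
have fE (t : R) : f t = t ^+ p * (X - (t ^+ n - 1) * Y).
  by rewrite /f !fctE /GRing.scale/= exprD; ring.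
have df (t : R) : is_derive t 1 f ((X + Y) * (p%:R * t ^+ p.-1) - Y * ((p + n)%:R * t ^+ (p + n).-1)).
  by apply: is_derive_eq; rewrite /GRing.scale/= !mulr1.
have i1 : (1 : R) \in `]0, 2[ by rewrite in_itv/= ltr01 ltr1n.
have d1 := df 1.
have m1 : is_derive (1 : R) 1 f 0.
  apply: (@derive1_at_max _ f 0 2 1) => //; first by move=> t; rewrite in_itv/= => /andP[t0 _];
    rewrite !fE !expr1n subrr mul0r subr0 mul1r H.
have := @derive_val _ _ _ _ _ _ _ d1; rewrite (@derive_val _ _ _ _ _ _ _ m1).
rewrite !expr1n !mulr1 natrD => h; lra.
Qed.

Variables (f E E1 : R * R -> R) (n : nat).
Hypotheses (mf : measurable_fun setT f) (mE : measurable_fun setT E)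
  (mE1 : measurable_fun setT E1).
Hypotheses (pf : poly_growth (fun _ => f)) (pE1 : poly_growth (fun _ => E1)).
Hypothesis cE : coercive E.
Hypothesis f0 : forall z, 0 <= f z.

(* Convexity of the exponential turns the scaling law of the integral of f e^-E
   into a one-sided inequality for every scale t, which is an equality at t = 1;
   comparing derivatives there gives the identity. *)
Lemma virial (p a b : nat) :
  (forall (t : R) z, 0 < t -> E (t ^+ a * z.1, t ^+ b * z.2) = E z + (t ^+ n - 1) * E1 z) ->
  (forall (t : R) z, 0 < t -> f (t ^+ a * z.1, t ^+ b * z.2) = t ^+ p * f z) ->
  n%:R * integral2 (fun z => f z * E1 z * expR (- E z)) =
  (p + a + b)%:R * integral2 (fun z => f z * expR (- E z)).
Proof.
move=> hE hf; apply: virial_of_scaling => t t0.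
have If : integrable2 (fun z => f z * expR (- E z)) by exact: integrable2_growth_exp.
have IfE : integrable2 (fun z => f z * E1 z * expR (- E z)).
  by apply: integrable2_growth_exp => //; [exact: measurable_funM|exact: poly_growthM].
have det0 : t ^+ a * t ^+ b - 0 * 0 != 0.
  by rewrite mul0r subr0 -exprD gt_eqF// exprn_gt0.
have [Is IsE] := integral2_linear det0 If.
rewrite mul0r subr0 -exprD gtr0_norm ?exprn_gt0// in IsE.
have tab : 0 < t ^+ (a + b) by rewrite exprn_gt0.
rewrite [leRHS](_ : _ = t ^+ (a + b) * integral2 (fun z =>
    t ^+ p * f z * expR (- (E z + (t ^+ n - 1) * E1 z)))); last first.
  rewrite -[LHS](mulVKf (lt0r_neq0 tab)) -IsE; congr (_ * _); apply: eq_integral2 => z.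
  by rewrite mul0r addr0 mul0r add0r hE// hf.
have Is' : integrable2 (fun z => t ^+ p * f z * expR (- (E z + (t ^+ n - 1) * E1 z))).
  apply: eq_integrable2 Is => z.
  by rewrite mul0r addr0 mul0r add0r hE// hf.
set I := integral2 (fun z => f z * expR (- E z)).
set J := integral2 (fun z => f z * E1 z * expR (- E z)).
have -> : t ^+ (p + a + b) * (I - (t ^+ n - 1) * J) =
    t ^+ (a + b) * (t ^+ p * (I - (t ^+ n - 1) * J)).
  by rewrite [RHS]mulrA -exprD -addnA (addnC p).
rewrite ler_pM2l// /I /J -integral2Z// -integral2B//; last exact: integrable2Z.
rewrite -integral2Z; last by apply: integrable2B => //; exact: integrable2Z.
apply: le_integral2 => //.
  by apply: integrable2Z; apply: integrable2B => //; exact: integrable2Z.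
move=> z; set d := (t ^+ n - 1).
have -> : t ^+ p * (f z * expR (- E z) - d * (f z * E1 z * expR (- E z))) =
    t ^+ p * f z * (expR (- E z) * (1 - d * E1 z)) by ring.
apply: ler_wpM2l; first by rewrite mulr_ge0// exprn_ge0// ltW.
rewrite opprD expRD.
by rewrite ler_wpM2l ?expR_ge0//; exact: expR_ge1Dx.
Qed.

End virial.

(** * Expansion of the potential at infinity *)

Section blow_up.
Context {R : realType}.
Implicit Types (z : R * R) (q m p e : R).

(* In the frame (tau, n) attached to a point z with A z = lam *: n, the fourth
   power of the distance and the density |A .|, rescaled with e = r / lam; here
   (q, m, p) are the coefficients of S in that frame. *)
Definition blow_dist q m p e z : R :=
  (z.1 ^+ 2 + (e * z.2 / 2) ^+ 2) ^+ 2 +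
  (z.2 + q * z.1 ^+ 2 + e * m * z.1 * z.2 + p * (e * z.2) ^+ 2 / 4) ^+ 2.

Definition blow_density q m p e z : R :=
  Num.sqrt ((1 + e * (m + 1) * z.1 + e ^+ 2 * p * z.2 / 2) ^+ 2 +
            (e * q * z.1 + e ^+ 2 * (m - 1) * z.2 / 2) ^+ 2).

(** The limit of [blow_dist] at [e = 0] once the shear by [q * z.1 ^+ 2] is undone: the fourth power
    of the Koranyi distance to the origin in a vertical plane. *)
Definition tangent_dist z : R := z.1 ^+ 4 + z.2 ^+ 2.

Lemma measurable_blow_dist q m p e : measurable_fun setT (blow_dist q m p e).
Proof. by rewrite /blow_dist; measurability. Qed.

Lemma measurable_blow_density q m p e : measurable_fun setT (blow_density q m p e).
Proof. by rewrite /blow_density; measurability. Qed.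

(** The second square contains L = u (1 + eta) + q s^2. If |eta| <= 1/2, then L and s^2 control u.
    Otherwise |s| + |Y| is at least of order 1/e, and since u = 2 Y / e, the first square alone
    controls u^2. The two cases cost 8 and 32 times B^2, whence the 40. *)
Lemma blow_dist_ge q m p e z B : `|q| <= B -> `|m| <= B -> `|p| <= B ->
  0 <= e <= 1 -> tangent_dist z <= (9 + 40 * B ^+ 2) * blow_dist q m p e z.
Proof.
move=> qB mB pB /andP[e0 e1]; rewrite /blow_dist /tangent_dist.
have B0 : 0 <= B := le_trans (normr_ge0 _) qB.
case: z => s u /=; set Y := e * u / 2.
set L := u + _ + _ + _.
set H := s ^+ 2 + Y ^+ 2.
have H0 : 0 <= H by rewrite addr_ge0 ?sqr_ge0.
have L0 : 0 <= L ^+ 2 by exact: sqr_ge0.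
have H20 : 0 <= H ^+ 2 by exact: sqr_ge0.
have s4 : s ^+ 4 <= H ^+ 2.
  rewrite (_ : s ^+ 4 = (s ^+ 2) ^+ 2); last by rewrite -exprM.
  by rewrite ler_sqr ?nnegrE ?sqr_ge0// lerDl sqr_ge0.
have q2 : q ^+ 2 <= B ^+ 2 by rewrite -real_normK ?num_real// ler_sqr ?nnegrE.
pose eta := e * (m * s + p * Y / 2).
have LE : L = u * (1 + eta) + q * s ^+ 2.
  by rewrite /L /eta /Y; field.
have s40 : 0 <= s ^+ 4 by rewrite exprn_even_ge0.
have B2H : 0 <= B ^+ 2 * H ^+ 2 by rewrite mulr_ge0 ?sqr_ge0.
have B2L : 0 <= B ^+ 2 * L ^+ 2 by rewrite mulr_ge0 ?sqr_ge0.
suff : u ^+ 2 <= 8 * L ^+ 2 + 40 * B ^+ 2 * H ^+ 2 by lra.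
have [small|large] := leP `|eta| (1 / 2).
  have : (1 / 2) ^+ 2 <= (1 + eta) ^+ 2.
    have h : 1 / 2 <= 1 + eta by move: small; rewrite ler_norml => /andP[]; lra.
    by rewrite ler_sqr// nnegrE; lra.
  move=> h1; have h2 : u ^+ 2 * (1 / 2) ^+ 2 <= u ^+ 2 * (1 + eta) ^+ 2.
    by rewrite ler_wpM2l// sqr_ge0.
  have h3 : q ^+ 2 * s ^+ 4 <= B ^+ 2 * H ^+ 2 by apply: ler_pM => //; exact: sqr_ge0.
  have h4 : (u * (1 + eta)) ^+ 2 <= 2 * L ^+ 2 + 2 * (q ^+ 2 * s ^+ 4).
    have := sqr_ge0 (L + q * s ^+ 2); rewrite LE; nra.
  rewrite exprMn in h4; lra.
have b1 : `|eta| <= e * (B * (`|s| + `|Y|)).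
  rewrite /eta normrM (ger0_norm e0) ler_wpM2l//.
  apply: (le_trans (ler_normD _ _)); rewrite mulrDr lerD//.
    by rewrite normrM ler_wpM2r.
  rewrite (_ : `|p * Y / 2| = `|p| * `|Y| / 2); last by rewrite 2!normrM normfV normr_nat.
  have := ler_wpM2r (normr_ge0 Y) pB.
  have : 0 <= `|p| * `|Y| by rewrite mulr_ge0.
  lra.
have b2 : 1 / 2 < e * (B * (`|s| + `|Y|)) by exact: lt_le_trans large b1.
have b3 : (1 / 2) ^+ 2 <= (e * (B * (`|s| + `|Y|))) ^+ 2.
  by rewrite ler_sqr ?nnegrE ?ltW//; lra.
have b4 : (`|s| + `|Y|) ^+ 2 <= 2 * H.
  have := sqr_ge0 (`|s| - `|Y|).
  have hs : `|s| ^+ 2 = s ^+ 2 by rewrite real_normK ?num_real.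
  have hY : `|Y| ^+ 2 = Y ^+ 2 by rewrite real_normK ?num_real.
  by rewrite /H -hs -hY; nra.
have b5 : 1 <= 8 * e ^+ 2 * B ^+ 2 * H.
  rewrite !exprMn in b3.
  have := ler_wpM2l (mulr_ge0 (sqr_ge0 e) (sqr_ge0 B)) b4.
  lra.
have b6 : u ^+ 2 <= 8 * e ^+ 2 * B ^+ 2 * H * u ^+ 2.
  by rewrite -[X in X <= _]mul1r ler_wpM2r// sqr_ge0.
have b7 : 8 * e ^+ 2 * B ^+ 2 * H * u ^+ 2 = 32 * B ^+ 2 * (H * Y ^+ 2).
  by rewrite /Y; field.
have b8 : H * Y ^+ 2 <= H ^+ 2 by rewrite expr2 ler_wpM2l// lerDr sqr_ge0.
have b9 := ler_wpM2l (sqr_ge0 B) b8.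
lra.
Qed.

Lemma tangent_dist_ge z : 1 + z.1 ^+ 2 + z.2 ^+ 2 - 2 <= tangent_dist z.
Proof.
rewrite /tangent_dist; have := sqr_ge0 (z.1 ^+ 2 - 1 / 2).
by rewrite (_ : z.1 ^+ 4 = (z.1 ^+ 2) ^+ 2) -?exprM//; lra.
Qed.

(** Again the bound must be global, because x and b will be unbounded polynomials. For 1 + x >= 1/2
    it is a genuine Taylor estimate; otherwise |x| >= 1/2, and the factor 8 |x|^3 >= 1 pays for a
    crude bound. *)
Lemma sqrt_expansion_norm (x b : R) :
  `|Num.sqrt ((1 + x) ^+ 2 + b ^+ 2) - (1 + x + b ^+ 2 / 2)| <=
  b ^+ 2 * (`|x| + `|b|) + 8 * `|x| ^+ 3 * (2 + 2 * `|x| + `|b| + b ^+ 2).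
Proof.
set a := 1 + x; set r := Num.sqrt _.
have r0 : 0 <= r by exact: sqrtr_ge0.
have rr : r ^+ 2 = a ^+ 2 + b ^+ 2 by rewrite sqr_sqrtr// addr_ge0 ?sqr_ge0.
have nx := normr_ge0 x; have nb := normr_ge0 b.
have b2 : `|b| ^+ 2 = b ^+ 2 by rewrite real_normK ?num_real.
have a2 : `|a| ^+ 2 = a ^+ 2 by rewrite real_normK ?num_real.
have r_ub : r <= `|a| + `|b|.
  have h : r ^+ 2 <= (`|a| + `|b|) ^+ 2.
    have : 0 <= `|a| * `|b| by rewrite mulr_ge0.
    by rewrite rr [(`|a| + _) ^+ 2]sqrrD a2 b2 mulr2n; lra.
  by move: h; rewrite ler_sqr ?nnegrE// addr_ge0.
have r_lb : `|a| <= r.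
  have h : `|a| ^+ 2 <= r ^+ 2 by rewrite rr a2 lerDl sqr_ge0.
  by move: h; rewrite ler_sqr ?nnegrE.
have b20 := sqr_ge0 b.
have x30 : 0 <= `|x| ^+ 3 by rewrite exprn_ge0.
have t2 : 0 <= 8 * `|x| ^+ 3 * (2 + 2 * `|x| + `|b| + b ^+ 2).
  by rewrite !mulr_ge0//; lra.
have t1 : 0 <= b ^+ 2 * (`|x| + `|b|) by rewrite mulr_ge0// addr_ge0.
have ax : `|a| <= 1 + `|x| by rewrite (le_trans (ler_normD _ _))// normr1.
have [a_ge|a_lt] := leP (1 / 2) a.
  have a0 : 0 < a by lra.
  rewrite (gtr0_norm a0) in r_ub r_lb ax.
  have d0 : 1 <= r + a by lra.
  (* Rationalisation: r - a = b^2 / (r + a), and r + a is close to 2. *)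
  have e1 : r - (a + b ^+ 2 / 2) = b ^+ 2 * (2 - (r + a)) / (2 * (r + a)).
    have ra : r + a != 0 by rewrite gt_eqF//; lra.
    have -> : b ^+ 2 = (r - a) * (r + a) by move: rr; lra.
    by field.
  have nxl := ler_norm x; have nxl' := ler_norm (- x); rewrite normrN in nxl'.
  have e2 : `|2 - (r + a)| <= 2 * (`|x| + `|b|).
    by rewrite ler_norml; apply/andP; split; rewrite /a in a0 r_ub r_lb ax d0 *; lra.
  rewrite e1 normrM normrM (ger0_norm b20) normfV (gtr0_norm (_ : 0 < 2 * (r + a))); last lra.
  rewrite ler_pdivrMr; last lra.
  have e3 := ler_wpM2l b20 e2.
  apply: (le_trans e3).
  have : 0 <= (b ^+ 2 * (`|x| + `|b|)) * (r + a - 1) by rewrite mulr_ge0//; lra.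
  have : 0 <= (8 * `|x| ^+ 3 * (2 + 2 * `|x| + `|b| + b ^+ 2)) * (r + a) by rewrite mulr_ge0//; lra.
  lra.
have x_large : 1 / 2 <= `|x|.
  have := ler_norm (- x); rewrite normrN /a in a_lt *; lra.
have x3 : 1 <= 8 * `|x| ^+ 3.
  have : (1 / 2) ^+ 3 <= `|x| ^+ 3 by rewrite lerXn2r ?nnegrE//; lra.
  by rewrite !exprS expr0; lra.
have bound : `|r - (a + b ^+ 2 / 2)| <= 2 + 2 * `|x| + `|b| + b ^+ 2.
  have la := ler_norm a; have la' := ler_norm (- a); rewrite normrN in la'.
  by rewrite ler_norml; apply/andP; split; lra.
apply: (le_trans bound).
have : 0 <= (8 * `|x| ^+ 3 - 1) * (2 + 2 * `|x| + `|b| + b ^+ 2) by rewrite mulr_ge0//; lra.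
lra.
Qed.

End blow_up.

(** * Moments of the tangent kernel and the condition at infinity *)

Section tangent_moments.
Context {R : realType}.
Implicit Types z : R * R.

Lemma coercive_tangent : coercive (@tangent_dist R).
Proof.
by exists 1, 2; split=> // z; rewrite mul1r; exact: tangent_dist_ge.
Qed.

Lemma measurable_tangent_dist : measurable_fun setT (@tangent_dist R).
Proof. by rewrite /tangent_dist; measurability. Qed.

Definition moment (j k : nat) : R :=
  integral2 (fun z => z.1 ^+ j * z.2 ^+ k * expR (- tangent_dist z)).

Lemma integrable2_moment j k : integrable2 (fun z : R * R =>
  z.1 ^+ j * z.2 ^+ k * expR (- tangent_dist z)).
Proof.
apply: integrable2_growth_exp.
- by measurability.
- exact: measurable_tangent_dist.
- by poly_growth_tac.
- exact: coercive_tangent.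
Qed.

Let even_ge0 j k z : ~~ odd j -> ~~ odd k -> 0 <= z.1 ^+ j * z.2 ^+ k.
Proof. by move=> hj hk; rewrite mulr_ge0// exprn_even_ge0. Qed.

(** Integration by parts in one variable, obtained as the virial identity for the dilation of that
    coordinate alone. Evenness provides the nonnegative weight which that identity asks for. *)
Lemma moment_snd j k : ~~ odd j -> ~~ odd k ->
  2 * moment j k.+2 = k.+1%:R * moment j k.
Proof.
move=> hj hk.
have := @virial R (fun z => z.1 ^+ j * z.2 ^+ k) (@tangent_dist R)
  (fun z => z.2 ^+ 2) 2 _ measurable_tangent_dist _ _ _ coercive_tangent
  (fun z => even_ge0 z hj hk) k 0 1.
rewrite !addn0 addn1 => H; rewrite /moment -H; first 1 last.
- by measurability.
- by measurability.
- by poly_growth_tac.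
- by poly_growth_tac.
- by move=> t z t0; rewrite /tangent_dist expr0 expr1 mul1r/= exprMn; ring.
- by move=> t z t0; rewrite expr0 expr1 mul1r/= exprMn; ring.
by congr (_ * _); apply: eq_integral2 => z; rewrite -addn2 exprD; ring.
Qed.

Lemma moment_fst j k : ~~ odd j -> ~~ odd k ->
  4 * moment (j + 4) k = j.+1%:R * moment j k.
Proof.
move=> hj hk.
have := @virial R (fun z => z.1 ^+ j * z.2 ^+ k) (@tangent_dist R)
  (fun z => z.1 ^+ 4) 4 _ measurable_tangent_dist _ _ _ coercive_tangent
  (fun z => even_ge0 z hj hk) j 1 0.
rewrite !addn0 addn1 => H; rewrite /moment -H; first 1 last.
- by measurability.
- by measurability.
- by poly_growth_tac.
- by poly_growth_tac.
- by move=> t z t0; rewrite /tangent_dist expr0 expr1 mul1r/= exprMn; ring.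
- by move=> t z t0; rewrite expr0 expr1 mul1r/= exprMn; ring.
by congr (_ * _); apply: eq_integral2 => z; rewrite exprD; ring.
Qed.

Lemma integral2_odd_snd (f : R * R -> R) : integrable2 f ->
  (forall z, f (z.1, - z.2) = - f z) -> integral2 f = 0.
Proof.
move=> If fodd.
have det : (1 : R) * -1 - 0 * 0 != 0 by rewrite mul0r subr0 mul1r oppr_eq0 oner_neq0.
have [_] := integral2_linear det If.
rewrite mul0r subr0 mul1r normrN1 invr1 mul1r.
rewrite (@eq_integral2 _ _ (fun z => -1 * f z)); last first.
  by move=> z; rewrite mul1r !mul0r addr0 add0r !mulN1r fodd.
by rewrite integral2Z// => h; lra.
Qed.

Lemma moment22 : moment 2 2 = moment 2 0 / 2.
Proof. by have := @moment_snd 2 0 isT isT; lra. Qed.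

Lemma moment24 : moment 2 4 = 3 / 4 * moment 2 0.
Proof. by have := @moment_snd 2 2 isT isT; rewrite moment22; lra. Qed.

Lemma moment60 : moment (2 + 4) 0 = 3 / 4 * moment 2 0.
Proof. by have := @moment_fst 2 0 isT isT; lra. Qed.

Lemma moment62 : moment (2 + 4) 2 = 3 / 8 * moment 2 0.
Proof. by have := @moment_fst 2 2 isT isT; rewrite moment22; lra. Qed.

Lemma moment20_gt0 : 0 < moment 2 0.
Proof.
apply: (@lt_le_trans _ _ (expR (- 20))); first exact: expR_gt0.
apply: integral2_ge_square => //.
- exact: integrable2_moment.
- by move=> z; rewrite expr0 mulr1 mulr_ge0 ?sqr_ge0 ?expR_ge0.
move=> z /andP[a1 a2] /andP[b1 b2]; rewrite expr0 mulr1.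
apply: (@le_trans _ _ (1 * expR (- tangent_dist z))).
  rewrite mul1r ler_expR lerN2 /tangent_dist.
  have h1 : z.1 ^+ 4 <= 2 ^+ 4 by rewrite lerXn2r ?nnegrE//; lra.
  have h2 : z.2 ^+ 2 <= 2 ^+ 2 by rewrite lerXn2r ?nnegrE//; lra.
  by rewrite !exprS expr0 in h1 h2 *; lra.
by rewrite ler_wpM2r ?expR_ge0// -[X in X <= _](expr1n R 2) lerXn2r ?nnegrE//; lra.
Qed.

End tangent_moments.

Section far_condition.
Context {R : realType}.
Variables q m p : R.

Let E1 (z : R * R) := 2 * (z.2 + q * z.1 ^+ 2) * (m * z.1 * z.2).
Let E2 (z : R * R) := z.1 ^+ 2 * z.2 ^+ 2 / 2 + m ^+ 2 * z.1 ^+ 2 * z.2 ^+ 2 +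
  (z.2 + q * z.1 ^+ 2) * (p * z.2 ^+ 2 / 2).
Let E3 e (z : R * R) := m * p * z.1 * z.2 ^+ 3 / 2 +
  e * (p ^+ 2 + 1) * z.2 ^+ 4 / 16.
Let E0 (z : R * R) := z.1 ^+ 4 + (z.2 + q * z.1 ^+ 2) ^+ 2.
Let r1 (z : R * R) := (m + 1) * z.1.
Let r2 (z : R * R) := p * z.2 / 2 + q ^+ 2 * z.1 ^+ 2 / 2.
Let al e (z : R * R) := (m + 1) * z.1 + e * (p * z.2 / 2).
Let be e (z : R * R) := q * z.1 + e * ((m - 1) * z.2 / 2).
(** The remainder is defined by division, so that the expansion of the density is an identity; the
    content lies in [r3_growth], where [sqrt_expansion_norm] is applied to [e * al] and [e * be]. *)
Let r3 e (z : R * R) :=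
  (blow_density q m p e z - (1 + e * r1 z + e ^+ 2 * r2 z)) / e ^+ 3.

Let r3_growth : poly_growth r3.
Proof.
apply: (@poly_growth_le _ _ (fun e z =>
  (be e z) ^+ 2 * (`|al e z| + `|be e z|) +
  8 * `|al e z| ^+ 3 * (2 + 2 * (e * `|al e z|) + e * `|be e z| + e ^+ 2 * be e z ^+ 2) +
  `|(m - 1) * z.2 / 4 * (be e z + q * z.1)|)).
  by rewrite /al /be; poly_growth_tac.
move=> e z /andP[e0 e1].
have e30 : 0 < e ^+ 3 by rewrite exprn_gt0.
rewrite /r3 normrM normfV (gtr0_norm e30) ler_pdivrMr//.
have := sqrt_expansion_norm (e * al e z) (e * be e z).
rewrite [`|e * al e z|]normrM [`|e * be e z|]normrM (gtr0_norm e0).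
have -> : Num.sqrt ((1 + e * al e z) ^+ 2 + (e * be e z) ^+ 2) = blow_density q m p e z.
  by rewrite /blow_density /al /be; congr (Num.sqrt (_ ^+ 2 + _ ^+ 2)); field.
set rho := blow_density _ _ _ _ _ => h.
have -> : rho - (1 + e * r1 z + e ^+ 2 * r2 z) =
    (rho - (1 + e * al e z + (e * be e z) ^+ 2 / 2)) +
    e ^+ 3 * ((m - 1) * z.2 / 4 * (be e z + q * z.1)).
  by rewrite /r1 /r2 /al /be; field.
apply: (le_trans (ler_normD _ _)).
rewrite [leRHS]mulrDl; apply: lerD; last first.
  by rewrite [leLHS]normrM (gtr0_norm e30) [leLHS]mulrC.
apply: (le_trans h); rewrite le_eqVlt; apply/orP; left; apply/eqP; ring.
Qed.

(** This serves twice: its second-order coefficient gives the condition at infinity, and its zeroth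
    order gives the limiting mass of the kernel at a point. Neither use needs the value of [c1]. *)
Lemma blow_up_expansion : exists C c1 : R, forall e, 0 < e <= 1 ->
  `|integral2 (fun z => blow_density q m p e z * expR (- blow_dist q m p e z)) -
    (integral2 (fun z => expR (- @tangent_dist R z)) + e * c1 +
     e ^+ 2 * (moment 2 0 * ((q ^+ 2 - 8 * m - 2) / 8)))| <= C * e ^+ 3.
Proof.
pose B := `|q| + `|m| + `|p|.
have B0 : 0 <= B by rewrite !addr_ge0.
have qB : `|q| <= B by have := (normr_ge0 q, normr_ge0 m, normr_ge0 p); rewrite /B; move=> [[? ?] ?]; lra.
have mB : `|m| <= B by have := (normr_ge0 q, normr_ge0 m, normr_ge0 p); rewrite /B; move=> [[? ?] ?]; lra.
have pB : `|p| <= B by have := (normr_ge0 q, normr_ge0 m, normr_ge0 p); rewrite /B; move=> [[? ?] ?]; lra.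
pose k := (9 + 40 * B ^+ 2)^-1.
have k'0 : 0 < 9 + 40 * B ^+ 2 by have := sqr_ge0 B; lra.
have k0 : 0 < k by rewrite invr_gt0.
have coer e z : 0 <= e <= 1 ->
    k * (1 + z.1 ^+ 2 + z.2 ^+ 2) - 2 * k <= blow_dist q m p e z.
  move=> he; have h1 := blow_dist_ge z qB mB pB he.
  rewrite mulrC -mulrBl /k ler_pdivrMr// mulrC.
  exact: le_trans (tangent_dist_ge z) h1.
have E0E z : E0 z = blow_dist q m p 0 z.
  by rewrite /E0 /blow_dist; field.
have sh : measurable_fun setT (fun s : R => q * s ^+ 2) by measurability.
have IW : integrable2 (fun z => expR (- @tangent_dist R z)).
  by apply: eq_integrable2 (integrable2_moment 0 0) => z; rewrite !expr0 !mul1r.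
have tE z : tangent_dist (z.1, z.2 + q * z.1 ^+ 2) = E0 z by [].
have main := @integral2_expansion R (blow_dist q m p) (blow_density q m p) E3 r3
  E0 E1 E2 (fun=> 1) r1 r2 k (2 * k) k0.
have {main} [C main] : exists C, forall e, 0 < e <= 1 ->
  `|integral2 (fun z => blow_density q m p e z * expR (- blow_dist q m p e z)) -
    (integral2 (fun z => 1 * expR (- E0 z)) +
     e * integral2 (fun z => (r1 z - 1 * E1 z) * expR (- E0 z)) +
     e ^+ 2 * integral2 (fun z => (r2 z - E1 z * r1 z + 1 * (E1 z ^+ 2 / 2 - E2 z)) *
       expR (- E0 z)))| <= C * e ^+ 3.
  apply: main.
  - exact: measurable_blow_dist.
  - exact: measurable_blow_density.
  - by rewrite /E0; measurability.
  - by rewrite /E1; measurability.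
  - by rewrite /E2; measurability.
  - exact: measurable_cst.
  - by rewrite /r1; measurability.
  - by rewrite /r2; measurability.
  - by rewrite /E1; poly_growth_tac.
  - by rewrite /E2; poly_growth_tac.
  - by rewrite /E3; poly_growth_tac.
  - by poly_growth_tac.
  - by rewrite /r1; poly_growth_tac.
  - by rewrite /r2; poly_growth_tac.
  - exact: r3_growth.
  - by move=> e z _; rewrite /blow_dist /E0 /E1 /E2 /E3; field.
  - move=> e z /andP[e0 _]; rewrite /r3; field.
    by rewrite gt_eqF.
  - by move=> z; rewrite E0E coer// lexx ler01.
  - by move=> e z /andP[e0 e1]; rewrite coer// e1 ltW.
(* In the sheared variable z.2 + q z.1^2 the weight becomes e^(- s^4 - u^2), which is even in u.
   [ev] and [od] are the parts of the second-order integrand that are even and odd in u; the odd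
   part integrates to 0. *)
pose ev (z : R * R) := (q ^+ 2 / 2 - p * q / 2) * (z.1 ^+ 2 * z.2 ^+ 0 * expR (- tangent_dist z)) +
  (p * q - 2 * m * (m + 1) - (1 / 2 + m ^+ 2)) * (z.1 ^+ 2 * z.2 ^+ 2 * expR (- tangent_dist z)) +
  (- (1 / 2 + m ^+ 2) * q ^+ 2) * (z.1 ^+ (2 + 4) * z.2 ^+ 0 * expR (- tangent_dist z)) +
  2 * m ^+ 2 * (z.1 ^+ 2 * z.2 ^+ 4 * expR (- tangent_dist z)) +
  2 * m ^+ 2 * q ^+ 2 * (z.1 ^+ (2 + 4) * z.2 ^+ 2 * expR (- tangent_dist z)).
pose od (z : R * R) := ((p / 2 + 2 * m * (m + 1) * q * z.1 ^+ 4 +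
   (1 + 2 * m ^+ 2) * q * z.1 ^+ 4 - p * q ^+ 2 * z.1 ^+ 4 / 2) * z.2
   - p / 2 * z.2 ^+ 3 - 4 * m ^+ 2 * q * z.1 ^+ 4 * z.2 ^+ 3) * expR (- tangent_dist z).
have Iod : integrable2 od.
  apply: integrable2_growth_exp.
  - by measurability.
  - exact: measurable_tangent_dist.
  - by poly_growth_tac.
  - exact: coercive_tangent.
have od0 : integral2 od = 0.
  apply: integral2_odd_snd => // z; rewrite /od /tangent_dist/= sqrrN; ring.
have I20 := integrable2_moment 2 0. have I22 := integrable2_moment 2 2.
have I60 := integrable2_moment (2 + 4) 0. have I24 := integrable2_moment 2 4.
have I62 := integrable2_moment (2 + 4) 2.
have Iev : integrable2 ev.
  by do 4 ! [apply: integrable2D; last exact: integrable2Z]; exact: integrable2Z.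
pose h z := ev z + od z.
have Ih : integrable2 h by exact: integrable2D.
have [_ shE] := integral2_shear sh Ih.
have gE : integral2 (fun z => (r2 z - E1 z * r1 z + 1 * (E1 z ^+ 2 / 2 - E2 z)) *
    expR (- E0 z)) = integral2 h.
  rewrite -shE; apply: eq_integral2 => z.
  by rewrite /h /ev /od tE /E1 /E2 /r1 /r2 /=; field.
have TE : integral2 (fun z => 1 * expR (- E0 z)) = integral2 (fun z => expR (- @tangent_dist R z)).
  have [_ <-] := integral2_shear sh IW.
  by apply: eq_integral2 => z; rewrite mul1r tE.
exists C, (integral2 (fun z => (r1 z - 1 * E1 z) * expR (- E0 z))) => e he.
have {he} := main e he; rewrite TE gE.
rewrite (_ : integral2 h = moment 2 0 * ((q ^+ 2 - 8 * m - 2) / 8))//.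
have h0 : integral2 h = integral2 ev by rewrite integral2D// od0 addr0.
have -> : integral2 h = (q ^+ 2 / 2 - p * q / 2) * moment 2 0 +
  (p * q - 2 * m * (m + 1) - (1 / 2 + m ^+ 2)) * moment 2 2 +
  (- (1 / 2 + m ^+ 2) * q ^+ 2) * moment (2 + 4) 0 +
  2 * m ^+ 2 * moment 2 4 + 2 * m ^+ 2 * q ^+ 2 * moment (2 + 4) 2.
  rewrite h0 /ev !integral2D; do ? [exact: integrable2Z | apply: integrable2D].
  by rewrite !integral2Z.
(* Every moment is now a multiple of [moment 2 0]; all terms with [p], m^2 or m^2 q^2 cancel. *)
rewrite moment62 moment60 moment24 moment22; by field.
Qed.

Lemma far_condition :
  (forall e, 0 < e <= 1 ->
    integral2 (fun z => blow_density q m p e z * expR (- blow_dist q m p e z)) =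
    integral2 (fun z => expR (- @tangent_dist R z))) ->
  q ^+ 2 = 2 + 8 * m.
Proof.
move=> H; have [C [c1 HC]] := blow_up_expansion.
have [] : c1 = 0 /\ moment 2 0 * ((q ^+ 2 - 8 * m - 2) / 8) = 0.
  apply: (@quadratic_eq0 _ _ _ C) => e he; have := HC e he; rewrite H// distrC.
  set T := integral2 _; set x := moment 2 0 * _.
  by rewrite (_ : _ - T = e * c1 + e ^+ 2 * x)//; ring.
by move=> _ /eqP; rewrite mulf_eq0 (gt_eqF (@moment20_gt0 R)) => /eqP; lra.
Qed.

End far_condition.

(** * Geometry of quadratic graphs *)

Section quadratic_graph_geometry.
Context {R : realType}.
Variables a b d : R.
Implicit Types z w : R * R.

Definition quad z : R := a * z.1 ^+ 2 + 2 * b * z.1 * z.2 + d * z.2 ^+ 2.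

(* The fourth power of the distance between the points of the graph above z and w. *)
Definition graph_dist z w : R :=
  ((w.1 - z.1) ^+ 2 + (w.2 - z.2) ^+ 2) ^+ 2 +
  (quad w - quad z + 2 * (z.1 * w.2 - z.2 * w.1)) ^+ 2.

(* |(S + J) z|, where J is the rotation by a right angle: the horizontal
   gradient of x_3 - <z, S z> has this length, up to a factor 2. *)
Definition graph_density z : R :=
  Num.sqrt ((a * z.1 + (b - 1) * z.2) ^+ 2 + ((b + 1) * z.1 + d * z.2) ^+ 2).

Lemma graph_distC z w : graph_dist z w = graph_dist w z.
Proof. by rewrite /graph_dist; ring. Qed.

Lemma graph_dist_ge0 z w : 0 <= graph_dist z w.
Proof. by rewrite addr_ge0 ?sqr_ge0. Qed.

Lemma graph_density_ge0 z : 0 <= graph_density z.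
Proof. exact: sqrtr_ge0. Qed.

Lemma measurable_graph_dist z : measurable_fun setT (graph_dist z).
Proof. by rewrite /graph_dist /quad; measurability. Qed.

Lemma measurable_graph_density : measurable_fun setT graph_density.
Proof. by rewrite /graph_density; measurability. Qed.

Lemma graph_dist_coercive z w :
  1 + w.1 ^+ 2 + w.2 ^+ 2 - (2 + 2 * (z.1 ^+ 2 + z.2 ^+ 2)) <= graph_dist z w.
Proof.
rewrite /graph_dist.
set X := (w.1 - z.1) ^+ 2 + _; set T := (_ + 2 * _) ^+ 2.
have T0 : 0 <= T by exact: sqr_ge0.
have h1 : 2 * X - 1 <= X ^+ 2 by have := sqr_ge0 (X - 1); lra.
have h2 : w.1 ^+ 2 <= 2 * (w.1 - z.1) ^+ 2 + 2 * z.1 ^+ 2.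
  by have := sqr_ge0 (w.1 - 2 * z.1); lra.
have h3 : w.2 ^+ 2 <= 2 * (w.2 - z.2) ^+ 2 + 2 * z.2 ^+ 2.
  by have := sqr_ge0 (w.2 - 2 * z.2); lra.
by rewrite /X in h1 *; lra.
Qed.

Lemma coercive_graph_dist z : coercive (graph_dist z).
Proof.
exists 1, (2 + 2 * (z.1 ^+ 2 + z.2 ^+ 2)); split=> // w; rewrite mul1r.
exact: graph_dist_coercive.
Qed.

Lemma graph_density_le z : graph_density z <=
  (a * z.1 + (b - 1) * z.2) ^+ 2 + ((b + 1) * z.1 + d * z.2) ^+ 2 + 1.
Proof.
rewrite /graph_density; set X := _ + _.
have X0 : 0 <= X by rewrite addr_ge0 ?sqr_ge0.
have := sqr_ge0 (Num.sqrt X - 1); rewrite sqrrB1 sqr_sqrtr// -mulr_natl.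
have := sqrtr_ge0 X; lra.
Qed.

Lemma poly_growth_graph_density : poly_growth (fun _ : R => graph_density).
Proof.
apply: (@poly_growth_le _ _ (fun _ z =>
  (a * z.1 + (b - 1) * z.2) ^+ 2 + ((b + 1) * z.1 + d * z.2) ^+ 2 + 1)).
  by poly_growth_tac.
by move=> _ z _; rewrite ger0_norm ?graph_density_le// graph_density_ge0.
Qed.

End quadratic_graph_geometry.

(** * The potential near the origin for S = a I with a^2 = 2 *)

Section origin.
Context {R : realType}.
Variable a : R.
Hypothesis a2 : a ^+ 2 = 2.
Hypothesis potential_constant : forall z,
  integral2 (fun w => graph_density a 0 a w * expR (- graph_dist a 0 a z w)) =
  integral2 (fun w => graph_density a 0 a w * expR (- graph_dist a 0 a (0, 0) w)).

Let N (w : R * R) := w.1 ^+ 2 + w.2 ^+ 2.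
Let rho := @graph_density R a 0 a.
Let E0 := @graph_dist R a 0 a (0, 0).

Let E0E w : E0 w = 3 * N w ^+ 2.
Proof.
transitivity ((1 + a ^+ 2) * N w ^+ 2); last by rewrite a2; ring.
by rewrite /E0 /graph_dist /quad /N /=; ring.
Qed.

Let mrho : measurable_fun setT rho := measurable_graph_density a 0 a.
Let mE0 : measurable_fun setT E0 := measurable_graph_dist a 0 a (0, 0).

(** Second variation of the potential at the origin along v. For the two coordinate directions the
    second-order coefficient of the distance is (6 - 2 a^2) N, which is 2 N because a^2 = 2. *)
Let variation (v : R * R) (E1 : R * R -> R) (E3 : R -> R * R -> R) :
  v.1 ^+ 2 + v.2 ^+ 2 = 1 -> measurable_fun setT E1 ->
  poly_growth (fun _ => E1) -> poly_growth E3 ->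
  (forall e w, graph_dist a 0 a (e * v.1, e * v.2) w =
     E0 w + e * E1 w + e ^+ 2 * (2 * N w) + e ^+ 3 * E3 e w) ->
  integral2 (fun w => (rho w * (E1 w ^+ 2 / 2 - 2 * N w)) * expR (- E0 w)) = 0.
Proof.
move=> v1 mE1 pE1 pE3 hE.
have := @second_variation_eq0 R (fun e => graph_dist a 0 a (e * v.1, e * v.2))
  (fun _ => rho) E3 (fun _ _ => 0) E0 E1 (fun w => 2 * N w) rho (fun=> 0) (fun=> 0)
  1 4 ltr01.
move=> H; rewrite -[RHS]H.
- by apply: eq_integral2 => w; rewrite mulr0 subr0 add0r.
- by move=> e; exact: measurable_graph_dist.
- by [].
- by [].
- by [].
- by rewrite /N; measurability.
- by [].
- exact: measurable_cst.
- exact: measurable_cst.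
- by [].
- by rewrite /N; poly_growth_tac.
- by [].
- exact: poly_growth_graph_density.
- by poly_growth_tac.
- by poly_growth_tac.
- by poly_growth_tac.
- by move=> e w _; rewrite hE.
- by move=> e w _; ring.
- move=> w; rewrite mul1r; apply: le_trans (graph_dist_coercive a 0 a (0, 0) w).
  by rewrite /=; lra.
- move=> e w /andP[e0 e1]; rewrite mul1r.
  apply: le_trans (graph_dist_coercive a 0 a (e * v.1, e * v.2) w) => /=.
  have -> : (e * v.1) ^+ 2 + (e * v.2) ^+ 2 = e ^+ 2 * (v.1 ^+ 2 + v.2 ^+ 2) by ring.
  have : e ^+ 2 <= 1 by rewrite expr_le1// ltW.
  by rewrite v1; lra.
- by move=> e he; rewrite potential_constant.
Qed.

Lemma origin_condition : False.
Proof.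
have v1 := @variation (1, 0) (fun w => - 4 * N w * w.1 + 4 * a * N w * w.2)
  (fun e w => - 4 * w.1 - 4 * a * w.2 + 3 * e).
have {v1} I1 : integral2 (fun w => (rho w * ((- 4 * N w * w.1 + 4 * a * N w * w.2) ^+ 2 / 2
     - 2 * N w)) * expR (- E0 w)) = 0.
  apply: v1; rewrite ?expr1n ?expr0n ?addr0//.
  - by rewrite /N; measurability.
  - by rewrite /N; poly_growth_tac.
  - by poly_growth_tac.
  move=> e w; rewrite E0E.
  transitivity (N w ^+ 2 + a ^+ 2 * N w ^+ 2 + e * (- 4 * N w * w.1 + 4 * a * N w * w.2)
    + e ^+ 2 * (2 * N w + 4 * N w - 2 * a ^+ 2 * N w)
    + e ^+ 3 * (- 4 * w.1 - 4 * a * w.2 + (1 + a ^+ 2) * e)).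
    by rewrite /graph_dist /quad /N /=; ring.
  by rewrite a2; ring.
have v2 := @variation (0, 1) (fun w => - 4 * N w * w.2 - 4 * a * N w * w.1)
  (fun e w => - 4 * w.2 + 4 * a * w.1 + 3 * e).
have {v2} I2 : integral2 (fun w => (rho w * ((- 4 * N w * w.2 - 4 * a * N w * w.1) ^+ 2 / 2
     - 2 * N w)) * expR (- E0 w)) = 0.
  apply: v2; rewrite ?expr1n ?expr0n ?add0r//.
  - by rewrite /N; measurability.
  - by rewrite /N; poly_growth_tac.
  - by poly_growth_tac.
  move=> e w; rewrite E0E.
  transitivity (N w ^+ 2 + a ^+ 2 * N w ^+ 2 + e * (- 4 * N w * w.2 - 4 * a * N w * w.1)
    + e ^+ 2 * (2 * N w + 4 * N w - 2 * a ^+ 2 * N w)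
    + e ^+ 3 * (- 4 * w.2 + 4 * a * w.1 + (1 + a ^+ 2) * e)).
    by rewrite /graph_dist /quad /N /=; ring.
  by rewrite a2; ring.
have prho : poly_growth (fun _ : R => rho) := poly_growth_graph_density a 0 a.
have cE0 : coercive E0 := coercive_graph_dist a 0 a (0, 0).
have int (g : R * R -> R) : measurable_fun setT g -> poly_growth (fun _ => g) ->
    integrable2 (fun w => g w * expR (- E0 w)).
  by move=> mg pg; exact: integrable2_growth_exp.
have II1 : integrable2 (fun w => (rho w * ((- 4 * N w * w.1 + 4 * a * N w * w.2) ^+ 2 / 2
     - 2 * N w)) * expR (- E0 w)).
  by apply: int; rewrite /N; [measurability|poly_growth_tac].
have II2 : integrable2 (fun w => (rho w * ((- 4 * N w * w.2 - 4 * a * N w * w.1) ^+ 2 / 2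
     - 2 * N w)) * expR (- E0 w)).
  by apply: int; rewrite /N; [measurability|poly_growth_tac].
pose f w := N w * rho w.
have IX3 : integrable2 (fun w => f w * expR (- E0 w)).
  by apply: int; rewrite /f /N; [measurability|poly_growth_tac].
have IX7 : integrable2 (fun w => f w * E0 w * expR (- E0 w)).
  have h : integrable2 (fun w => f w * (3 * N w ^+ 2) * expR (- E0 w)).
    by apply: int; rewrite /f /N; [measurability|poly_growth_tac].
  by apply: eq_integrable2 h => w; rewrite -E0E.
(* The squares of the two first-order terms add up to 16 (1 + a^2) N^3 = 16 N E0, so the sum over
   the two directions is radial. *)
have sum : 8 * integral2 (fun w => f w * E0 w * expR (- E0 w)) -
    4 * integral2 (fun w => f w * expR (- E0 w)) = 0.
  rewrite -!integral2Z// -integral2B; [|exact: integrable2Z..].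
  rewrite -[RHS]addr0 -[X in _ = X + _]I1 -[X in _ = _ + X]I2 -integral2D//.
  apply: eq_integral2 => w; rewrite E0E /f.
  have -> : rho w * ((- 4 * N w * w.1 + 4 * a * N w * w.2) ^+ 2 / 2 - 2 * N w) *
      expR (- (3 * N w ^+ 2)) +
    rho w * ((- 4 * N w * w.2 - 4 * a * N w * w.1) ^+ 2 / 2 - 2 * N w) *
      expR (- (3 * N w ^+ 2)) =
    rho w * expR (- (3 * N w ^+ 2)) *
     (8 * (1 + a ^+ 2) * N w ^+ 2 * (w.1 ^+ 2 + w.2 ^+ 2) - 4 * N w) by field.
  by rewrite a2 -/(N w); ring.
have f0 w : 0 <= f w by rewrite /f mulr_ge0 ?sqrtr_ge0// addr_ge0 ?sqr_ge0.
have vir := @virial R f E0 E0 4 _ mE0 mE0 _ _ cE0 f0 3 1 1.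
(* [f] has degree 3 and [E0] degree 4, and the plane contributes 1 + 1, whence 5. Inserted into
   [sum], this leaves (10 - 4) times a positive integral. *)
have {}vir : 4 * integral2 (fun w => f w * E0 w * expR (- E0 w)) =
    5 * integral2 (fun w => f w * expR (- E0 w)).
  apply: vir.
  - by rewrite /f /N; measurability.
  - by rewrite /f /N; poly_growth_tac.
  - by rewrite /E0 /graph_dist /quad /=; poly_growth_tac.
  - by move=> t w t0; rewrite !E0E /N expr1/=; ring.
  - move=> t w t0; rewrite /f /N /rho /graph_density expr1/=.
    rewrite (_ : (a * (t * w.1) + _) ^+ 2 + _ = t ^+ 2 *
      ((a * w.1 + (0 - 1) * w.2) ^+ 2 + ((0 + 1) * w.1 + a * w.2) ^+ 2)); last by ring.
    by rewrite sqrtrM ?sqr_ge0// sqrtr_sqr gtr0_norm//; ring.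
have X3 : 0 < integral2 (fun w => f w * expR (- E0 w)).
  (* On the square N <= 8, so that E0 = 3 N^2 <= 192. *)
  apply: (@lt_le_trans _ _ (expR (- 192))); first exact: expR_gt0.
  apply: integral2_ge_square => //; first by move=> w; rewrite mulr_ge0 ?expR_ge0.
  move=> w /andP[w1 w1'] /andP[w2 w2'].
  have l1 : 1 <= w.1 ^+ 2 by rewrite expr_ge1//; lra.
  have l2 : 1 <= w.2 ^+ 2 by rewrite expr_ge1//; lra.
  have u1 : w.1 ^+ 2 <= 2 ^+ 2 by rewrite lerXn2r ?nnegrE//; lra.
  have u2 : w.2 ^+ 2 <= 2 ^+ 2 by rewrite lerXn2r ?nnegrE//; lra.
  have N1 : 2 <= N w <= 8 by rewrite /N; rewrite !exprS expr0 in l1 l2 u1 u2 *; lra.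
  rewrite -[leLHS]mul1r; apply: ler_pM => //.
    rewrite /f -[leLHS]mul1r; apply: ler_pM => //; first by case/andP: N1; lra.
    rewrite -(ler_sqr (x := 1)) ?nnegrE ?sqrtr_ge0// expr1n sqr_sqrtr ?addr_ge0 ?sqr_ge0//.
    rewrite (_ : _ + _ = (1 + a ^+ 2) * N w); last by rewrite /N; ring.
    by rewrite a2; case/andP: N1; lra.
  rewrite ler_expR lerN2 E0E.
  have : N w ^+ 2 <= 8 ^+ 2 by case/andP: N1 => ? ?; rewrite lerXn2r ?nnegrE//; lra.
  by rewrite !exprS expr0; lra.
lra.
Qed.

End origin.

(** * Anisotropic frames at a point where A does not vanish *)

Section frames.
Context {R : realType}.

(** A translation of the second coordinate is a shear with constant [g]; the first coordinate is
    reached by swapping. *)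
Lemma integral2_affine (x0 y0 k11 k12 k21 k22 : R) :
  k11 * k22 - k12 * k21 != 0 -> forall f, integrable2 f ->
  integrable2 (fun z => f (x0 + (k11 * z.1 + k12 * z.2), y0 + (k21 * z.1 + k22 * z.2))) /\
  integral2 f = `|k11 * k22 - k12 * k21| *
    integral2 (fun z => f (x0 + (k11 * z.1 + k12 * z.2), y0 + (k21 * z.1 + k22 * z.2))).
Proof.
move=> D f If.
have swap_det : (0 : R) * 0 - 1 * 1 != 0 by rewrite mul0r mul1r sub0r oppr_eq0 oner_neq0.
have mc (c : R) : measurable_fun setT (fun _ : R => c) by exact: measurable_cst.
have swap (g : R * R -> R) : integrable2 g ->
    integrable2 (fun z => g (z.2, z.1)) /\ integral2 (fun z => g (z.2, z.1)) = integral2 g.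
  move=> Ig; have [Is Es] := integral2_linear swap_det Ig.
  have E z : g (0 * z.1 + 1 * z.2, 1 * z.1 + 0 * z.2) = g (z.2, z.1).
    by rewrite !mul0r !mul1r add0r addr0.
  split; first by apply: eq_integrable2 Is.
  rewrite -(eq_integral2 E) Es mul0r mul1r sub0r normrN1 invr1 mul1r//.
have [I1 E1] := integral2_shear (mc y0) If.
have [I2 E2] := swap _ I1.
have [I3 E3] := integral2_shear (mc x0) I2.
have [I4 E4] := swap _ I3.
have [I5 E5] := integral2_linear D I4.
split; first by apply: eq_integrable2 I5 => z /=; rewrite addrC [in X in f (_, X)]addrC.
rewrite -E1 -E2 -E3 -E4; apply/eqP.
rewrite eq_sym -[eqbRHS]mul1r -(mulfV (_ : `|k11 * k22 - k12 * k21| != 0)) ?normr_eq0// -mulrA -E5.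
apply/eqP; congr (_ * _); apply: eq_integral2 => z /=.
by rewrite addrC [in X in f (_, X)]addrC.
Qed.

Variables a b d : R.
Local Notation dist := (graph_dist a b d).
Local Notation density := (graph_density a b d).

(* The frame (tau, n) at y : A y = lam *: n, with n the image of the unit vector
   tau under the rotation by a right angle. *)
Variables (y : R * R) (lam t1 t2 : R).
Hypothesis lam0 : 0 < lam.
Hypothesis t_unit : t1 ^+ 2 + t2 ^+ 2 = 1.
Hypothesis Ay1 : a * y.1 + (b - 1) * y.2 = - (lam * t2).
Hypothesis Ay2 : (b + 1) * y.1 + d * y.2 = lam * t1.

Definition frame_q := a * t1 ^+ 2 + 2 * b * t1 * t2 + d * t2 ^+ 2.
Definition frame_m := (b * t1 + d * t2) * t1 - (a * t1 + b * t2) * t2.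
Definition frame_p := a * t2 ^+ 2 - 2 * b * t1 * t2 + d * t1 ^+ 2.

(** The factor 1 / (2 lam) across tau normalises the linear part 2 <A y, h> of the vertical term to
    r^2 z.2, which is of the same order as the quadratic part along tau. *)
Definition frame_point (r : R) (z : R * R) : R * R :=
  (y.1 + (r * t1 * z.1 + - (r ^+ 2 / (2 * lam) * t2) * z.2),
   y.2 + (r * t2 * z.1 + r ^+ 2 / (2 * lam) * t1 * z.2)).

(** For h the displacement from y, the distance is |h|^4 + (2 <A y, h> + <S h, h>)^2: the group law
    contributes <J y, h>, which turns S into A in the linear part. *)
Lemma graph_dist_frame r z :
  dist y (frame_point r z) = r ^+ 4 * blow_dist frame_q frame_m frame_p (r / lam) z.
Proof.
set h1 := r * t1 * z.1 + - (r ^+ 2 / (2 * lam) * t2) * z.2.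
set h2 := r * t2 * z.1 + r ^+ 2 / (2 * lam) * t1 * z.2.
have nh : h1 ^+ 2 + h2 ^+ 2 = r ^+ 2 * (z.1 ^+ 2 + (r / lam * z.2 / 2) ^+ 2).
  transitivity ((t1 ^+ 2 + t2 ^+ 2) * (r ^+ 2 * (z.1 ^+ 2 + (r / lam * z.2 / 2) ^+ 2))).
    by rewrite /h1 /h2; field; rewrite gt_eqF.
  by rewrite t_unit mul1r.
have lin : 2 * ((a * y.1 + (b - 1) * y.2) * h1 + ((b + 1) * y.1 + d * y.2) * h2) =
    r ^+ 2 * z.2.
  rewrite Ay1 Ay2; transitivity ((t1 ^+ 2 + t2 ^+ 2) * (r ^+ 2 * z.2)).
    by rewrite /h1 /h2; field; rewrite gt_eqF.
  by rewrite t_unit mul1r.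
have qh : quad a b d (h1, h2) = r ^+ 2 * (frame_q * z.1 ^+ 2 +
    r / lam * frame_m * z.1 * z.2 + frame_p * (r / lam * z.2) ^+ 2 / 4).
  by rewrite /quad /h1 /h2 /frame_q /frame_m /frame_p /=; field; rewrite gt_eqF.
have -> : dist y (frame_point r z) = (h1 ^+ 2 + h2 ^+ 2) ^+ 2 +
    (2 * ((a * y.1 + (b - 1) * y.2) * h1 + ((b + 1) * y.1 + d * y.2) * h2) +
     quad a b d (h1, h2)) ^+ 2.
  by rewrite /graph_dist /frame_point /quad -/h1 -/h2 /=; ring.
rewrite nh lin qh /blow_dist; ring.
Qed.

Lemma graph_density_frame r z :
  density (frame_point r z) = lam * blow_density frame_q frame_m frame_p (r / lam) z.
Proof.
rewrite /graph_density /blow_density /=.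
rewrite -[X in _ = X * _]ger0_norm ?ltW// -sqrtr_sqr -sqrtrM ?sqr_ge0//; congr Num.sqrt.
set h1 := r * t1 * z.1 + - (r ^+ 2 / (2 * lam) * t2) * z.2.
set h2 := r * t2 * z.1 + r ^+ 2 / (2 * lam) * t1 * z.2.
set e := r / lam; set q := frame_q; set m := frame_m; set p := frame_p.
have -> : a * (y.1 + h1) + (b - 1) * (y.2 + h2) =
    - (lam * t2) + (a * h1 + (b - 1) * h2) by rewrite -Ay1; ring.
have -> : (b + 1) * (y.1 + h1) + d * (y.2 + h2) =
    lam * t1 + ((b + 1) * h1 + d * h2) by rewrite -Ay2; ring.
(* components of A h along tau and n *)
set U := a * h1 + (b - 1) * h2; set V := (b + 1) * h1 + d * h2.
have UV1 : t1 * U + t2 * V = lam * (e * q * z.1 + e ^+ 2 * (m - 1) * z.2 / 2).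
  transitivity (lam * (e * q * z.1 + e ^+ 2 * (m - (t1 ^+ 2 + t2 ^+ 2)) * z.2 / 2)).
    by rewrite /U /V /h1 /h2 /e /q /m /frame_q /frame_m; field; rewrite gt_eqF.
  by rewrite t_unit.
have UV2 : t1 * V - t2 * U = lam * (e * (m + 1) * z.1 + e ^+ 2 * p * z.2 / 2).
  transitivity (lam * (e * (m + (t1 ^+ 2 + t2 ^+ 2)) * z.1 + e ^+ 2 * p * z.2 / 2)).
    by rewrite /U /V /h1 /h2 /e /p /m /frame_p /frame_m; field; rewrite gt_eqF.
  by rewrite t_unit.
(* Multiplying by |t|^2 = 1 rewrites the squared length as the sum of the squared components along n
   and tau. *)
transitivity ((t1 ^+ 2 + t2 ^+ 2) * ((- (lam * t2) + U) ^+ 2 + (lam * t1 + V) ^+ 2)).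
  by rewrite t_unit mul1r.
transitivity ((lam * (t1 ^+ 2 + t2 ^+ 2) + (t1 * V - t2 * U)) ^+ 2 + (t1 * U + t2 * V) ^+ 2).
  by ring.
by rewrite t_unit UV1 UV2; ring.
Qed.

Lemma integral2_frame (r : R) (psi : R * R -> R) : 0 < r ->
  integrable2 (fun w => density w * expR (- (dist y w / r ^+ 4)) * psi w) ->
  integrable2 (fun z => blow_density frame_q frame_m frame_p (r / lam) z *
     expR (- blow_dist frame_q frame_m frame_p (r / lam) z) * psi (frame_point r z)) /\
  integral2 (fun w => density w * expR (- (dist y w / r ^+ 4)) * psi w) =
  r ^+ 3 / 2 * integral2 (fun z => blow_density frame_q frame_m frame_p (r / lam) z *
     expR (- blow_dist frame_q frame_m frame_p (r / lam) z) * psi (frame_point r z)).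
Proof.
move=> r0 If.
have det : r * t1 * (r ^+ 2 / (2 * lam) * t1) - - (r ^+ 2 / (2 * lam) * t2) * (r * t2) =
    r ^+ 3 / (2 * lam).
  transitivity ((t1 ^+ 2 + t2 ^+ 2) * (r ^+ 3 / (2 * lam))); last by rewrite t_unit mul1r.
  by field; rewrite gt_eqF.
have det0 : 0 < r ^+ 3 / (2 * lam) by rewrite divr_gt0 ?exprn_gt0 ?mulr_gt0.
have D : r * t1 * (r ^+ 2 / (2 * lam) * t1) - - (r ^+ 2 / (2 * lam) * t2) * (r * t2) != 0.
  by rewrite det gt_eqF.
have [I E] := integral2_affine y.1 y.2 D If.
have pt z : density (frame_point r z) * expR (- (dist y (frame_point r z) / r ^+ 4)) *
    psi (frame_point r z) = lam * (blow_density frame_q frame_m frame_p (r / lam) z *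
     expR (- blow_dist frame_q frame_m frame_p (r / lam) z) * psi (frame_point r z)).
  rewrite graph_dist_frame graph_density_frame [r ^+ 4 * _]mulrC mulfK ?mulrA//.
  by rewrite gt_eqF// exprn_gt0.
have I' : integrable2 (fun z => lam * (blow_density frame_q frame_m frame_p (r / lam) z *
     expR (- blow_dist frame_q frame_m frame_p (r / lam) z) * psi (frame_point r z))).
  exact: eq_integrable2 pt I.
have I'' : integrable2 (fun z => blow_density frame_q frame_m frame_p (r / lam) z *
     expR (- blow_dist frame_q frame_m frame_p (r / lam) z) * psi (frame_point r z)).
  apply: eq_integrable2 (integrable2Z lam^-1 I') => z.
  by rewrite mulKf// gt_eqF.
split; first exact: I''.
apply: (etrans E); rewrite det (gtr0_norm det0).
apply: (etrans (congr1 _ (eq_integral2 pt))).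
apply: (etrans (congr1 _ (integral2Z lam I''))).
by rewrite mulrA; congr (_ * _); field; rewrite gt_eqF.
Qed.

End frames.

Lemma frame_exists {R : realType} (a b d : R) (y : R * R) :
  0 < graph_density a b d y -> exists t1 t2 : R, [/\ t1 ^+ 2 + t2 ^+ 2 = 1,
    a * y.1 + (b - 1) * y.2 = - (graph_density a b d y * t2) &
    (b + 1) * y.1 + d * y.2 = graph_density a b d y * t1].
Proof.
set lam := graph_density a b d y => lam0.
have lam2 : lam ^+ 2 = (a * y.1 + (b - 1) * y.2) ^+ 2 + ((b + 1) * y.1 + d * y.2) ^+ 2.
  by rewrite sqr_sqrtr// addr_ge0 ?sqr_ge0.
have l0 : lam != 0 by rewrite gt_eqF.
exists (((b + 1) * y.1 + d * y.2) / lam), (- (a * y.1 + (b - 1) * y.2) / lam); split.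
- rewrite !expr_div_n sqrrN -mulrDl addrC -lam2 mulfV// expf_neq0//.
- by field.
- by field.
Qed.

(** * Kernel estimates *)

Lemma expRN_lipschitz {R : realType} (u v : R) : 0 <= u -> 0 <= v ->
  `|expR (- u) - expR (- v)| <= `|u - v|.
Proof.
wlog uv : u v / u <= v.
  move=> H u0 v0; have [uv|/ltW vu] := leP u v; first exact: H.
  by rewrite distrC (distrC u); exact: H.
move=> u0 v0.
rewrite ger0_norm; last by rewrite subr_ge0 ler_expR lerN2.
rewrite distrC ger0_norm ?subr_ge0//.
have h := ler_wpM2l (expR_ge0 (- u)) (expR_ge1Dx (- (v - u))).
have e1 : expR (- u) <= 1 by rewrite -expR0 ler_expR oppr_le0.
have : 0 <= (1 - expR (- u)) * (v - u) by rewrite mulr_ge0//; lra.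
rewrite -expRD (_ : - u + - (v - u) = - v) in h; last by ring.
lra.
Qed.

Section concentration.
Context {R : realType}.
Variables a b d : R.
Local Notation dist := (graph_dist a b d).
Local Notation density := (graph_density a b d).
Implicit Types (w y z : R * R) (r e : R).

Let B := `|a| + 2 * `|b| + `|d|.

Let B0 : 0 <= B.
Proof. by rewrite !addr_ge0// mulr_ge0. Qed.

Let mul_le1 (c x : R) : `|x| <= 1 -> - `|c| <= c * x <= `|c|.
Proof.
by move=> x1; rewrite -ler_norml normrM ler_piMr.
Qed.

Lemma frame_coefficients (t1 t2 : R) : t1 ^+ 2 + t2 ^+ 2 = 1 ->
  [/\ `|frame_q a b d t1 t2| <= B, `|frame_m a b d t1 t2| <= B
    & `|frame_p a b d t1 t2| <= B].
Proof.
move=> t_unit.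
have s1 := sqr_ge0 t1; have s2 := sqr_ge0 t2.
have s12 : `|t1 * t2| <= 1 / 2.
  rewrite ler_norml; have := (sqr_ge0 (t1 - t2), sqr_ge0 (t1 + t2)).
  by move=> [? ?]; apply/andP; split; lra.
have l1 : `|t1 ^+ 2| <= 1 by rewrite ger0_norm//; lra.
have l2 : `|t2 ^+ 2| <= 1 by rewrite ger0_norm//; lra.
have l12 : `|2 * (t1 * t2)| <= 1 by rewrite normrM ger0_norm//; lra.
have l3 : `|t1 ^+ 2 - t2 ^+ 2| <= 1 by rewrite ler_norml; apply/andP; split; lra.
have a0 := normr_ge0 a; have b0 := normr_ge0 b; have d0 := normr_ge0 d.
rewrite /frame_q /frame_m /frame_p /B !ler_norml; split.
- have /andP[? ?] := mul_le1 b l12.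
  have t1a : - `|a| * t1 ^+ 2 <= a * t1 ^+ 2 <= `|a| * t1 ^+ 2.
    by rewrite mulNr -ler_norml normrM [`|t1 ^+ 2|]ger0_norm.
  have /andP[? ?] := mul_le1 a l1; have /andP[? ?] := mul_le1 d l2.
  by apply/andP; split; lra.
- have /andP[? ?] := mul_le1 b l3; have /andP[? ?] := mul_le1 a l12.
  have /andP[? ?] := mul_le1 d l12.
  by apply/andP; split; lra.
- have /andP[? ?] := mul_le1 b l12.
  have /andP[? ?] := mul_le1 a l2; have /andP[? ?] := mul_le1 d l1.
  by apply/andP; split; lra.
Qed.

Lemma blow_density_le (q m p e : R) z : `|q| <= B -> `|m| <= B -> `|p| <= B ->
  0 <= e <= 1 ->
  blow_density q m p e z <= 4 + 5 * (B + 1) ^+ 2 * (z.1 ^+ 2 + z.2 ^+ 2).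
Proof.
move=> qB mB pB /andP[e0 e1]; rewrite /blow_density.
set x := e * (m + 1) * z.1; set v := e ^+ 2 * p * z.2 / 2.
set x' := e * q * z.1; set v' := e ^+ 2 * (m - 1) * z.2 / 2.
have hB := B0; have K0 : 0 <= B + 1 by lra.
have sq (f c t : R) : `|f| <= 1 -> `|c| <= B + 1 -> (f * c * t) ^+ 2 <= (B + 1) ^+ 2 * t ^+ 2.
  move=> f1 cB; rewrite exprMn ler_wpM2r ?sqr_ge0// -real_normK ?num_real//.
  rewrite lerXn2r ?nnegrE// normrM -[leRHS]mul1r ler_pM//.
have e_n : `|e| <= 1 by rewrite ger0_norm.
have e2_n : `|e ^+ 2 / 2| <= 1.
  rewrite normrM ger0_norm ?sqr_ge0// ger0_norm ?invr_ge0//.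
  have : e ^+ 2 <= 1 by rewrite expr_le1.
  lra.
have hx : x ^+ 2 <= (B + 1) ^+ 2 * z.1 ^+ 2.
  by apply: sq => //; rewrite (le_trans (ler_normD _ _))// normr1; lra.
have hv : v ^+ 2 <= (B + 1) ^+ 2 * z.2 ^+ 2.
  rewrite (_ : v = e ^+ 2 / 2 * p * z.2); last by rewrite /v; field.
  by apply: sq => //; lra.
have hx' : x' ^+ 2 <= (B + 1) ^+ 2 * z.1 ^+ 2 by apply: sq => //; lra.
have hv' : v' ^+ 2 <= (B + 1) ^+ 2 * z.2 ^+ 2.
  rewrite (_ : v' = e ^+ 2 / 2 * (m - 1) * z.2); last by rewrite /v'; field.
  by apply: sq => //; rewrite (le_trans (ler_normB _ _))// normr1; lra.
set X := (1 + x + v) ^+ 2 + (x' + v') ^+ 2.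
have X0 : 0 <= X by rewrite addr_ge0 ?sqr_ge0.
have h1 : Num.sqrt X <= X + 1.
  have := sqr_ge0 (Num.sqrt X - 1); rewrite sqrrB1 sqr_sqrtr// -mulr_natl.
  by have := sqrtr_ge0 X; lra.
have h2 : X <= 3 * (1 + x ^+ 2 + v ^+ 2) + 2 * (x' ^+ 2 + v' ^+ 2).
  have := (sqr_ge0 (1 - x), sqr_ge0 (1 - v), sqr_ge0 (x - v), sqr_ge0 (x' - v')).
  by move=> [[[? ?] ?] ?]; rewrite /X; lra.
lra.
Qed.

Lemma integrable2_kernel y r : 0 < r ->
  integrable2 (fun w => density w * expR (- (dist y w / r ^+ 4))).
Proof.
move=> r0; have r4 : 0 < (r ^+ 4)^-1 by rewrite invr_gt0 exprn_gt0.
apply: integrable2_growth_exp.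
- exact: measurable_graph_density.
- by apply: measurable_funM => //; exact: measurable_graph_dist.
- exact: poly_growth_graph_density.
exists (r ^+ 4)^-1, ((2 + 2 * (y.1 ^+ 2 + y.2 ^+ 2)) / r ^+ 4); split=> // w.
rewrite mulrC -mulrBl ler_pM2r//; exact: graph_dist_coercive.
Qed.

Let k := (9 + 40 * B ^+ 2)^-1.
Let k'0 : 0 < 9 + 40 * B ^+ 2.
Proof. by have := sqr_ge0 B; lra. Qed.
Let k0 : 0 < k.
Proof. by rewrite invr_gt0. Qed.

Let blow_ge (q m p e : R) z : `|q| <= B -> `|m| <= B -> `|p| <= B -> 0 <= e <= 1 ->
  k * tangent_dist z <= blow_dist q m p e z.
Proof.
by move=> qB mB pB he; rewrite mulrC ler_pdivrMr// mulrC; exact: blow_dist_ge.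
Qed.

Let coercive_k : coercive (fun z : R * R => k * tangent_dist z).
Proof.
exists k, (2 * k); split=> // z.
by have := ler_wpM2l (ltW k0) (tangent_dist_ge z); rewrite mulrBr (mulrC k 2).
Qed.

Let integrable_far : integrable2 (fun z : R * R =>
  (4 + 5 * (B + 1) ^+ 2 * (z.1 ^+ 2 + z.2 ^+ 2)) * expR (- (k * tangent_dist z))).
Proof.
apply: integrable2_growth_exp.
- by measurability.
- by apply: measurable_funM => //; exact: measurable_tangent_dist.
- by poly_growth_tac.
- exact: coercive_k.
Qed.

(** A polynomial majorant of sqrt (2 + 2 |A z|^2), hence of |A (y + r z)| / r as soon as |A y| <=
    r. *)
Let near_weight z := 3 + 2 * ((a * z.1 + (b - 1) * z.2) ^+ 2 +
  ((b + 1) * z.1 + d * z.2) ^+ 2).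

Let integrable_near : integrable2 (fun z : R * R =>
  near_weight z * expR (- (z.1 ^+ 2 + z.2 ^+ 2) ^+ 2)).
Proof.
apply: integrable2_growth_exp.
- by rewrite /near_weight; measurability.
- by measurability.
- by rewrite /near_weight; poly_growth_tac.
exists 1, 2; split=> // z; have := sqr_ge0 (z.1 ^+ 2 + z.2 ^+ 2 - 1 / 2); lra.
Qed.

(** Uniformity in y, up to the zeros of A, comes from two regimes. If r <= |A y|, the frame at y
    applies with e = r / |A y| <= 1. If r > |A y|, an isotropic dilation by r suffices: the area
    gives r^2, the density is O(r), and the distance is at least r^4 |z|^4. *)
Lemma kernel_bound : exists C, 0 <= C /\ forall y r, 0 < r ->
  integral2 (fun w => density w * expR (- (dist y w / r ^+ 4))) <= C * r ^+ 3.
Proof.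
pose C1 := integral2 (fun z : R * R =>
  (4 + 5 * (B + 1) ^+ 2 * (z.1 ^+ 2 + z.2 ^+ 2)) * expR (- (k * tangent_dist z))).
pose C2 := integral2 (fun z : R * R =>
  near_weight z * expR (- (z.1 ^+ 2 + z.2 ^+ 2) ^+ 2)).
have C10 : 0 <= C1.
  apply: integral2_ge0 => z; rewrite mulr_ge0 ?expR_ge0// addr_ge0//.
  by rewrite !mulr_ge0 ?sqr_ge0// addr_ge0 ?sqr_ge0.
have nw0 z : 0 <= near_weight z.
  by rewrite /near_weight addr_ge0// mulr_ge0// addr_ge0 ?sqr_ge0.
have C20 : 0 <= C2 by apply: integral2_ge0 => z; rewrite mulr_ge0 ?expR_ge0.
exists (C1 + C2); split; first exact: addr_ge0.
move=> y r r0; have r30 : 0 < r ^+ 3 by rewrite exprn_gt0.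
have r40 : 0 < r ^+ 4 by rewrite exprn_gt0.
have [r_le|r_gt] := leP r (density y).
  have lam0 : 0 < density y by exact: lt_le_trans r_le.
  have [t1 [t2 [t_unit Ay1 Ay2]]] := frame_exists lam0.
  have [qB mB pB] := frame_coefficients t_unit.
  have he : 0 <= r / density y <= 1.
    by apply/andP; split; [rewrite divr_ge0// ltW|rewrite ler_pdivrMr// mul1r].
  have I1 : integrable2 (fun w => density w * expR (- (dist y w / r ^+ 4)) * 1).
    by apply: eq_integrable2 (integrable2_kernel y r0) => w; rewrite mulr1.
  have [Ib Eb] := integral2_frame lam0 t_unit Ay1 Ay2 r0 I1.
  rewrite (@eq_integral2 _ _ (fun w => density w * expR (- (dist y w / r ^+ 4)) * 1)).
    apply: (@le_trans _ _ (r ^+ 3 / 2 * C1)); last first.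
      have := mulr_ge0 (ltW r30) C10; have := mulr_ge0 (ltW r30) C20; lra.
    rewrite Eb ler_wpM2l//; first by rewrite divr_ge0// ltW.
    apply: le_integral2 => // z; rewrite mulr1; apply: ler_pM.
    - exact: sqrtr_ge0.
    - exact: expR_ge0.
    - exact: blow_density_le.
    - by rewrite ler_expR lerN2; exact: blow_ge.
  by move=> w; rewrite mulr1.
have det : r * r - 0 * 0 != 0 by rewrite mul0r subr0 mulf_neq0// gt_eqF.
have [Ia Ea] := integral2_affine y.1 y.2 det (integrable2_kernel y r0).
apply: (@le_trans _ _ (r * r * (r * C2))); last first.
  have := mulr_ge0 (ltW r30) C10; rewrite !exprS expr0; lra.
rewrite Ea mul0r subr0 (gtr0_norm (mulr_gt0 r0 r0)).
apply: ler_wpM2l; first by rewrite mulr_ge0// ltW.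
rewrite /C2 -integral2Z//; apply: le_integral2 => //; first exact: integrable2Z.
move=> z; rewrite mulrA; apply: ler_pM.
- exact: graph_density_ge0.
- exact: expR_ge0.
- rewrite /graph_density /=.
  set U := a * y.1 + (b - 1) * y.2; set V := (b + 1) * y.1 + d * y.2.
  set P := a * z.1 + (b - 1) * z.2; set Q := (b + 1) * z.1 + d * z.2.
  have UV : U ^+ 2 + V ^+ 2 <= r ^+ 2.
    have <- : density y ^+ 2 = U ^+ 2 + V ^+ 2 by rewrite sqr_sqrtr// addr_ge0 ?sqr_ge0.
    by rewrite lerXn2r ?nnegrE ?graph_density_ge0 ?ltW.
  set s := Num.sqrt _.
  have s0 : 0 <= s by exact: sqrtr_ge0.
  have W0 : 0 <= P ^+ 2 + Q ^+ 2 by rewrite addr_ge0 ?sqr_ge0.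
  have hs : s ^+ 2 <= r ^+ 2 * (2 + 2 * (P ^+ 2 + Q ^+ 2)).
    rewrite sqr_sqrtr ?addr_ge0 ?sqr_ge0//.
    have -> : a * (y.1 + (r * z.1 + 0 * z.2)) + (b - 1) * (y.2 + (0 * z.1 + r * z.2)) =
        U + r * P by rewrite /U /P; ring.
    have -> : (b + 1) * (y.1 + (r * z.1 + 0 * z.2)) + d * (y.2 + (0 * z.1 + r * z.2)) =
        V + r * Q by rewrite /V /Q; ring.
    have := (sqr_ge0 (U - r * P), sqr_ge0 (V - r * Q)); move=> [? ?]; lra.
  rewrite -(ler_sqr (x := s)) ?nnegrE//; last by rewrite mulr_ge0// ltW.
  apply: (le_trans hs); rewrite exprMn ler_wpM2l ?sqr_ge0// /near_weight -/P -/Q.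
  have : 0 <= (P ^+ 2 + Q ^+ 2) ^+ 2 by exact: sqr_ge0.
  lra.
- rewrite ler_expR lerN2 ler_pdivlMr// /graph_dist /=.
  set T := (_ + 2 * _) ^+ 2; have : 0 <= T by exact: sqr_ge0.
  lra.
Qed.

(** The weighted kernel is an approximate identity of mass T / 2 at y, tested on e^(- P x0 w). The
    constant may depend on y, since domination is provided separately by [kernel_bound]. *)
Lemma kernel_concentration (x0 y : R * R) : 0 < density y ->
  exists C, forall r, 0 < r <= density y ->
  `|integral2 (fun w => density w * expR (- (dist y w / r ^+ 4)) * expR (- dist x0 w)) / r ^+ 3
    - integral2 (fun z => expR (- @tangent_dist R z)) / 2 * expR (- dist x0 y)| <= C * r.
Proof.
set lam := density y => lam0.
have [t1 [t2 [t_unit Ay1 Ay2]]] := frame_exists lam0.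
have [qB mB pB] := frame_coefficients t_unit.
set q := frame_q a b d t1 t2 in qB *; set m := frame_m a b d t1 t2 in mB *.
set p := frame_p a b d t1 t2 in pB *.
(* With r = e lam, the displacement of the frame point from y is e (h1, h2). [dX], [dT] and [D] are
   the resulting difference quotients of the squared horizontal length [X], of the vertical term [T]
   and of the distance X^2 + T^2. *)
pose h1 e (z : R * R) := lam * t1 * z.1 - e * (lam * t2 * z.2 / 2).
pose h2 e (z : R * R) := lam * t2 * z.1 + e * (lam * t1 * z.2 / 2).
pose dX e z := 2 * ((y.1 - x0.1) * h1 e z + (y.2 - x0.2) * h2 e z) +
  e * (h1 e z ^+ 2 + h2 e z ^+ 2).
pose dT e z := 2 * (a * y.1 * h1 e z + b * (y.1 * h2 e z + y.2 * h1 e z) + d * y.2 * h2 e z)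
  + 2 * (x0.1 * h2 e z - x0.2 * h1 e z) +
  e * (a * h1 e z ^+ 2 + 2 * b * (h1 e z * h2 e z) + d * h2 e z ^+ 2).
pose X := (y.1 - x0.1) ^+ 2 + (y.2 - x0.2) ^+ 2.
pose T := quad a b d y - quad a b d x0 + 2 * (x0.1 * y.2 - x0.2 * y.1).
pose D e z := dX e z * (2 * X + e * dX e z) + dT e z * (2 * T + e * dT e z).
have DE e z : dist x0 (frame_point y lam t1 t2 (e * lam) z) - dist x0 y = e * D e z.
  have -> : frame_point y lam t1 t2 (e * lam) z = (y.1 + e * h1 e z, y.2 + e * h2 e z).
    by rewrite /frame_point /h1 /h2; congr (_, _); field; rewrite gt_eqF.
  by rewrite /graph_dist /D /dX /dT /X /T /quad /=; ring.
have [C [n [C0 HC]]] : poly_growth (fun e z =>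
    (4 + 5 * (B + 1) ^+ 2 * (z.1 ^+ 2 + z.2 ^+ 2)) * `|D e z|).
  by rewrite /D /dX /dT /h1 /h2; poly_growth_tac.
pose g z := C * (1 + z.1 ^+ 2 + z.2 ^+ 2) ^+ n * expR (- (k * tangent_dist z)).
have Ig : integrable2 g.
  apply: integrable2_growth_exp => //.
  - by measurability.
  - by apply: measurable_funM => //; exact: measurable_tangent_dist.
  - by poly_growth_tac.
have [C1 [c1 H1]] := blow_up_expansion q m p.
set c2 := moment 2 0 * _ in H1.
set Tt := integral2 (fun z => expR (- tangent_dist z)) in H1 *.
exists ((integral2 g + (`|c1| + `|c2| + C1)) / lam) => r /andP[r0 r_le].
set e := r / lam.
have e0 : 0 < e by rewrite divr_gt0.
have e1 : e <= 1 by rewrite ler_pdivrMr// mul1r.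
have he : 0 < e <= 1 by rewrite e0.
have er : r = e * lam by rewrite /e divfK// gt_eqF.
have r30 : r ^+ 3 != 0 by rewrite expf_neq0// gt_eqF.
have phi1 w : expR (- dist x0 w) <= 1 by rewrite -expR0 ler_expR oppr_le0 graph_dist_ge0.
have If : integrable2 (fun w => density w * expR (- (dist y w / r ^+ 4)) * expR (- dist x0 w)).
  apply: le_integrable2 (integrable2_kernel y r0) _.
    apply: measurable_funM; last by apply: measurable_fun_expR; apply: measurable_fun_oppr;
      exact: measurable_graph_dist.
    apply: measurable_funM; first exact: measurable_graph_density.
    apply: measurable_fun_expR; apply: measurable_fun_oppr; apply: measurable_funM => //.
    exact: measurable_graph_dist.
  move=> w; rewrite ger0_norm; last by rewrite !mulr_ge0 ?expR_ge0 ?graph_density_ge0.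
  by rewrite ler_piMr// mulr_ge0 ?expR_ge0 ?graph_density_ge0.
have [Ib Eb] := integral2_frame lam0 t_unit Ay1 Ay2 r0 If.
pose F z := blow_density q m p e z * expR (- blow_dist q m p e z).
have {}Eb : integral2 (fun w => density w * expR (- (dist y w / r ^+ 4)) *
    expR (- dist x0 w)) = r ^+ 3 / 2 *
    integral2 (fun z => F z * expR (- dist x0 (frame_point y lam t1 t2 r z))) by [].
have {}Ib : integrable2 (fun z => F z * expR (- dist x0 (frame_point y lam t1 t2 r z))) by [].
have I1 : integrable2 (fun w => density w * expR (- (dist y w / r ^+ 4)) * 1).
  by apply: eq_integrable2 (integrable2_kernel y r0) => w; rewrite mulr1.
have [IF _] := integral2_frame lam0 t_unit Ay1 Ay2 r0 I1.
have {I1} {}IF : integrable2 F by apply: eq_integrable2 IF => z; rewrite mulr1.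
set phi := expR (- dist x0 y).
have IFp : integrable2 (fun z => phi * F z) by exact: integrable2Z.
have tail : `|integral2 (fun z => F z * expR (- dist x0 (frame_point y lam t1 t2 r z))) -
    phi * integral2 F| <= e * integral2 g.
  rewrite -integral2Z// -integral2B// -integral2Z//.
  apply: le_norm_integral2.
  - exact: integrable2B.
  - exact: integrable2Z.
  move=> z.
  have -> : F z * expR (- dist x0 (frame_point y lam t1 t2 r z)) - phi * F z =
    F z * (expR (- dist x0 (frame_point y lam t1 t2 r z)) - phi) by ring.
  have lip : `|expR (- dist x0 (frame_point y lam t1 t2 r z)) - phi| <= e * `|D e z|.
    rewrite -[X in _ <= X * _](gtr0_norm e0) -normrM -DE -er /phi.
    by apply: expRN_lipschitz; exact: graph_dist_ge0.
  rewrite normrM; apply: (le_trans (ler_wpM2l (normr_ge0 _) lip)).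
  rewrite mulrCA; apply: ler_wpM2l; first exact: ltW.
  have F0 : 0 <= F z by rewrite mulr_ge0 ?expR_ge0 ?sqrtr_ge0.
  rewrite ger0_norm// /F /g mulrAC; apply: ler_pM.
  - by rewrite mulr_ge0 ?sqrtr_ge0.
  - exact: expR_ge0.
  - have := HC e z he; apply: le_trans; apply: le_trans (ler_norm _).
    rewrite ler_wpM2r//; apply: blow_density_le => //; by rewrite e1 ltW.
  - by rewrite ler_expR lerN2; apply: blow_ge => //; rewrite e1 ltW.
have main : `|integral2 F - Tt| <= e * (`|c1| + `|c2| + C1).
  have := H1 e he; rewrite -/(integral2 F) => h.
  have C10 : 0 <= C1.
    have := H1 1; rewrite ltr01 lexx !expr1n !mulr1 => /(_ isT).
    by apply: le_trans; exact: normr_ge0.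
  have e2 : e ^+ 2 <= e by rewrite expr2 ler_piMr// ltW.
  have e3 : e ^+ 3 <= e.
    by rewrite exprS; apply: ler_piMr; [exact: ltW|apply: exprn_ile1 => //; exact: ltW].
  have -> : integral2 F - Tt = (integral2 F - (Tt + e * c1 + e ^+ 2 * c2)) +
    (e * c1 + e ^+ 2 * c2) by ring.
  apply: (le_trans (ler_normD _ _)).
  have b2 : `|e * c1 + e ^+ 2 * c2| <= e * `|c1| + e * `|c2|.
    apply: (le_trans (ler_normD _ _)); rewrite [`|e * c1|]normrM [`|e ^+ 2 * c2|]normrM (gtr0_norm e0).
    by rewrite lerD2l (ger0_norm (sqr_ge0 e)) ler_wpM2r.
  have b3 : C1 * e ^+ 3 <= C1 * e by rewrite ler_wpM2l.
  lra.
rewrite Eb.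
have -> : r ^+ 3 / 2 * integral2 (fun z =>
      F z * expR (- dist x0 (frame_point y lam t1 t2 r z))) / r ^+ 3 - Tt / 2 * phi =
    ((integral2 (fun z => F z * expR (- dist x0 (frame_point y lam t1 t2 r z))) -
    phi * integral2 F) + phi * (integral2 F - Tt)) / 2.
  by field; rewrite gt_eqF.
rewrite normrM [`|2^-1|]gtr0_norm ?invr_gt0// ler_pdivrMr//.
apply: (le_trans (ler_normD _ _)).
have b4 : `|phi * (integral2 F - Tt)| <= e * (`|c1| + `|c2| + C1).
  rewrite normrM gtr0_norm ?expR_gt0//; apply: le_trans main.
  by apply: ler_piMl => //; exact: phi1.
have -> : (integral2 g + (`|c1| + `|c2| + C1)) / lam * r * 2 =
    2 * (e * integral2 g + e * (`|c1| + `|c2| + C1)).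
  by rewrite /e; field; rewrite gt_eqF.
have := le_trans (normr_ge0 _) tail; have := le_trans (normr_ge0 _) main.
lra.
Qed.

End concentration.

(** * Uniform measures of the plane *)

Section exponential_tail.
Import numFieldNormedType.Exports.

Lemma integral_expRN_tail {R : realType} (s x : R) : 0 < s ->
  (\int[lebesgue_measure]_(t in `[x, +oo[) (expR (- (s * t)))%:E =
   (expR (- (s * x)) / s)%:E)%E.
Proof.
move=> s0.
pose F : R -> R := (- s^-1) *: (expR \o (( - s) *: id)).
have FE (t : R) : F t = - s^-1 * expR (- (s * t)).
  by rewrite /F !fctE /GRing.scale/= (mulNr s t).
have dF (t : R) : is_derive t 1 F (expR (- (s * t))).
  apply: is_derive_eq; change (- s^-1 * (expR (- s * t) * (- s * 1)) = expR (- (s * t))); rewrite (mulNr s t).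
  by field; rewrite gt_eqF.
have cF : continuous F.
  by move=> t; apply: differentiable_continuous; apply/derivable1_diffP; case: (dF t).
rewrite (@ge0_continuous_FTC2y _ _ F _ 0).
- by rewrite FE sub0e -EFinN; congr EFin; field; rewrite gt_eqF.
- by move=> t _; exact: expR_ge0.
- apply: continuous_subspaceT => t.
  apply: (@continuous_comp _ _ _ (fun t => - (s * t)) expR); last exact: continuous_expR.
  by apply: cvgN; apply: cvgMr; exact: cvg_id.
- rewrite (_ : 0 = - s^-1 * 0); last by rewrite mulr0.
  rewrite (_ : F = fun t => - s^-1 * expR (- (s * t))); last exact/funext.
  apply: cvgMr.
  apply: (@cvg_comp _ _ _ (fun t => s * t) (fun t => expR (- t)) _ (@pinfty_nbhs R)).
    exact: gt0_cvgMry.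
  exact: cvgr_expR.
- by move=> t _; case: (dF t).
- by apply: cvg_at_right_filter; exact: cF.
- by move=> t _; rewrite derive1E; exact: derive_val.
Qed.

End exponential_tail.

Section layer_cake.
Context dsp (T : measurableType dsp) (R : realType).
Variable nu : {sigma_finite_measure set T -> \bar R}.
Local Notation leb := (@lebesgue_measure R).

(** Tonelli for e^(- f w), written as the integral of e^(- t) over t >= f w. *)
Lemma layer_cake_expR (f : T -> R) : measurable_fun setT f ->
  (\int[nu]_w (expR (- f w))%:E =
   \int[leb]_t ((expR (- t))%:E * nu [set w | (f w <= t)%R]))%E.
Proof.
move=> mf.
pose A : set (T * R) := [set z | f z.1 <= z.2].
have mA : measurable A.
  rewrite -[A]setTI; apply: measurable_fun_le => //.
    exact: (measurableT_comp mf measurable_fst).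
pose g (z : T * R) : \bar R := (expR (- z.2) * \1_A z)%:E.
have mg : measurable_fun setT g.
  apply/measurable_EFinP; apply: measurable_funM; last exact: measurable_indic.
  by apply: measurable_fun_expR; apply: measurable_fun_oppr; exact: measurable_snd.
have g0 z : (0 <= g z)%E by rewrite lee_fin mulr_ge0 ?expR_ge0.
transitivity (\int[nu]_w \int[leb]_t g (w, t))%E.
  apply: eq_integral => w _; rewrite /g /=.
  have := integral_expRN_tail (f w) (@ltr01 R).
  rewrite mul1r divr1 => <-; rewrite integral_mkcond.
  apply: eq_integral => t _; rewrite /patch/= indicE.
  have -> : ((w, t) \in A) = (t \in `[f w, +oo[%classic).
    by apply/idP/idP; rewrite !inE /A/= in_itv/= andbT.
  by case: (t \in _); rewrite ?mul1r ?mulr1 ?mulr0.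
rewrite (fubini_tonelli (m1 := nu) (m2 := leb) g)//.
apply: eq_integral => t _; rewrite /g /=.
under eq_integral do rewrite EFinM.
rewrite ge0_integralZl ?lee_fin ?expR_ge0//; last first.
  apply/measurable_EFinP; apply: (measurable_fun_pair1 (f := \1_A : T * R -> R)); exact: measurable_indic.
congr (_ * _)%E.
have mB : measurable [set w | f w <= t].
  rewrite -[X in measurable X]setTI; apply: measurable_fun_le => //.
transitivity (\int[nu]_w (\1_[set w | f w <= t] w)%:E)%E; last by rewrite integral_indic// setIT.
by apply: eq_integral => w _; rewrite !indicE; congr ((_ : bool)%:R)%:E; apply/idP/idP; rewrite !inE.
Qed.

End layer_cake.

Lemma sigma_finite_measure_pack dsp (T : measurableType dsp) (R : realType)
    (nu : {measure set T -> \bar R}) : sigma_finite setT nu ->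
  exists nu' : {sigma_finite_measure set T -> \bar R}, nu' = nu :> (set T -> \bar R).
Proof.
move=> H.
pose H2 := isSFinite.Build _ _ _ _ (sfinite_measure_sigma_finite H).
pose H3 := isSigmaFinite.Build _ _ _ _ H.
by exists (HB.pack_for (SigmaFiniteMeasure.type T R) (Measure.sort nu) H2 H3).
Qed.

Lemma le_eps_eq0 {R : realType} (x : \bar R) (C : R) : (0 <= x)%E ->
  (forall e : R, 0 < e <= 1 -> (x <= (C * e)%:E)%E) -> x = 0%E.
Proof.
move=> x0 H; have h1 := H 1; rewrite ltr01 lexx in h1.
have := le_lt_trans (h1 isT) (ltry _).
case: x x0 H {h1} => [x| |]//; rewrite lee_fin => x0 H _; congr EFin.
have C0 : 0 <= C.
  have := H 1; rewrite ltr01 lexx lee_fin mulr1 => /(_ isT); exact: le_trans.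
apply/eqP; rewrite eq_le x0 andbT leNgt; apply/negP => xp.
pose e := Num.min 1 (x / (2 * (C + 1))).
have D1 : 0 < 2 * (C + 1) by lra.
have e0 : 0 < e by rewrite lt_min ltr01 divr_gt0.
have e1 : e <= 1 by rewrite ge_min lexx.
have := H e; rewrite e0 e1 lee_fin => /(_ isT).
have : e <= x / (2 * (C + 1)) by rewrite ge_min lexx orbT.
by rewrite ler_pdivlMr// => h1 h2; nra.
Qed.

Section uniform_plane_measure.
Context {R : realType}.
Variables a b d : R.
Local Notation dist := (graph_dist a b d).
Local Notation density := (graph_density a b d).
Local Notation leb := (@lebesgue_measure R).
Local Notation leb2 := (leb \x leb)%E.
Variable nu : {sigma_finite_measure set (R * R)%type -> \bar R}.
Variable c : R.
Hypothesis c0 : 0 < c.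
Hypothesis nu_ball : forall (z : R * R) (r : R), 0 < r ->
  nu [set w | dist z w <= r ^+ 4] = (c * r ^+ 3)%:E.

Lemma measurable_graph_ball (z : R * R) (t : R) : measurable [set w | dist z w <= t].
Proof.
rewrite -[X in measurable X]setTI; apply: measurable_fun_le => //.
exact: measurable_graph_dist.
Qed.

Let root4 (t : R) := Num.sqrt (Num.sqrt t).

Let root4K (t : R) : 0 <= t -> root4 t ^+ 4 = t.
Proof. by move=> t0; rewrite (exprM _ 2 2) !sqr_sqrtr// sqrtr_ge0. Qed.

Lemma nu_sublevel (z : R * R) (r t : R) : 0 < r ->
  nu [set w | dist z w / r ^+ 4 <= t] = (c * (root4 t * r) ^+ 3)%:E.
Proof.
move=> r0; have r40 : 0 < r ^+ 4 by rewrite exprn_gt0.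
have [t0|t0] := ltP 0 t.
  have s0 : 0 < root4 t by rewrite !sqrtr_gt0.
  rewrite -(nu_ball z (mulr_gt0 s0 r0)); congr (nu _); apply/seteqP.
  by split=> w /=; rewrite exprMn (root4K (ltW t0)) ler_pdivrMr.
have -> : root4 t = 0 by rewrite /root4 (ler0_sqrtr t0) sqrtr0.
rewrite mul0r expr0n/= mulr0.
have mS : measurable [set w | dist z w / r ^+ 4 <= t].
  rewrite -[X in measurable X]setTI; apply: measurable_fun_le => //.
  by apply: measurable_funM => //; exact: measurable_graph_dist.
apply: (@le_eps_eq0 _ _ c) => // e /andP[e0 e1].
apply: (@le_trans _ _ (nu [set w | dist z w <= e ^+ 4])).
  apply: le_measure; rewrite ?inE//; first exact: measurable_graph_ball.
  move=> w /=; rewrite ler_pdivrMr// => h; apply: (le_trans h).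
  by apply: (@le_trans _ _ 0); [rewrite pmulr_lle0|rewrite exprn_ge0// ltW].
rewrite nu_ball// lee_fin ler_pM2l// exprS; apply: ler_piMr; first exact: ltW.
by apply: exprn_ile1 => //; exact: ltW.
Qed.

Definition kernel_mass : R := fine (\int[nu]_w (expR (- dist (0, 0) w))%:E).

(** This is c Gamma(7/4), the integrand being 0 for t <= 0. Only its finiteness and positivity
    matter. *)
Let K := (\int[leb]_t (expR (- t) * (c * root4 t ^+ 3))%:E)%E.

Let integral_kernelK (z : R * R) (r : R) : 0 < r ->
  (\int[nu]_w (expR (- (dist z w / r ^+ 4)))%:E = (r ^+ 3)%:E * K)%E.
Proof.
move=> r0; rewrite layer_cake_expR; last first.
  by apply: measurable_funM => //; exact: measurable_graph_dist.
rewrite /K -ge0_integralZl//.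
- apply: eq_integral => t _; rewrite nu_sublevel// -!EFinM; congr EFin; ring.
- apply/measurable_EFinP; rewrite /root4; measurability.
- move=> t _; rewrite lee_fin !mulr_ge0 ?expR_ge0 ?exprn_ge0 ?sqrtr_ge0//; exact: ltW.
- by rewrite lee_fin exprn_ge0// ltW.
Qed.

Let K_lty : (K < +oo)%E.
Proof.
(* Since t^(3/4) <= 1 + t <= 2 e^(t/2) for t >= 0, the integrand is at most 2 c e^(- t/2). *)
have tail : (\int[leb]_(t in `[0%R, +oo[) (expR (- (1 / 2 * t)))%:E =
    (expR (- (1 / 2 * 0)) / (1 / 2))%:E)%E by exact: integral_expRN_tail.
apply: (@le_lt_trans _ _ ((2 * c)%:E * \int[leb]_(t in `[0%R, +oo[) (expR (- (1 / 2 * t)))%:E)%E);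
  last by rewrite tail -EFinM ltry.
rewrite -ge0_integralZl//; last 2 first.
- by apply/measurable_EFinP; apply: measurable_funTS; measurability.
- by rewrite lee_fin mulr_ge0// ltW.
rewrite [leRHS]integral_mkcond; apply: ge0_le_integral => //.
- move=> t _; rewrite lee_fin !mulr_ge0 ?expR_ge0 ?exprn_ge0 ?sqrtr_ge0//; exact: ltW.
- by apply/measurable_EFinP; rewrite /root4; measurability.
- apply/(measurable_restrictT _ _).1 => //; apply: measurable_funTS.
  by apply/measurable_EFinP; measurability.
move=> t _; rewrite /patch/=; case: ifPn => [|t0]; last first.
  have -> : root4 t = 0.
    rewrite /root4 (@ler0_sqrtr _ t) ?sqrtr0//.
    by move: t0; rewrite notin_setE /= in_itv/= andbT => /negP; rewrite -ltNge => /ltW.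
  by rewrite expr0n/= !mulr0.
rewrite inE/= in_itv/= andbT => t0.
rewrite -EFinM lee_fin.
have r0 : 0 <= root4 t by exact: sqrtr_ge0.
have r3 : root4 t ^+ 3 <= 1 + t.
  rewrite -[X in _ <= 1 + X]root4K//; have := sqr_ge0 (root4 t ^+ 2 - root4 t / 2).
  have := sqr_ge0 (root4 t); have := sqr_ge0 (root4 t / 2 - 1).
  rewrite !exprS !expr0; nra.
have e1 : 1 + t <= 2 * expR (1 / 2 * t) by have := expR_ge1Dx (1 / 2 * t); lra.
have -> : expR (- t) = expR (- (1 / 2 * t)) * expR (- (1 / 2 * t)).
  by rewrite -expRD; congr expR; field.
have e2 : expR (- (1 / 2 * t)) * expR (1 / 2 * t) = 1 by rewrite -expRD addNr expR0.
have e3 := expR_gt0 (- (1 / 2 * t)).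
have h1 : expR (- (1 / 2 * t)) * root4 t ^+ 3 <= 2.
  apply: (le_trans (ler_wpM2l (ltW e3) (le_trans r3 e1))); lra.
have := ler_wpM2l (mulr_ge0 (ltW c0) (ltW e3)) h1; lra.
Qed.

Let K_kernel_mass : K = kernel_mass%:E.
Proof.
have <- : (\int[nu]_w (expR (- dist (0, 0) w))%:E = K)%E.
  have := integral_kernelK (0, 0) ltr01; rewrite !expr1n mul1e => <-.
  by apply: eq_integral => w _; rewrite divr1.
rewrite /kernel_mass fineK//.
have := integral_kernelK (0, 0) ltr01; rewrite !expr1n mul1e.
under eq_integral do rewrite divr1.
move=> ->; rewrite ge0_fin_numE ?K_lty//; apply: integral_ge0 => t _.
by rewrite lee_fin !mulr_ge0 ?expR_ge0 ?exprn_ge0 ?sqrtr_ge0//; exact: ltW.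
Qed.

Lemma integral_kernel (z : R * R) (r : R) : 0 < r ->
  (\int[nu]_w (expR (- (dist z w / r ^+ 4)))%:E = (r ^+ 3 * kernel_mass)%:E)%E.
Proof. by move=> r0; rewrite integral_kernelK// K_kernel_mass EFinM. Qed.

Lemma kernel_mass_gt0 : 0 < kernel_mass.
Proof.
rewrite -lte_fin; have := integral_kernel (0, 0) ltr01; rewrite !expr1n mul1r => <-.
under eq_integral do rewrite divr1.
pose B1 := [set w | dist (0, 0) w <= 1].
have mB : measurable B1 by exact: measurable_graph_ball.
apply: (@lt_le_trans _ _ (\int[nu]_(w in B1) (expR (- 1))%:E)%E).
  rewrite integral_cst// [X in (_ * X)%E](_ : _ = (c * 1 ^+ 3)%:E); last first.
    by rewrite -(nu_ball (0, 0) ltr01) expr1n.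
  by rewrite -EFinM lte_fin expr1n mulr1 mulr_gt0 ?expR_gt0.
have mE : measurable_fun setT (fun w => (expR (- dist (0, 0) w))%:E).
  apply/measurable_EFinP; apply: measurable_fun_expR; apply: measurable_fun_oppr.
  exact: measurable_graph_dist.
apply: (@le_trans _ _ (\int[nu]_(w in B1) (expR (- dist (0, 0) w))%:E)%E).
  apply: ge0_le_integral => //.
  - exact: measurable_funTS.
  - by move=> w /= h; rewrite lee_fin ler_expR lerN2.
apply: ge0_subset_integral => //.
Qed.

End uniform_plane_measure.

(** * The quasi-metric on the plane and the zeros of A *)

Section graph_dist_theory.
Context {R : realType}.
Variables a b d : R.
Local Notation dist := (graph_dist a b d).
Local Notation density := (graph_density a b d).
Implicit Types w z x : R * R.

(** The vertical terms add up to an error 2 (u1 v2 - u2 v1) from the group law, which is bounded by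
    the horizontal lengths. Any constant up to 16 = 2^4 serves, that being the divisor in the
    dominating function of [H_le]. *)
Lemma graph_dist_quasi_triangle x z w : dist x w <= 14 * (dist x z + dist z w).
Proof.
rewrite /graph_dist.
set u1 := z.1 - x.1; set u2 := z.2 - x.2; set v1 := w.1 - z.1; set v2 := w.2 - z.2.
set t1 := quad a b d z - quad a b d x + _; set t2 := quad a b d w - quad a b d z + _.
have -> : w.1 - x.1 = u1 + v1 by rewrite /u1 /v1; ring.
have -> : w.2 - x.2 = u2 + v2 by rewrite /u2 /v2; ring.
have -> : quad a b d w - quad a b d x + 2 * (x.1 * w.2 - x.2 * w.1) =
    t1 + t2 - 2 * (u1 * v2 - u2 * v1) by rewrite /t1 /t2 /u1 /u2 /v1 /v2; ring.
set om := u1 * v2 - u2 * v1.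
set A := u1 ^+ 2 + u2 ^+ 2; set B := v1 ^+ 2 + v2 ^+ 2.
have A0 : 0 <= A by rewrite addr_ge0 ?sqr_ge0.
have B0 : 0 <= B by rewrite addr_ge0 ?sqr_ge0.
have hom : om ^+ 2 <= A * B.
  have := sqr_ge0 (u1 * v1 + u2 * v2); rewrite /om /A /B; lra.
have h1 : (u1 + v1) ^+ 2 + (u2 + v2) ^+ 2 <= 2 * (A + B).
  have := (sqr_ge0 (u1 - v1), sqr_ge0 (u2 - v2)); rewrite /A /B => -[? ?]; lra.
have h2 : ((u1 + v1) ^+ 2 + (u2 + v2) ^+ 2) ^+ 2 <= (2 * (A + B)) ^+ 2.
  rewrite lerXn2r ?nnegrE ?addr_ge0 ?sqr_ge0//; lra.
have h3 : (t1 + t2 - 2 * om) ^+ 2 <= 3 * (t1 ^+ 2 + t2 ^+ 2 + 4 * om ^+ 2).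
  by have := (sqr_ge0 (t1 - t2), sqr_ge0 (t1 + 2 * om), sqr_ge0 (t2 + 2 * om)) => -[[? ?] ?]; lra.
have := (sqr_ge0 (A - B), sqr_ge0 t1, sqr_ge0 t2) => -[[? ?] ?].
lra.
Qed.

Lemma density_eq0 w : density w = 0 ->
  a * w.1 + (b - 1) * w.2 = 0 /\ (b + 1) * w.1 + d * w.2 = 0.
Proof.
move=> h; have : density w ^+ 2 = 0 by rewrite h expr0n.
rewrite sqr_sqrtr ?addr_ge0 ?sqr_ge0// => /eqP.
by rewrite paddr_eq0 ?sqr_ge0// !sqrf_eq0 => /andP[/eqP-> /eqP->].
Qed.

(* On the characteristic line the quadratic form vanishes, since <J h, h> = 0. *)
Lemma characteristic_dist w w' : density w = 0 -> density w' = 0 ->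
  dist w w' = ((w'.1 - w.1) ^+ 2 + (w'.2 - w.2) ^+ 2) ^+ 2.
Proof.
move=> /density_eq0[h1 h2] /density_eq0[h1' h2'].
rewrite /graph_dist (_ : quad a b d w' - quad a b d w + _ =
  (a * w'.1 + (b - 1) * w'.2 + (a * w.1 + (b - 1) * w.2)) * (w'.1 - w.1) +
  ((b + 1) * w'.1 + d * w'.2 + ((b + 1) * w.1 + d * w.2)) * (w'.2 - w.2)).
  by rewrite h1 h2 h1' h2' !addr0 !mul0r addr0 expr0n/= addr0.
by rewrite /quad; ring.
Qed.

(** The entries b - 1 and b + 1 of A never vanish together, so the kernel of A is at most a line and
    one of the two coordinates parametrises it. *)
Lemma characteristic_coordinate : exists (l : R * R -> R) (k : R),
  [/\ measurable_fun setT l, 0 <= k & forall w w', density w = 0 -> density w' = 0 ->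
    (w'.1 - w.1) ^+ 2 + (w'.2 - w.2) ^+ 2 <= k * (l w' - l w) ^+ 2].
Proof.
have [b1|b1] := eqVneq (b - 1) 0.
  have b2 : b + 1 != 0 by rewrite (_ : b + 1 = 2); [|lra].
  exists snd, (1 + (d / (b + 1)) ^+ 2); split.
  - exact: measurable_snd.
  - by rewrite addr_ge0 ?sqr_ge0.
  move=> w w' /density_eq0[_ h2] /density_eq0[_ h2'].
  have -> : w'.1 - w.1 = - (d / (b + 1)) * (w'.2 - w.2).
    apply: (mulfI b2).
    transitivity (- (d * (w'.2 - w.2))); last by field.
    lra.
  by rewrite exprMn sqrrN; lra.
exists fst, (1 + (a / (b - 1)) ^+ 2); split.
- exact: measurable_fst.
- by rewrite addr_ge0 ?sqr_ge0.
move=> w w' /density_eq0[h2 _] /density_eq0[h2' _].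
have -> : w'.2 - w.2 = - (a / (b - 1)) * (w'.1 - w.1).
  apply: (mulfI b1).
  transitivity (- (a * (w'.1 - w.1))); last by field.
  lra.
by rewrite exprMn sqrrN; lra.
Qed.

End graph_dist_theory.

Section characteristic_null.
Context {R : realType}.
Variables a b d : R.
Local Notation dist := (graph_dist a b d).
Local Notation density := (graph_density a b d).
Variable nu : {measure set (R * R) -> \bar R}.
Variable c : R.
Hypothesis c0 : 0 < c.
Hypothesis nu_ball : forall (z : R * R) (r : R), 0 < r ->
  nu [set w | dist z w <= r ^+ 4] = (c * r ^+ 3)%:E.

Let char_set := [set w : R * R | density w = 0].

Let m_char : measurable char_set.
Proof.
rewrite -[char_set]setTI; exact: (measurable_graph_density a b d measurableT (measurable_set1 (0 : R))).
Qed.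

(* The characteristic set is a line (or a point) on which d_H is Euclidean, so a
   segment is covered by N balls of radius 1/N, of total mass N * N^-3. *)
Lemma characteristic_null : nu [set w | density w = 0] = 0%E.
Proof.
have [l [k [ml k0 hl]]] := characteristic_coordinate a b d.
pose s := 1 + k.
(* As k <= s^2, two characteristic points whose l-values differ by at most 1/n lie within distance s
   / n. *)
have s_gt0 : 0 < s by rewrite /s; lra.
pose N (M : nat) := char_set `&` [set w | `|l w| <= M%:R].
have mN M : measurable (N M).
  apply: measurableI => //; rewrite -[X in measurable X]setTI.
  by apply: measurable_fun_le => //; exact: measurableT_comp.
have N0 M : nu (N M) = 0%E.
  apply: (@le_eps_eq0 _ _ ((2 * M%:R + 1) * (c * s ^+ 3))) => // e /andP[e0 e1].
  (* With 1/n <= e, the at most 2 M n + 1 pieces have total mass at most (2 M n + 1) c (s / n)^3,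
     which is even O(e^2). *)
  pose n := (Num.truncn (e^-1)).+1.
  have n0 : 0 < n%:R :> R by rewrite ltr0n.
  have ne : n%:R^-1 <= e.
    have ei : 0 < e^-1 by rewrite invr_gt0.
    have /andP[_ h] := truncn_itv (ltW ei).
    by rewrite -[leRHS]invrK lef_pV2 ?posrE//; exact: ltW.
  pose C (j : nat) := char_set `&` [set w | j%:R <= (l w + M%:R) * n%:R]
     `&` [set w | (l w + M%:R) * n%:R <= j.+1%:R].
  have mC j : measurable (C j).
    have ml' : measurable_fun setT (fun w => (l w + M%:R) * n%:R).
      by apply: measurable_funM => //; exact: measurable_funD.
    apply: measurableI; first apply: measurableI => //.
    - by rewrite -[X in measurable X]setTI; apply: measurable_fun_le.
    - by rewrite -[X in measurable X]setTI; apply: measurable_fun_le.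
  have nuC j : (nu (C j) <= (c * (s / n%:R) ^+ 3)%:E)%E.
    have [/eqP C0|/set0P[w0 [[w0c w01] w02]]] := boolP (C j == set0).
      rewrite C0 measure0 lee_fin; apply: mulr_ge0; first exact: ltW.
      by rewrite exprn_ge0// divr_ge0// ltW.
    have sn0 : 0 < s / n%:R by rewrite divr_gt0.
    rewrite -(nu_ball w0 sn0); apply: le_measure; rewrite ?inE//.
      exact: measurable_graph_ball.
    move=> w [[wc w1] w2] /=; rewrite characteristic_dist//.
    have h1 := hl w0 w w0c wc; rewrite /= in w01 w02 w1 w2.
    have h2 : `|(l w - l w0) * n%:R| <= 1.
      rewrite ler_norml; move: w1 w2 w01 w02; rewrite -natr1 => ? ? ? ?.
      by apply/andP; split; lra.
    have h3 : (l w - l w0) ^+ 2 <= n%:R^-1 ^+ 2.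
      rewrite exprVn -[leRHS]mul1r ler_pdivlMr ?exprn_gt0// -exprMn.
      by rewrite -real_normK ?num_real// expr_le1.
    rewrite (exprM _ 2 2) lerXn2r ?nnegrE ?sqr_ge0 ?addr_ge0 ?sqr_ge0//.
    apply: (le_trans h1); rewrite exprMn; apply: ler_pM => //; first exact: sqr_ge0.
    by rewrite /s; have := sqr_ge0 k; lra.
  have sub : N M `<=` \big[setU/set0]_(j < (2 * M * n).+1) C j.
    move=> w [wc /= wM]; rewrite -bigcup_mkord.
    have x0 : 0 <= (l w + M%:R) * n%:R.
      by rewrite mulr_ge0//; move: wM; rewrite ler_norml => /andP[]; lra.
    have /andP[t1 t2] := truncn_itv x0.
    exists (Num.truncn ((l w + M%:R) * n%:R)) => /=.
      rewrite ltnS -(ler_nat R); apply: (le_trans t1).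
      rewrite natrM ler_pM2r// natrM.
      by move: wM; rewrite ler_norml => /andP[]; lra.
    by split; [split|exact: ltW].
  apply: (@le_trans _ _ (\sum_(j < (2 * M * n).+1) nu (C j))%E).
    apply: le_trans (Boole_inequality nu _) => //.
    apply: le_measure; rewrite ?inE//.
    by apply: bigsetU_measurable.
  apply: (@le_trans _ _ (\sum_(j < (2 * M * n).+1) (c * (s / n%:R) ^+ 3)%:E)%E).
    exact: lee_sum.
  rewrite sumEFin lee_fin sumr_const card_ord -[_ *+ _]mulr_natl -natr1 !natrM.
  have n1 : n%:R^-1 <= 1 :> R by rewrite invf_le1// ler1n.
  have i0 : 0 <= n%:R^-1 :> R by rewrite invr_ge0.
  have s0 : 0 <= c * s ^+ 3 by apply: mulr_ge0; rewrite ?exprn_ge0//; exact: ltW.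
  have -> : (2 * M%:R * n%:R + 1) * (c * (s / n%:R) ^+ 3) =
      (2 * M%:R + n%:R^-1) * n%:R^-1 * (n%:R^-1 * (c * s ^+ 3)).
    by field; rewrite gt_eqF.
  have -> : (2 * M%:R + 1) * (c * s ^+ 3) * e = (2 * M%:R + 1) * (e * (c * s ^+ 3)) by ring.
  have M0 : 0 <= M%:R :> R by [].
  apply: ler_pM.
  - by rewrite mulr_ge0//; lra.
  - by rewrite mulr_ge0.
  - rewrite -[leRHS]mulr1; apply: ler_pM => //; lra.
  - by rewrite ler_wpM2r.
apply/negligibleP => //.
have -> : [set w | density w = 0] = \bigcup_M N M.
  apply/seteqP; split=> w /=; last by move=> [M _ []].
  move=> w0; exists (Num.truncn `|l w|).+1 => //; split=> //=.
  by have /andP[_ /ltW] := truncn_itv (normr_ge0 (l w)).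
apply: negligible_bigcup => M; apply/negligibleP; [exact: mN|exact: N0].
Qed.

End characteristic_null.

Lemma lebesgue2_sigma_finite {R : realType} :
  exists m : {sigma_finite_measure set (measurableTypeR R * measurableTypeR R)%type -> \bar R},
    m = (lebesgue_measure \x lebesgue_measure)%E :> (set _ -> \bar R).
Proof.
pose m2 : {measure set (measurableTypeR R * measurableTypeR R)%type -> \bar R} :=
  (@lebesgue_measure R \x @lebesgue_measure R)%E.
pose I (n : nat) : set R := `[- n%:R, n%:R]%classic.
apply: (@sigma_finite_measure_pack _ _ _ m2).
exists (fun n => I n `*` I n).
  apply/seteqP; split=> // z _.
  have /andP[_ h1] := truncn_itv (normr_ge0 z.1).
  have /andP[_ h2] := truncn_itv (normr_ge0 z.2).
  pose n := maxn (Num.truncn `|z.1|).+1 (Num.truncn `|z.2|).+1.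
  exists n => //; split; rewrite /I /= in_itv /= -ler_norml.
    by apply: (le_trans (ltW h1)); rewrite ler_nat leq_maxl.
  by apply: (le_trans (ltW h2)); rewrite ler_nat leq_maxr.
have mI n : measurable (I n : set (measurableTypeR R)) by exact: measurable_itv.
move=> n; split; first by apply: measurableX; exact: mI.
rewrite [X in (X < _)%E](_ : _ = (lebesgue_measure (I n) * lebesgue_measure (I n))%E).
  rewrite /I lebesgue_measure_itv /=; case: ifP => _; last by rewrite mule0 ltry.
  by rewrite -EFinB -EFinM ltry.
exact: product_measure1E.
Qed.

Section tonelli_lebesgue2.
Context dsp (Y : measurableType dsp) (R : realType).
Variable nu : {sigma_finite_measure set Y -> \bar R}.
Local Notation leb2 := (@lebesgue_measure R \x @lebesgue_measure R)%E.
Variable F : (R * R) * Y -> \bar R.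
Hypotheses (mF : measurable_fun setT F) (F0 : forall x, (0 <= F x)%E).

Lemma tonelli_lebesgue2 :
  (\int[leb2]_z \int[nu]_w F (z, w) = \int[nu]_w \int[leb2]_z F (z, w))%E.
Proof.
have [m <-] := @lebesgue2_sigma_finite R.
exact: (fubini_tonelli (m1 := m) (m2 := nu) F mF F0).
Qed.

Lemma measurable_fun_integral_lebesgue2 :
  measurable_fun setT (fun w => \int[leb2]_z F (z, w))%E.
Proof.
have [m <-] := @lebesgue2_sigma_finite R.
exact: (measurable_fun_fubini_tonelli_G (m1 := m) F mF F0).
Qed.

End tonelli_lebesgue2.

(** * Constancy of the potential *)

Section potential.
Context {R : realType}.
Variables a b d : R.
Local Notation dist := (graph_dist a b d).
Local Notation density := (graph_density a b d).
Local Notation leb := (@lebesgue_measure R).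
Local Notation leb2 := (leb \x leb)%E.
Variable nu : {sigma_finite_measure set (R * R)%type -> \bar R}.
Variable c : R.
Hypothesis c0 : 0 < c.
Hypothesis nu_ball : forall (z : R * R) (r : R), 0 < r ->
  nu [set w | dist z w <= r ^+ 4] = (c * r ^+ 3)%:E.

Let K := kernel_mass a b d nu.
Let T := integral2 (fun z : R * R => expR (- tangent_dist z)).

Variable x0 : R * R.

Let V := integral2 (fun z => density z * expR (- dist x0 z)).

Let F (r : R) (zw : (R * R) * (R * R)) : \bar R :=
  (density zw.1 * expR (- (dist zw.2 zw.1 / r ^+ 4)) * expR (- dist x0 zw.1))%:E.

Let H (r : R) (w : R * R) :=
  integral2 (fun z => density z * expR (- (dist w z / r ^+ 4)) * expR (- dist x0 z)).

Let mF r : measurable_fun setT (F r).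
Proof.
by apply/measurable_EFinP; rewrite /graph_density /graph_dist /quad; measurability.
Qed.

Let F0 r zw : (0 <= F r zw)%E.
Proof. by rewrite lee_fin !mulr_ge0 ?expR_ge0 ?sqrtr_ge0. Qed.

Let phi_le1 z : expR (- dist x0 z) <= 1.
Proof. by rewrite -expR0 ler_expR oppr_le0 graph_dist_ge0. Qed.

Let integrable_H r w : 0 < r -> integrable2 (fun z =>
  density z * expR (- (dist w z / r ^+ 4)) * expR (- dist x0 z)).
Proof.
move=> r0; apply: le_integrable2 (integrable2_kernel a b d w r0) _.
  by rewrite /graph_density /graph_dist /quad; measurability.
move=> z; rewrite ger0_norm; last by rewrite !mulr_ge0 ?expR_ge0 ?sqrtr_ge0.
by rewrite ler_piMr// mulr_ge0 ?expR_ge0 ?sqrtr_ge0.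
Qed.

Let inner_H r w : 0 < r -> (\int[leb2]_z F r (z, w) = (H r w)%:E)%E.
Proof. by move=> r0; rewrite -integral2E//; exact: integrable_H. Qed.

Let integral_H r : 0 < r -> (\int[nu]_w (H r w)%:E = (r ^+ 3 * K * V)%:E)%E.
Proof.
move=> r0.
transitivity (\int[nu]_w \int[leb2]_z F r (z, w))%E.
  by apply: eq_integral => w _; rewrite inner_H.
rewrite -(tonelli_lebesgue2 nu (mF r) (F0 r)).
transitivity (\int[leb2]_z ((r ^+ 3 * K)%:E * (density z * expR (- dist x0 z))%:E))%E.
  apply: eq_integral => z _; rewrite /F /=.
  transitivity (\int[nu]_w ((density z * expR (- dist x0 z))%:E *
      (expR (- (dist z w / r ^+ 4)))%:E))%E.
    by apply: eq_integral => w _; rewrite -EFinM graph_distC; congr EFin; ring.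
  rewrite ge0_integralZl//.
  - by rewrite (integral_kernel c0 nu_ball z r0) muleC.
  - by apply/measurable_EFinP; rewrite /graph_dist /quad; measurability.
  - by rewrite lee_fin mulr_ge0 ?expR_ge0 ?sqrtr_ge0.
have IV : integrable2 (fun z => density z * expR (- dist x0 z)).
  by apply: eq_integrable2 (integrable2_kernel a b d x0 ltr01) => z; rewrite expr1n divr1.
rewrite ge0_integralZl//.
- by rewrite integral2E// -EFinM.
- by apply/measurable_EFinP; rewrite /graph_density /graph_dist /quad; measurability.
- by move=> z _; rewrite lee_fin mulr_ge0 ?expR_ge0 ?sqrtr_ge0.
- by rewrite lee_fin mulr_ge0 ?exprn_ge0// ltW// (kernel_mass_gt0 c0 nu_ball).
Qed.

(** Domination for the passage to the limit. Passing from scale r to 2 r frees the decay of (15/16)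
    P w z / r^4 in the exponent. Together with e^(- P x0 z) this pays, through the quasi-triangle
    inequality, for the integrable factor e^(- P x0 w / 16). *)
Let H_le : exists C, forall r w, 0 < r <= 1 / 2 ->
  `|H r w / r ^+ 3| <= C * expR (- (dist x0 w / 2 ^+ 4)).
Proof.
have [C [C0 HC]] := kernel_bound a b d.
exists (8 * C) => r w /andP[r0 r1].
have r30 : 0 < r ^+ 3 by rewrite exprn_gt0.
have r40 : 0 < r ^+ 4 by rewrite exprn_gt0.
have H0 : 0 <= H r w by apply: integral2_ge0 => z; rewrite !mulr_ge0 ?expR_ge0 ?sqrtr_ge0.
rewrite ger0_norm; last by rewrite divr_ge0// ltW.
rewrite ler_pdivrMr//.
have r20 : 0 < 2 * r by rewrite mulr_gt0.
have hC := HC w (2 * r) r20.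
set E := expR (- (dist x0 w / 2 ^+ 4)).
have := ler_wpM2l (expR_ge0 (- (dist x0 w / 2 ^+ 4))) hC; rewrite -/E => hC'.
have -> : 8 * C * E * r ^+ 3 = E * (C * (2 * r) ^+ 3) by ring.
apply: le_trans hC'; rewrite -integral2Z; last exact: integrable2_kernel.
apply: le_integral2; first exact: integrable_H.
  by apply: integrable2Z; exact: integrable2_kernel.
move=> z; rewrite -mulrA [leRHS]mulrCA; apply: ler_wpM2l; first exact: sqrtr_ge0.
rewrite /E -!expRD ler_expR.
have dw := graph_dist_ge0 a b d w z; have dx := graph_dist_ge0 a b d x0 z.
have := graph_dist_quasi_triangle a b d x0 z w; rewrite (graph_distC a b d z w) => tri.
have r4 : r ^+ 4 <= 1 / 16.
  have : r ^+ 4 <= (1 / 2) ^+ 4 by rewrite lerXn2r ?nnegrE//; lra.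
  by rewrite !exprS expr0; lra.
have split4 : dist w z / r ^+ 4 = dist w z / (2 * r) ^+ 4 + 15 / 16 * (dist w z / r ^+ 4).
  by field; rewrite gt_eqF.
have big : dist w z <= 15 / 16 * (dist w z / r ^+ 4).
  have h : 15 <= (r ^+ 4)^-1.
    rewrite -[15]invrK lef_pV2 ?posrE//; lra.
  have := ler_wpM2l dw h; lra.
have dxw := graph_dist_ge0 a b d x0 w.
rewrite !exprS expr0 in tri split4 big *; lra.
Qed.

Lemma potential_eq : V = T / 2.
Proof.
have [C HC] := H_le.
(* Starting at 1/2, the range in which [H_le] dominates. *)
pose r (n : nat) : R := n.+2%:R^-1.
have r0 n : 0 < r n by rewrite invr_gt0.
have r1 n : 0 < r n <= 1 / 2.
  by rewrite r0 /= mul1r lef_pV2 ?posrE// ler_nat.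
pose f_ n w : \bar R := (H (r n) w / r n ^+ 3)%:E.
pose f w : \bar R := (T / 2 * expR (- dist x0 w))%:E.
pose g w : \bar R := (C * expR (- (dist x0 w / 2 ^+ 4)))%:E.
have mH n : measurable_fun setT (fun w => (H (r n) w)%:E).
  have := measurable_fun_integral_lebesgue2 (mF (r n)) (F0 (r n)).
  by rewrite (_ : (fun w => _) = fun w => (H (r n) w)%:E)//; apply/funext => w; exact: inner_H.
have mf_ n : measurable_fun setT (f_ n).
  have mHr : measurable_fun setT (H (r n)) by apply/measurable_EFinP; exact: mH.
  by apply/measurable_EFinP; exact: measurable_funM.
have mf : measurable_fun setT f.
  by apply/measurable_EFinP; rewrite /graph_dist /quad; measurability.
have ig : nu.-integrable setT g.
  apply/integrableP; split.
    by apply/measurable_EFinP; rewrite /graph_dist /quad; measurability.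
  rewrite (eq_integral (fun w => `|C|%:E * (expR (- (dist x0 w / 2 ^+ 4)))%:E)%E); last first.
    by move=> w _; rewrite /g /= normrM (ger0_norm (expR_ge0 _)).
  rewrite ge0_integralZl//.
  - by rewrite (integral_kernel c0 nu_ball x0 (ltr0Sn R 1)) -EFinM ltry.
  - by apply/measurable_EFinP; rewrite /graph_dist /quad; measurability.
have cvg_f : {ae nu, forall w, setT w -> f_ ^~ w @ \oo --> f w}.
  exists [set w | density w = 0]; split.
  - rewrite -[X in measurable X]setTI.
    exact: (measurable_graph_density a b d measurableT (measurable_set1 (0 : R))).
  - exact: (characteristic_null c0 nu_ball).
  move=> w /= hw; apply: contrapT => w0; apply: hw => _.
  have lam0 : 0 < density w by rewrite lt_neqAle sqrtr_ge0 andbT eq_sym; apply/eqP.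
  have [C' hC'] := kernel_concentration x0 lam0.
  apply: cvg_EFin; first by apply: nearW.
  apply/cvgrPdist_le => e e0.
  have C1 : 0 < `|C'| + 1 by rewrite ltr_wpDl.
  have small (x : R) : 0 < x -> \forall n \near \oo, r n <= x.
    move=> x_gt0; near=> n; apply: (@le_trans _ _ n.+1%:R^-1).
      by rewrite lef_pV2 ?posrE// ler_nat.
    by apply: ltW; near: n; exact: (near_infty_natSinv_lt (PosNum x_gt0)).
  near=> n.
  have rn1 : r n <= density w by near: n; exact: small.
  have rn2 : r n <= e / (`|C'| + 1) by near: n; apply: small; exact: divr_gt0.
  have := hC' (r n); rewrite r0 rn1 distrC => /(_ isT); move=> h; apply: (le_trans h).
  apply: (@le_trans _ _ (`|C'| * r n)).
    by rewrite ler_wpM2r ?ler_norm// ltW.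
  rewrite ler_pdivlMr// in rn2; apply: le_trans rn2.
  by rewrite mulrDr mulr1 mulrC lerDl ltW.
have dom : {ae nu, forall w n, setT w -> (`|f_ n w| <= g w)%E}.
  by apply: aeW => w n _; rewrite /f_ /g lee_fin; exact: HC.
have [_ _ lim] := dominated_convergence measurableT mf_ mf cvg_f ig dom.
have K0 : 0 < K := kernel_mass_gt0 c0 nu_ball.
have fn_int n : (\int[nu]_w f_ n w = (K * V)%:E)%E.
  have r3 : 0 < r n ^+ 3 by rewrite exprn_gt0.
  transitivity (\int[nu]_w ((r n ^+ 3)^-1%:E * (H (r n) w)%:E))%E.
    by apply: eq_integral => w _; rewrite -EFinM mulrC.
  rewrite ge0_integralZl//.
  - rewrite integral_H// -EFinM; congr EFin; field.
    by rewrite gt_eqF.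
  - by move=> w _; rewrite lee_fin; apply: integral2_ge0 => z; rewrite !mulr_ge0 ?expR_ge0 ?sqrtr_ge0.
  - by rewrite lee_fin invr_ge0 ltW.
have f_int : (\int[nu]_w f w = (T / 2 * K)%:E)%E.
  transitivity (\int[nu]_w ((T / 2)%:E * (expR (- (dist x0 w / 1 ^+ 4)))%:E))%E.
    by apply: eq_integral => w _; rewrite -EFinM expr1n divr1.
  rewrite ge0_integralZl//.
  - by rewrite (integral_kernel c0 nu_ball x0 ltr01) expr1n mul1r.
  - by apply/measurable_EFinP; rewrite /graph_dist /quad; measurability.
  - by rewrite lee_fin divr_ge0// /T; apply: integral2_ge0 => z; exact: expR_ge0.
have lim' : (fun=> (K * V)%:E) @ \oo --> (T / 2 * K)%:E.
  by move: lim; rewrite f_int (_ : [sequence _]_n = fun=> (K * V)%:E)//; apply/funext => n; exact: fn_int.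
have : (K * V)%:E = (T / 2 * K)%:E by apply: (cvg_unique _ (cvg_cst _) lim').
by move=> [] /(congr1 (fun x => K^-1 * x)); rewrite mulKf ?gt_eqF// => ->; field; rewrite gt_eqF.
Unshelve. all: by end_near.
Qed.

End potential.

(** * The Koranyi metric and the projection of measures *)

Section koranyi_borel.
Context {R : realType}.
Implicit Types x y : heis R.

Lemma koranyi_dist4 x y : koranyi_dist x y ^+ 4 =
  ((y.1.1 - x.1.1) ^+ 2 + (y.1.2 - x.1.2) ^+ 2) ^+ 2 +
  (y.2 - x.2 + 2 * (x.1.1 * y.1.2 - x.1.2 * y.1.1)) ^+ 2.
Proof.
by rewrite /koranyi_dist koranyi_norm4 /heis_mul /heis_inv /=; ring.
Qed.

Lemma koranyi_dist_ge0 x y : 0 <= koranyi_dist x y.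
Proof. exact: koranyi_norm_ge0. Qed.

Lemma koranyi_dist_small x (r : R) : 0 < r -> exists2 del : R, 0 < del &
  forall y, `|y.1.1 - x.1.1| < del -> `|y.1.2 - x.1.2| < del -> `|y.2 - x.2| < del ->
    koranyi_dist x y <= r.
Proof.
move=> r0.
pose L := 1 + 2 * `|x.1.1| + 2 * `|x.1.2|.
have L0 : 0 <= L by rewrite !addr_ge0// mulr_ge0.
have L4 : 0 < 4 + L ^+ 2 by have := sqr_ge0 L; lra.
have r4 : 0 < r ^+ 4 by rewrite exprn_gt0.
pose del := Num.min 1 (r ^+ 4 / (4 + L ^+ 2)).
have del0 : 0 < del by rewrite lt_min ltr01 divr_gt0.
have del1 : del <= 1 by rewrite ge_min lexx.
have del2 : del * (4 + L ^+ 2) <= r ^+ 4.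
  by rewrite -ler_pdivlMr// ge_min lexx orbT.
exists del => // y /ltW h1 /ltW h2 /ltW h3.
have d0 := koranyi_dist_ge0 x y.
suff : koranyi_dist x y ^+ 4 <= r ^+ 4 by rewrite ler_pXn2r ?nnegrE// ltW.
rewrite koranyi_dist4; apply: le_trans del2.
set a1 := y.1.1 - x.1.1 in h1 *; set a2 := y.1.2 - x.1.2 in h2 *.
set a3 := y.2 - x.2 in h3 *.
have -> : x.1.1 * y.1.2 - x.1.2 * y.1.1 = x.1.1 * a2 - x.1.2 * a1.
  by rewrite /a1 /a2; ring.
have sq (u : R) : `|u| <= del -> u ^+ 2 <= del.
  move=> hu; rewrite -real_normK ?num_real//; apply: (@le_trans _ _ (del ^+ 2)).
    by rewrite ler_pXn2r ?nnegrE// ltW.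
  by rewrite expr2; apply: ler_piMl => //; exact: ltW.
have b1 : (a1 ^+ 2 + a2 ^+ 2) ^+ 2 <= 4 * del.
  have := sq _ h1; have := sq _ h2; have := sqr_ge0 a1; have := sqr_ge0 a2.
  move=> p1 p2 q1 q2.
  have h : (a1 ^+ 2 + a2 ^+ 2) ^+ 2 <= (2 * del) ^+ 2 by rewrite lerXn2r ?nnegrE//; lra.
  apply: (le_trans h); rewrite exprMn.
  have : del ^+ 2 <= del by rewrite expr2; apply: ler_piMl => //; exact: ltW.
  by rewrite !exprS expr0; lra.
have b2 : `|a3 + 2 * (x.1.1 * a2 - x.1.2 * a1)| <= del * L.
  apply: (le_trans (ler_normD _ _)); rewrite normrM (ger0_norm (ler0n _ 2)).
  have k1 := ler_normB (x.1.1 * a2) (x.1.2 * a1); rewrite !normrM in k1.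
  have k2 := ler_wpM2l (normr_ge0 x.1.1) h2.
  have k3 := ler_wpM2l (normr_ge0 x.1.2) h1.
  rewrite /L; lra.
have b3 : (a3 + 2 * (x.1.1 * a2 - x.1.2 * a1)) ^+ 2 <= del * L ^+ 2.
  rewrite -real_normK ?num_real//; apply: (@le_trans _ _ ((del * L) ^+ 2)).
    by rewrite lerXn2r ?nnegrE// mulr_ge0// ltW.
  rewrite exprMn ler_wpM2r ?sqr_ge0// expr2; apply: ler_piMl => //; exact: ltW.
by rewrite mulrDr; lra.
Qed.

Lemma measurable_koranyi_ball x (r : R) : measurable (koranyi_ball x r).
Proof.
rewrite -[X in measurable X]setTI; apply: measurable_fun_le => //.
by rewrite /koranyi_dist /koranyi_norm /heis_mul /heis_inv /=; measurability.
Qed.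

(* The sigma-algebra inferred for [heis_borel R] is the product one, which has the
   same measurable sets since the Koranyi metric induces the Euclidean topology. *)
Variable mu : {measure set (heis_borel R) -> \bar R}.

(* Second countability: the complement is covered by countably many null boxes
   with rational centre. *)
Lemma spt_complement_null : mu.-negligible (~` spt mu).
Proof.
pose rad (n : nat) : R := n.+1%:R^-1.
pose box (p : rat * rat * rat * nat) : set (heis R) :=
  [set y | `|y.1.1 - ratr p.1.1.1| <= rad p.2] `&`
  [set y | `|y.1.2 - ratr p.1.1.2| <= rad p.2] `&`
  [set y | `|y.2 - ratr p.1.2| <= rad p.2].
have mbox p : measurable (box p).
  apply: measurableI; first apply: measurableI;
    rewrite -[X in measurable X]setTI; apply: measurable_fun_le => //;
    (apply: (measurableT_comp (@normr_measurable R setT)); by measurability).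
(* The rational boxes are enumerated by their codes; every code of a box of positive mass, and every
   number that is no code, contributes the empty set. *)
pose F (k : nat) : set (heis R) := if unpickle k is Some p then
  (if `[< mu (box p) = 0%E >] then box p else set0) else set0.
apply: (@negligibleS _ _ _ mu (\bigcup_k F k)); last first.
  apply: negligible_bigcup => k; rewrite /F; case: unpickle => [p|]; last exact: negligible_set0.
  by case: asboolP => [h|_]; [apply/negligibleP|exact: negligible_set0].
move=> y /existsNP[r /not_implyP[r0 /negP]]; rewrite -leNgt => mu0.
have [del del0 hdel] := koranyi_dist_small y r0.
(* A box containing y stays within twice its radius of y in each coordinate, so 2 rad n <= del puts
   it inside the null ball. *)
pose n := Num.truncn (2 / del).
have rn : 2 * rad n <= del.
  have d20 : 0 < 2 / del by rewrite divr_gt0.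
  have /andP[_ /ltW] := truncn_itv (ltW d20).
  rewrite /rad ler_pdivrMr// => h; rewrite ler_pdivrMr ?ltr0n// mulrC.
  exact: h.
have rad0 : 0 < rad n by rewrite /rad invr_gt0.
have approx (u : R) : exists p : rat, `|u - ratr p| < rad n.
  have [p] := @rat_in_itvoo R (u - rad n) (u + rad n) ltac:(lra).
  rewrite in_itv/= => /andP[p1 p2]; exists p; rewrite ltr_norml; apply/andP; split; lra.
have [p1 hp1] := approx y.1.1; have [p2 hp2] := approx y.1.2; have [p3 hp3] := approx y.2.
pose p := (p1, p2, p3, n).
exists (pickle p); [exact: I|rewrite /F pickleK]; case: asboolP => [_|]; first by split; [split|]; exact: ltW.
case.
apply/eqP; rewrite eq_le measure_ge0 andbT; apply: le_trans mu0.
apply: le_measure; rewrite ?inE//; first exact: measurable_koranyi_ball.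
move=> w [[/= w1 w2] w3]; apply: hdel.
- move: hp1 w1; rewrite !ltr_norml ler_norml => /andP[? ?] /andP[? ?]; apply/andP; split; lra.
- move: hp2 w2; rewrite !ltr_norml ler_norml => /andP[? ?] /andP[? ?]; apply/andP; split; lra.
- move: hp3 w3; rewrite !ltr_norml ler_norml => /andP[? ?] /andP[? ?]; apply/andP; split; lra.
Qed.

End koranyi_borel.

(** * Rigidity *)

Section constant_potential.
Context {R : realType}.
Variables a b d : R.
Hypothesis potential_constant : forall x,
  integral2 (fun z => graph_density a b d z * expR (- graph_dist a b d x z)) =
  integral2 (fun z => expR (- @tangent_dist R z)) / 2.

(* The potential is expanded at [z / e] as [e] tends to [0], i.e. far out in the
   direction [z]. *)
Lemma direction_condition (z : R * R) (t1 t2 : R) : t1 ^+ 2 + t2 ^+ 2 = 1 ->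
  a * z.1 + (b - 1) * z.2 = - t2 -> (b + 1) * z.1 + d * z.2 = t1 ->
  frame_q a b d t1 t2 ^+ 2 = 2 + 8 * frame_m a b d t1 t2.
Proof.
move=> t_unit z1 z2; apply: (@far_condition _ _ _ (frame_p a b d t1 t2)) => e /andP[e0 _].
have e0' : e != 0 by rewrite gt_eqF.
(* Here |A y| = 1 / e, so the frame at y with r = 1 has blow-up parameter r / lam = e: going to
   infinity at unit scale is the same as zooming in. *)
pose y := (z.1 / e, z.2 / e).
have Ay1 : a * y.1 + (b - 1) * y.2 = - (e^-1 * t2).
  by rewrite /y /= -[t2]opprK -z1; field.
have Ay2 : (b + 1) * y.1 + d * y.2 = e^-1 * t1.
  by rewrite /y /= -z2; field.
have l0 : 0 < e^-1 by rewrite invr_gt0.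
have Ek w : graph_density a b d w * expR (- (graph_dist a b d y w / 1 ^+ 4)) * 1 =
    graph_density a b d w * expR (- graph_dist a b d y w).
  by rewrite expr1n divr1 mulr1.
have If : integrable2 (fun w => graph_density a b d w *
    expR (- (graph_dist a b d y w / 1 ^+ 4)) * 1).
  apply: (eq_integrable2 _ (integrable2_kernel a b d y ltr01)) => w.
  by rewrite mulr1.
have [_] := integral2_frame l0 t_unit Ay1 Ay2 (psi := fun=> 1) ltr01 If.
rewrite (eq_integral2 Ek) potential_constant expr1n mul1r => I1.
have -> : integral2 (fun w => blow_density (frame_q a b d t1 t2) (frame_m a b d t1 t2)
    (frame_p a b d t1 t2) e w * expR (- blow_dist (frame_q a b d t1 t2)
    (frame_m a b d t1 t2) (frame_p a b d t1 t2) e w)) =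
    integral2 (fun w => blow_density (frame_q a b d t1 t2) (frame_m a b d t1 t2)
    (frame_p a b d t1 t2) (1 / e^-1) w * expR (- blow_dist (frame_q a b d t1 t2)
    (frame_m a b d t1 t2) (frame_p a b d t1 t2) (1 / e^-1) w) * 1).
  by apply: eq_integral2 => w; rewrite invrK mul1r mulr1.
by move: I1; lra.
Qed.

Let D := a * d - (b - 1) * (b + 1).

Lemma direction_condition_nondegenerate (t1 t2 : R) : D != 0 ->
  t1 ^+ 2 + t2 ^+ 2 = 1 -> frame_q a b d t1 t2 ^+ 2 = 2 + 8 * frame_m a b d t1 t2.
Proof.
move=> D0 t_unit.
apply: (@direction_condition ((- (d * t2) - (b - 1) * t1) / D, ((b + 1) * t2 + a * t1) / D));
  by rewrite //= /D; field.
Qed.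

Lemma constant_potential_nondegenerate : D != 0 -> [/\ d = a, b = 0 & a ^+ 2 = 2].
Proof.
(* The test directions are the two axes and the two diagonals (s, s) and (s, - s). *)
move=> D0; pose s : R := Num.sqrt (1 / 2).
have s2 : s ^+ 2 = 1 / 2 by rewrite sqr_sqrtr//; lra.
have cond t1 t2 := @direction_condition_nondegenerate t1 t2 D0.
have := cond 1 0; have := cond 0 1; have := cond s s; have := cond s (- s).
rewrite /frame_q /frame_m !sqrrN s2 => C4 C3 C2 C1.
have {C1}h1 : a ^+ 2 = 2 + 8 * b by have := C1 ltac:(ring); rewrite !exprS !expr0; lra.
have {C2}h2 : d ^+ 2 = 2 - 8 * b by have := C2 ltac:(ring); rewrite !exprS !expr0; lra.
have {C3}h3 : ((a + d) / 2 + b) ^+ 2 = 2 + 4 * (d - a).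
  have := C3 ltac:(lra).
  rewrite (_ : _ + d * (1 / 2) = (a + d) / 2 + 2 * b * s ^+ 2); last by ring.
  rewrite (_ : (b * s + d * s) * s - (a * s + b * s) * s = (d - a) * s ^+ 2); last by ring.
  rewrite s2 => h; rewrite (_ : b = 2 * b * (1 / 2)); last by field.
  by rewrite h; field.
have {C4}h4 : ((a + d) / 2 - b) ^+ 2 = 2 - 4 * (d - a).
  have := C4 ltac:(lra).
  rewrite (_ : _ + d * (1 / 2) = (a + d) / 2 - 2 * b * s ^+ 2); last by ring.
  rewrite (_ : (b * s + d * - s) * s - (a * s + b * - s) * - s = (a - d) * s ^+ 2);
    last by ring.
  rewrite s2 => h; rewrite (_ : b = 2 * b * (1 / 2)); last by field.
  by rewrite h; field.
(* Subtracting the conditions of two orthogonal directions couples a - d with b in two ways.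
   Eliminating b leaves the positive factor (a + d)^2 + 64, which forces a = d and then b = 0. *)
have k1 : (a - d) * (a + d) = 16 * b.
  by rewrite (_ : _ * _ = a ^+ 2 - d ^+ 2); [rewrite h1 h2|]; ring.
have k2 : (a + d) * b = - 4 * (a - d).
  have : 2 * ((a + d) * b) = ((a + d) / 2 + b) ^+ 2 - ((a + d) / 2 - b) ^+ 2 by field.
  rewrite h3 h4; lra.
have k3 : (a - d) * ((a + d) ^+ 2 + 64) = 0.
  have -> : (a - d) * ((a + d) ^+ 2 + 64) =
      (a + d) * ((a - d) * (a + d)) + 64 * (a - d) by ring.
  rewrite k1; have -> : (a + d) * (16 * b) = 16 * ((a + d) * b) by ring.
  by rewrite k2; ring.
have ad : a - d = 0.
  move/eqP: k3; rewrite mulf_eq0 => /orP[/eqP//|/eqP h].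
  by have := sqr_ge0 (a + d); lra.
have b0 : b = 0 by move: k1; rewrite ad mul0r; lra.
by split=> //; [lra|rewrite h1 b0; ring].
Qed.

(** If A is singular, its range is spanned by J t, so t is orthogonal to the range and lies in the
    kernel of the transpose S - J. Hence S t = J t, so q = 0 and m = 1, and the condition at
    infinity reads 0 = 10. *)
Lemma constant_potential_degenerate : D <> 0.
Proof.
move=> D0.
have [z z0] : exists z, 0 < graph_density a b d z.
  have [b1|b1] := eqVneq b 1.
    exists (1, 0); rewrite sqrtr_gt0 /= b1 ltr_wpDl ?sqr_ge0//.
    by rewrite mulr0 addr0 mulr1 exprn_gt0//; lra.
  exists (0, 1); rewrite sqrtr_gt0 /= ltr_pwDl ?sqr_ge0//.
  by rewrite mulr0 add0r mulr1 lt0r sqr_ge0 sqrf_eq0 subr_eq0 b1.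
have [t1 [t2 [t_unit z1 z2]]] := frame_exists z0.
set lam := graph_density a b d z in z0 z1 z2.
have l0 : lam != 0 by rewrite gt_eqF.
have cond : frame_q a b d t1 t2 ^+ 2 = 2 + 8 * frame_m a b d t1 t2.
  apply: (@direction_condition (z.1 / lam, z.2 / lam)) => //=.
  - by rewrite !mulrA -mulrDl z1; field.
  - by rewrite !mulrA -mulrDl z2; field.
have k1 : b * t1 + d * t2 = t1.
  apply/eqP; rewrite -subr_eq0; apply/eqP; apply: (mulfI l0); rewrite mulr0.
  transitivity ((b - 1) * (lam * t1) - d * - (lam * t2)); first by ring.
  by rewrite -z1 -z2; transitivity (- D * z.1); [rewrite /D; ring|rewrite D0; ring].
have k2 : a * t1 + b * t2 = - t2.
  apply/eqP; rewrite -subr_eq0; apply/eqP; apply: (mulfI l0); rewrite mulr0.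
  transitivity (a * (lam * t1) - (b + 1) * - (lam * t2)); first by ring.
  by rewrite -z1 -z2; transitivity (D * z.2); [rewrite /D; ring|rewrite D0; ring].
have q0 : frame_q a b d t1 t2 = 0.
  transitivity ((a * t1 + b * t2) * t1 + (b * t1 + d * t2) * t2); first by rewrite /frame_q; ring.
  by rewrite k1 k2; ring.
have m1 : frame_m a b d t1 t2 = 1 by rewrite /frame_m k1 k2 -t_unit; ring.
by move: cond; rewrite q0 m1; lra.
Qed.

End constant_potential.

Lemma potential_not_constant {R : realType} (a b d : R) : ~ forall x,
  integral2 (fun z => graph_density a b d z * expR (- graph_dist a b d x z)) =
  integral2 (fun z => expR (- @tangent_dist R z)) / 2.
Proof.
move=> H; have /eqP D0 := constant_potential_degenerate H.
have [da b0 a2] := constant_potential_nondegenerate H D0.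
rewrite da b0 in H; apply: (origin_condition a2) => z.
by rewrite !H.
Qed.

Lemma measure_eq_conegligible dsp (T : measurableType dsp) (R : realType)
    (mu : {measure set T -> \bar R}) (E A B : set T) :
  mu.-negligible (~` E) -> measurable A -> measurable B ->
  A `&` E = B `&` E -> mu A = mu B.
Proof.
move=> [N [mN N0 EN]] mA mB AB.
rewrite -(measureU0 mA mN N0) -(measureU0 mB mN N0); congr (mu _).
apply/seteqP; split=> x [] Hx; try by right.
- have [Ex|Ex] := pselect (E x); last by right; apply: EN.
  by left; have : (A `&` E) x by []; rewrite AB => -[].
- have [Ex|Ex] := pselect (E x); last by right; apply: EN.
  by left; have : (B `&` E) x by []; rewrite -AB => -[].
Qed.

Lemma pushforward_measure dsp dsp' (T : measurableType dsp) (T' : measurableType dsp')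
    (R : realType) (mu : {measure set T -> \bar R}) (f : T -> T') :
  measurable_fun setT f -> exists nu : {measure set T' -> \bar R},
  forall A, nu A = mu (f @^-1` A).
Proof.
move=> mf.
by unshelve refine (ex_intro _ (pushforward mu f : {measure set T' -> \bar R}) _).
Qed.

Section plane_projection.
Context {R : realType}.
Variable S : 'M[R]_2.
Hypothesis hS : S^T = S.
Local Notation a := (S 0 0).
Local Notation b := (S 0 1).
Local Notation d := (S 1 1).

Lemma quadratic_graphE : quadratic_graph S = [set x | x.2 = quad a b d x.1].
Proof.
have S10 : S 1 0 = b by rewrite -[in LHS]hS mxE.
have l1 : lift ord0 ord0 = 1 :> 'I_2 by exact/val_inj.
suff Q x : inner (horizontal x) (S *m horizontal x) = quad a b d x.1.
  by apply/seteqP; split=> x; rewrite /quadratic_graph /= Q.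
rewrite /inner !big_ord_recl !big_ord0 !mxE !big_ord_recl !big_ord0 !mxE l1 /= S10.
by rewrite /quad; ring.
Qed.

Let graph_pt (z : R * R) : heis R := (z.1, z.2, quad a b d z).

(** Every point of the plane lifts to a point of the support, so the ball condition holds at all
    centres z, as Tonelli against Lebesgue measure will require. The balls about the origin exhaust
    the plane with finite mass, whence sigma-finiteness. *)
Lemma plane_measure (mu : {measure set (heis_borel R) -> \bar R}) (c : R) :
  spt mu = quadratic_graph S ->
  (forall x, spt mu x -> forall r : R, 0 < r ->
     mu (koranyi_ball x r) = (c * r ^+ 3)%:E) ->
  exists nu : {sigma_finite_measure set (R * R)%type -> \bar R}, forall z (r : R), 0 < r ->
    nu [set w | graph_dist a b d z w <= r ^+ 4] = (c * r ^+ 3)%:E.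
Proof.
move=> sE mub; pose pi (y : heis_borel R) : R * R := (y.1.1, y.1.2).
have mpi : measurable_fun setT pi.
  by rewrite /pi; measurability.
have [nu0 nu0E] := pushforward_measure mu mpi.
have nu0_ball z (r : R) : 0 < r ->
    nu0 [set w | graph_dist a b d z w <= r ^+ 4] = (c * r ^+ 3)%:E.
  move=> r0; have sz : spt mu (graph_pt z).
    by rewrite sE quadratic_graphE /=; case: z.
  rewrite nu0E -(mub _ sz r r0); apply: (measure_eq_conegligible (spt_complement_null mu)).
  - rewrite -[X in measurable X]setTI; apply: mpi => //.
    exact: measurable_graph_ball.
  - exact: measurable_koranyi_ball.
  rewrite sE quadratic_graphE; apply/seteqP.
  have ball_graph (y : heis R) : y.2 = quad a b d y.1 ->
      (graph_dist a b d z (y.1.1, y.1.2) <= r ^+ 4) = (koranyi_dist (graph_pt z) y <= r).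
    case: y => -[y1 y2] y3 /= ->.
    rewrite -[RHS](@ler_pXn2r _ 4) ?nnegrE ?koranyi_dist_ge0 ?(ltW r0)// koranyi_dist4 /=.
    by case: z {sz}.
  by split=> y /= [hy Ey]; split=> //; move: hy; rewrite /koranyi_ball /= ball_graph.
have [nu nuE] : exists nu : {sigma_finite_measure set (R * R)%type -> \bar R},
    nu = nu0 :> (set (R * R)%type -> \bar R).
  apply: sigma_finite_measure_pack.
  exists (fun n : nat => [set w | graph_dist a b d (0, 0) w <= n.+1%:R ^+ 4]).
    apply/seteqP; split=> // w _.
    exists (Num.truncn (graph_dist a b d (0, 0) w)) => //=.
    have /andP[_ /ltW h] := truncn_itv (graph_dist_ge0 a b d (0, 0) w).
    by apply: (le_trans h); apply: ler_eXnr => //; rewrite ler1n.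
  move=> n; split; first exact: measurable_graph_ball.
  by rewrite nu0_ball ?ltry// ltr0n.
by exists nu => z r r0; rewrite nuE nu0_ball.
Qed.

End plane_projection.

Theorem proposition1p6 (R : realType) (S : 'M[R]_2) (hS : S^T = S) :
  ~ exists2 mu : {measure set (heis_borel R) -> \bar R},
      uniform_measure 3 mu & spt mu = quadratic_graph S.
Proof.
move=> [mu [_ [c c0 mub]] sE].
have [nu nub] := plane_measure hS sE mub.
by apply: (@potential_not_constant R (S 0 0) (S 0 1) (S 1 1)) => x; exact: potential_eq nub x.
Qed.
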